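(* Let $f:\mathbb{R}^m\times\mathbb{R}^n\to\mathbb{R}$ be $\ell$-smooth, let $\mathcal{X}\subset\mathbb{R}^m$ and $\mathcal{Y}\subset\mathbb{R}^n$ be nonempty, closed, convex and bounded, and assume that $f(\cdot,y)$ is $\mu_x$-strongly convex for each $y\in\mathcal{Y}$, with $\mu_x>0$, and $f(x,\cdot)$ is concave for each $x\in\mathcal{X}$. Let $x_0\in\mathcal{X}$, $y_0\in\mathcal{Y}$, $\epsilon>0$, and define $$f_{\epsilon,y}(x,y)=f(x,y)-\frac{\epsilon}{4D_y^2}\|y-y_0\|^2 .$$ Then there exists $T>0$ such that the output $(\hat x,\hat y)=\text{Minimax-APPA}(f_{\epsilon,y},x_0,y_0,\ell,\mu_x,\epsilon/(4D_y^2),\epsilon/2,T)$ is an $\epsilon$-saddle point of $f$, and the total number of gradient evaluations is bounded by $$O\left(\sqrt{\frac{\kappa_x\ell}{\epsilon}}\,D_y\,\log^3\left(\frac{\kappa_x\ell(D_x^2+D_y^2)}{\epsilon}\right)\right),$$ where $\kappa_x=\ell/\mu_x$ is the condition number.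
   Context: Notation. $\|\cdot\|$ is the Euclidean norm; $\mathcal{P}_{\mathcal{Z}}$ is the Euclidean projection onto a closed convex set $\mathcal{Z}$; $D_x=\max_{x,x'\in\mathcal{X}}\|x-x'\|$ and $D_y=\max_{y,y'\in\mathcal{Y}}\|y-y'\|$, with $D_y>0$. $O(\cdot)$ hides only absolute constants that do not depend on any problem parameter. A function $h$ is $\ell$-smooth if $\|\nabla h(z)-\nabla h(z')\|\le \ell\|z-z'\|$ for all $z,z'$ (for $f$, with respect to the joint variable $(x,y)$). A differentiable $\phi:\mathbb{R}^d\to\mathbb{R}$ is $\mu$-strongly convex if $\phi(x')\ge\phi(x)+(x'-x)^\top\nabla\phi(x)+(\mu/2)\|x'-x\|^2$ for all $x,x'\in\mathbb{R}^d$, and $\mu$-strongly concave if $-\phi$ is $\mu$-strongly convex; $\mu=0$ gives convexity and concavity. A point $(\hat x,\hat y)\in\mathcal{X}\times\mathcal{Y}$ is an $\epsilon$-saddle point of $f$ if $\max_{y\in\mathcal{Y}}f(\hat x,y)-\min_{x\in\mathcal{X}}f(x,\hat y)\le\epsilon$. Gradient evaluations are counted over the whole run, including all inner procedures. Procedure $\mathrm{AGD}(h,\mathcal{Z},z_0,L,m,\tau)$. Set $\tilde z_0=z_0$, $\kappa=L/m$, $\eta=1/L$, $\theta=\frac{\sqrt\kappa-1}{\sqrt\kappa+1}$. For $t=1,2,\dots$: $z_t=\mathcal{P}_{\mathcal{Z}}[\tilde z_{t-1}-\eta\nabla h(\tilde z_{t-1})]$, $\tilde z_t=z_t+\theta(z_t-z_{t-1})$.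 Stop at the first $t\ge1$ with $\|z_t-\mathcal{P}_{\mathcal{Z}}(z_t-\eta\nabla h(z_t))\|^2\le\frac{\tau}{2\kappa^2(L-m)}$ (right side read as $+\infty$ if $L=m$) and output $\mathcal{P}_{\mathcal{Z}}(z_t-\eta\nabla h(z_t))$. Procedure $\text{Maximin-AG2}(g,x_0,y_0,L,m_1,m_2,\tau)$. Set $\tilde y_0=y_0$, $k_1=L/m_1$, $k_2=L/m_2$, $\eta=\frac{1}{2k_1L}$, $\theta=\frac{4\sqrt{k_1k_2}-1}{4\sqrt{k_1k_2}+1}$, $\tilde\tau=\frac{\tau}{(10k_1k_2)^7}$. For $t=1,2,\dots$: $\tilde x_{t-1}=\mathrm{AGD}(g(\cdot,\tilde y_{t-1}),\mathcal{X},x_0,L,m_1,\tilde\tau)$; $y_t=\mathcal{P}_{\mathcal{Y}}[\tilde y_{t-1}+\eta\nabla_yg(\tilde x_{t-1},\tilde y_{t-1})]$; $\tilde y_t=y_t+\theta(y_t-y_{t-1})$; $x_t=\mathrm{AGD}(g(\cdot,y_t),\mathcal{X},x_0,L,m_1,\tilde\tau)$. Stop at the first $t\ge1$ with $\|y_t-\mathcal{P}_{\mathcal{Y}}(y_t+\eta\nabla_yg(x_t,y_t))\|^2\le\frac{\tau}{(10k_1k_2)^4L}$ and output $\mathcal{P}_{\mathcal{X}}(x_t-\frac{1}{2k_2L}\nabla_xg(x_t,y_t))$. Procedure $\text{Minimax-APPA}(F,x_0,y_0,\ell,\mu_1,\mu_2,\varepsilon,T)$. Set $\tilde x_0=x_0$,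 $\kappa_1=\ell/\mu_1$, $\kappa_2=\ell/\mu_2$, $\theta=\frac{2\sqrt{\kappa_1}-1}{2\sqrt{\kappa_1}+1}$, $\delta=\frac{\varepsilon}{(10\kappa_1\kappa_2)^4}$, $\tilde\varepsilon=\frac{\varepsilon}{10^2\kappa_1\kappa_2}$. For $t=1,\dots,T$: with $g_t(x,y)=F(x,y)+\ell\|x-\tilde x_{t-1}\|^2$, set $x_t=\text{Maximin-AG2}(g_t,x_0,y_0,3\ell,2\ell,\mu_2,\delta)$ and $\tilde x_t=x_t+\theta(x_t-x_{t-1})$. Then set $\tilde y=\mathrm{AGD}(-F(x_T,\cdot),\mathcal{Y},y_0,\ell,\mu_2,\tilde\varepsilon)$ and $y_T=\mathcal{P}_{\mathcal{Y}}(\tilde y+\frac{1}{2\kappa_1\ell}\nabla_yF(x_T,\tilde y))$, and output $(x_T,y_T)$.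
   Formalization: The claim is proved for ε at most an absolute constant times ℓD_y² (and m ≥ 1); for large ε it fails as stated, since the logarithm becomes nonpositive and, for ε > 4ℓD_y², the final AGD call never stops. *)

(* Defs.v *)
From HB Require Import structures.
From mathcomp Require Import all_boot all_order all_algebra.
From mathcomp Require Import all_classical all_reals all_analysis.

Set Implicit Arguments.
Unset Strict Implicit.
Unset Printing Implicit Defensive.

Import Order.TTheory GRing.Theory Num.Theory.
Import numFieldNormedType.Exports.

Local Open Scope classical_set_scope.
Local Open Scope ring_scope.

(* The norm of the library on 'rV[R]_d is the max-norm. It induces the same   *)
(* topology, bounded sets and Frechet derivatives as enorm, but every norm in *)
(* a formula below is the Euclidean one.                                      *)
Definition dot (R : realType) (d : nat) (u v : 'rV[R]_d) : R :=
  \sum_(i < d) u 0 i * v 0 i.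

Definition enorm (R : realType) (d : nat) (u : 'rV[R]_d) : R :=
  Num.sqrt (dot u u).

Definition grad (R : realType) (d : nat) (h : 'rV[R]_d -> R)
    (z : 'rV[R]_d) : 'rV[R]_d :=
  \row_(j < d) 'D_(delta_mx 0 j) h z.

Definition smooth (R : realType) (d : nat) (ell : R) (h : 'rV[R]_d -> R) :=
  (forall z, differentiable h z) /\
  (forall z z', enorm (grad h z - grad h z') <= ell * enorm (z - z')).

Definition joint (R : realType) (m n : nat)
    (f : 'rV[R]_m -> 'rV[R]_n -> R) : 'rV[R]_(m + n) -> R :=
  fun z => f (lsubmx z) (rsubmx z).

Definition strongly_convex (R : realType) (d : nat) (mu : R)
    (phi : 'rV[R]_d -> R) :=
  (forall x, differentiable phi x) /\
  (forall x x', phi x + dot (x' - x) (grad phi x)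
                + mu / 2 * enorm (x' - x) ^+ 2 <= phi x').

Definition strongly_concave (R : realType) (d : nat) (mu : R)
    (phi : 'rV[R]_d -> R) :=
  strongly_convex mu (fun z => - phi z).

(* On the nonempty bounded sets considered this supremum is a maximum.        *)
Definition diam (R : realType) (d : nat) (Z : set 'rV[R]_d) : R :=
  sup [set enorm (z - z') | z in Z & z' in Z].

(* The junk value z of xget is returned only when no nearest point exists,    *)
(* which does not happen for Z nonempty and closed.                           *)
Definition proj (R : realType) (d : nat) (Z : set 'rV[R]_d) (z : 'rV[R]_d) :
    'rV[R]_d :=
  xget z [set p | Z p /\ forall q, Z q -> enorm (z - p) <= enorm (z - q)].

(* For f continuous and X, Y nonempty, closed and bounded, the sup is a       *)
(* maximum and the inf is a minimum.                                          *)
Definition saddle_point (R : realType) (m n : nat)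
    (X : set 'rV[R]_m) (Y : set 'rV[R]_n) (f : 'rV[R]_m -> 'rV[R]_n -> R)
    (eps : R) (xh : 'rV[R]_m) (yh : 'rV[R]_n) :=
  [/\ X xh, Y yh &
      sup [set f xh y | y in Y] - inf [set f x yh | x in X] <= eps].

(* The procedures may fail to stop, so each one is the graph of a             *)
(* deterministic partial function: P args out N means that the run of P on    *)
(* args stops, returns out and has performed N gradient evaluations, those of *)
(* its inner procedures included.                                             *)

Definition AGD_step (R : realType) (d : nat) (h : 'rV[R]_d -> R)
    (Z : set 'rV[R]_d) (L : R) (z : 'rV[R]_d) : 'rV[R]_d :=
  proj Z (z - L^-1 *: grad h z).

(* The pair (z_t, ztilde_t). *)
Definition AGD_iterate (R : realType) (d : nat) (h : 'rV[R]_d -> R)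
    (Z : set 'rV[R]_d) (z0 : 'rV[R]_d) (L m : R) (t : nat) :
    'rV[R]_d * 'rV[R]_d :=
  let kappa := L / m in
  let theta := (Num.sqrt kappa - 1) / (Num.sqrt kappa + 1) in
  iter t (fun s => let z := AGD_step h Z L s.2 in
                   (z, z + theta *: (z - s.1))) (z0, z0).

Definition AGD_stop (R : realType) (d : nat) (h : 'rV[R]_d -> R)
    (Z : set 'rV[R]_d) (L m tau : R) (z : 'rV[R]_d) : Prop :=
  let kappa := L / m in
  L = m \/
  enorm (z - AGD_step h Z L z) ^+ 2 <= tau / (2 * kappa ^+ 2 * (L - m)).

(* Iteration s evaluates grad h at ztilde_(s-1) and, in the stopping test, at *)
(* z_s; the output reuses the latter.                                         *)
Definition AGD (R : realType) (d : nat) (h : 'rV[R]_d -> R)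
    (Z : set 'rV[R]_d) (z0 : 'rV[R]_d) (L m tau : R)
    (out : 'rV[R]_d) (N : nat) : Prop :=
  let z t := (AGD_iterate h Z z0 L m t).1 in
  exists t : nat,
    [/\ (0 < t)%N,
        AGD_stop h Z L m tau (z t),
        forall s : nat, (0 < s < t)%N -> ~ AGD_stop h Z L m tau (z s),
        out = AGD_step h Z L (z t) &
        N = (2 * t)%N].

Definition AG2_eta (R : realType) (L m1 : R) : R :=
  let k1 := L / m1 in (2 * k1 * L)^-1.

Definition AG2_stop (R : realType) (m n : nat)
    (g : 'rV[R]_m -> 'rV[R]_n -> R) (Y : set 'rV[R]_n)
    (L m1 m2 tau : R) (x : 'rV[R]_m) (y : 'rV[R]_n) : Prop :=
  let k1 := L / m1 in
  let k2 := L / m2 in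
  enorm (y - proj Y (y + AG2_eta L m1 *: grad (g x) y)) ^+ 2
    <= tau / ((10 * k1 * k2) ^+ 4 * L).

(* AG2_iterate ... t x y yt N: the run reaches the end of iteration t with    *)
(* (x_t, y_t, ytilde_t) = (x, y, yt) after N gradient evaluations. For t >= 1 *)
(* the evaluation made by the stopping test of iteration t is included in N.  *)
Inductive AG2_iterate (R : realType) (m n : nat)
    (g : 'rV[R]_m -> 'rV[R]_n -> R) (X : set 'rV[R]_m) (Y : set 'rV[R]_n)
    (x0 : 'rV[R]_m) (y0 : 'rV[R]_n) (L m1 m2 tau : R) :
    nat -> 'rV[R]_m -> 'rV[R]_n -> 'rV[R]_n -> nat -> Prop :=
| AG2_start : AG2_iterate g X Y x0 y0 L m1 m2 tau 0%N x0 y0 y0 0%N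
| AG2_next (t : nat) (x xt x' : 'rV[R]_m) (y yt : 'rV[R]_n)
    (N Nxt Nx' : nat) :
    let k1 := L / m1 in
    let k2 := L / m2 in
    let theta := (4 * Num.sqrt (k1 * k2) - 1)
                 / (4 * Num.sqrt (k1 * k2) + 1) in
    let tau' := tau / (10 * k1 * k2) ^+ 7 in
    let y' := proj Y (yt + AG2_eta L m1 *: grad (g xt) yt) in
    AG2_iterate g X Y x0 y0 L m1 m2 tau t x y yt N ->
    ((0 < t)%N -> ~ AG2_stop g Y L m1 m2 tau x y) ->
    AGD (g^~ yt) X x0 L m1 tau' xt Nxt ->
    AGD (g^~ y') X x0 L m1 tau' x' Nx' ->
    AG2_iterate g X Y x0 y0 L m1 m2 tau
      t.+1 x' y' (y' + theta *: (y' - y)) (N + Nxt + 1 + Nx' + 1)%N.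

Definition Maximin_AG2 (R : realType) (m n : nat)
    (g : 'rV[R]_m -> 'rV[R]_n -> R) (X : set 'rV[R]_m) (Y : set 'rV[R]_n)
    (x0 : 'rV[R]_m) (y0 : 'rV[R]_n) (L m1 m2 tau : R)
    (out : 'rV[R]_m) (N : nat) : Prop :=
  let k2 := L / m2 in
  exists (t : nat) (x : 'rV[R]_m) (y yt : 'rV[R]_n) (N' : nat),
    [/\ (0 < t)%N,
        AG2_iterate g X Y x0 y0 L m1 m2 tau t x y yt N',
        AG2_stop g Y L m1 m2 tau x y,
        out = proj X (x - (2 * k2 * L)^-1 *: grad (g^~ y) x) &
        N = (N' + 1)%N].

(* APPA_iterate ... t x xt N: (x_t, xtilde_t) = (x, xt) after N gradient      *)
(* evaluations.                                                               *)
Inductive APPA_iterate (R : realType) (m n : nat)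
    (F : 'rV[R]_m -> 'rV[R]_n -> R) (X : set 'rV[R]_m) (Y : set 'rV[R]_n)
    (x0 : 'rV[R]_m) (y0 : 'rV[R]_n) (ell mu1 mu2 eps : R) :
    nat -> 'rV[R]_m -> 'rV[R]_m -> nat -> Prop :=
| APPA_start : APPA_iterate F X Y x0 y0 ell mu1 mu2 eps 0%N x0 x0 0%N
| APPA_next (t : nat) (x xt x' : 'rV[R]_m) (N Nx' : nat) :
    let kappa1 := ell / mu1 in
    let kappa2 := ell / mu2 in
    let theta := (2 * Num.sqrt kappa1 - 1) / (2 * Num.sqrt kappa1 + 1) in
    let delta := eps / (10 * kappa1 * kappa2) ^+ 4 in
    let g := fun u v => F u v + ell * enorm (u - xt) ^+ 2 in
    APPA_iterate F X Y x0 y0 ell mu1 mu2 eps t x xt N ->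
    Maximin_AG2 g X Y x0 y0 (3 * ell) (2 * ell) mu2 delta x' Nx' ->
    APPA_iterate F X Y x0 y0 ell mu1 mu2 eps
      t.+1 x' (x' + theta *: (x' - x)) (N + Nx')%N.

Definition Minimax_APPA (R : realType) (m n : nat)
    (F : 'rV[R]_m -> 'rV[R]_n -> R) (X : set 'rV[R]_m) (Y : set 'rV[R]_n)
    (x0 : 'rV[R]_m) (y0 : 'rV[R]_n) (ell mu1 mu2 eps : R) (T : nat)
    (xT : 'rV[R]_m) (yT : 'rV[R]_n) (N : nat) : Prop :=
  let kappa1 := ell / mu1 in
  let kappa2 := ell / mu2 in
  let eps' := eps / (10 ^+ 2 * kappa1 * kappa2) in
  exists (xt : 'rV[R]_m) (yt : 'rV[R]_n) (N1 N2 : nat),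
    [/\ APPA_iterate F X Y x0 y0 ell mu1 mu2 eps T xT xt N1,
        AGD (fun y => - F xT y) Y y0 ell mu2 eps' yt N2,
        yT = proj Y (yt + (2 * kappa1 * ell)^-1 *: grad (F xT) yt) &
        N = (N1 + N2 + 1)%N].

(* In general f_eps is only (ell + eps / (2 * diam Y ^+ 2))-smooth when f is  *)
(* ell-smooth, so AGD applied to it with L = ell need not stop unless         *)
(* ell * diam Y ^+ 2 / eps is large.                                          *)
Definition f_eps (R : realType) (m n : nat)
    (f : 'rV[R]_m -> 'rV[R]_n -> R) (Y : set 'rV[R]_n) (y0 : 'rV[R]_n)
    (eps : R) : 'rV[R]_m -> 'rV[R]_n -> R :=
  fun x y => f x y - eps / (4 * diam Y ^+ 2) * enorm (y - y0) ^+ 2.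

(* Main.v *)
From Pilot Require Import Defs.
From HB Require Import structures.
From mathcomp Require Import all_boot all_order all_algebra.
From mathcomp Require Import all_classical all_reals all_analysis.
From mathcomp Require Import ring lra.

(** The method is a nest of four loops, and the proof shows that each of them
    approaches its target linearly, with a stopping rule that certifies the
    accuracy that the enclosing loop needs.

    Let [mu = eps / (4 D_y ^ 2)] be the regularization parameter and [F] the
    regularized function, which is [ell]-smooth up to [2 mu], [mux]-strongly
    convex in [x] and [2 mu]-strongly concave in [y].  A saddle point of [F] is
    a saddle point of [f] up to [eps / 4], so it is enough to reach the
    accuracy [eps / 2] on [F].

    - Minimax-APPA is an accelerated inexact proximal point method for the
      primal function [Phi x = max_y F x y].  Its subproblems, in which
      [ell |x - xt| ^ 2] is added, are uniformly well conditioned in [x].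
    - Maximin-AG2 solves such a subproblem by an accelerated inexact gradient
      method for the dual function [phi y = min_x g x y].  Evaluating the
      partial gradient at an approximate minimizer in [x] is an inexact oracle
      for [phi] ([value_lower], [value_upper]).
    - AGD on the well conditioned variable is the innermost loop
      ([AGD_short]); AGD is also run once at the end on the badly conditioned
      variable ([AGD_long]).

    The three accelerated loops share one potential argument.  Whatever the
    origin of a step, it satisfies an inequality [step_bound] against any
    competitor, and this inequality alone makes the potential
    [H p - H zs + a ^ 2 L / 2 |v - zs| ^ 2] contract by [1 - a / 4] up to the
    inexactness ([acceleratedS]); here [a] is of the order of the inverse
    square root of the condition number.

    Three points need care.  Gradients may be arbitrarily large on the feasible
    sets, so objective gaps are never deduced from distances by a Lipschitz
    bound; they come from the projected gradient step that closes Maximin-AG2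
    and Minimax-APPA ([projected_step_gap]), and the potential is only started after
    the first step.  Extrapolated points may leave the feasible sets, where [f]
    loses its convexity in [x]; smoothness together with the proximal term
    still leaves the modulus [ell] there, and the innermost loop contracts with
    this weaker modulus.  Finally [F] is slightly less smooth in [y] than the
    step length [1 / ell] of the last solver presumes; the perturbation is of
    relative order [mu / ell] while a step gains [sqrt (mu / ell)], so it is
    harmless when [ell D_y ^ 2 / eps] is large.

    The tolerances are polynomial in the argument of the logarithm
    ([tolerance_polynomial]), so that every loop runs for a logarithm times its
    inverse rate: a constant for the innermost loop, [sqrt (ell / mu)] for
    Maximin-AG2 and [sqrt (ell / mux)] for Minimax-APPA.  The product of the
    three is the bound ([total_count]). *)

Set Implicit Arguments.
Unset Strict Implicit.
Unset Printing Implicit Defensive.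

Import Order.TTheory GRing.Theory Num.Theory.
Import numFieldNormedType.Exports.

Local Open Scope classical_set_scope.
Local Open Scope ring_scope.

Local Notation proj := Pilot.Defs.proj.

(** * Euclidean geometry of row vectors *)

Section Euclidean.
Variables (R : realType) (d : nat).
Implicit Types (u v w : 'rV[R]_d) (a : R).

Lemma dotC u v : dot u v = dot v u.
Proof. by apply: eq_bigr => i _; rewrite mulrC. Qed.

Lemma dotDl u v w : dot (u + v) w = dot u w + dot v w.
Proof. by rewrite /dot -big_split; apply: eq_bigr => i _; rewrite mxE mulrDl. Qed.

Lemma dotZl a u v : dot (a *: u) v = a * dot u v.
Proof. by rewrite /dot mulr_sumr; apply: eq_bigr => i _; rewrite mxE mulrA. Qed.

Lemma dotNl u v : dot (- u) v = - dot u v.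
Proof. by rewrite -scaleN1r dotZl mulN1r. Qed.

Lemma dotDr u v w : dot u (v + w) = dot u v + dot u w.
Proof. by rewrite !(dotC u) dotDl. Qed.

Lemma dotZr a u v : dot u (a *: v) = a * dot u v.
Proof. by rewrite !(dotC u) dotZl. Qed.

Lemma dotNr u v : dot u (- v) = - dot u v.
Proof. by rewrite !(dotC u) dotNl. Qed.

Lemma dot0l u : dot 0 u = 0.
Proof. by rewrite -(scale0r 0) dotZl mul0r. Qed.

Lemma dot0r u : dot u 0 = 0.
Proof. by rewrite dotC dot0l. Qed.

Lemma dot_ge0 u : 0 <= dot u u.
Proof. by apply: sumr_ge0 => i _; rewrite -expr2 sqr_ge0. Qed.

Lemma enorm_sq u : enorm u ^+ 2 = dot u u.
Proof. by rewrite sqr_sqrtr // dot_ge0. Qed.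

Lemma enorm_ge0 u : 0 <= enorm u.
Proof. exact: sqrtr_ge0. Qed.

Definition dotE := (dotDl, dotDr, dotNl, dotNr, dotZl, dotZr, dot0l, dot0r).

Lemma enormN u : enorm (- u) = enorm u.
Proof. by rewrite /enorm !dotE opprK. Qed.

Lemma enormB u v : enorm (u - v) = enorm (v - u).
Proof. by rewrite -opprB enormN. Qed.

Lemma enorm0 : enorm (0 : 'rV[R]_d) = 0.
Proof. by rewrite /enorm dot0l sqrtr0. Qed.

Lemma ler_abs_sq a b : 0 <= b -> a ^+ 2 <= b ^+ 2 -> a <= b.
Proof.
by move=> b0 h; rewrite leNgt; apply/negP => h'; move: h; rewrite leNgt; nra.
Qed.

(** Cauchy-Schwarz, by expanding [0 <= dot w w] for
    [w := dot v v *: u - dot u v *: v]. *)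
Lemma dot_le u v : dot u v <= enorm u * enorm v.
Proof.
apply: ler_abs_sq; first by rewrite mulr_ge0 ?enorm_ge0.
rewrite exprMn !enorm_sq.
have [v0|v0] := eqVneq (dot v v) 0.
  have h t : 0 <= dot u u + 2 * t * dot u v.
    have := dot_ge0 (u + t *: v).
    by rewrite !dotE v0 (dotC v u); lra.
  have [->|c0] := eqVneq (dot u v) 0; first by rewrite v0 mulr0 expr0n.
  have := h (- (dot u u + 1) / (2 * dot u v)).
  have -> : 2 * (- (dot u u + 1) / (2 * dot u v)) * dot u v = - (dot u u + 1).
    by field.
  lra.
have vp : 0 < dot v v by rewrite lt_def v0 dot_ge0.
have := dot_ge0 (dot v v *: u - dot u v *: v).
rewrite !dotE (dotC v u); set a := dot u v; set b := dot v v in vp *.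
move=> h; have : 0 <= b * (b * dot u u - a ^+ 2) by lra.
rewrite pmulr_rge0 // subr_ge0; lra.
Qed.

Lemma dot_abs u v : `|dot u v| <= enorm u * enorm v.
Proof.
rewrite ler_norml dot_le andbT lerNl -dotNl; apply: le_trans (dot_le _ _) _.
by rewrite enormN.
Qed.

Lemma enormD u v : enorm (u + v) <= enorm u + enorm v.
Proof.
apply: ler_abs_sq; first by rewrite addr_ge0 ?enorm_ge0.
rewrite sqrrD !enorm_sq !dotE (dotC v u).
by have := dot_le u v; lra.
Qed.

Lemma enorm_triangle u v w : enorm (u - w) <= enorm (u - v) + enorm (v - w).
Proof. by have := enormD (u - v) (v - w); rewrite addrA subrK. Qed.

Lemma enorm_le0 u : enorm u <= 0 -> u = 0.
Proof.
move=> h; have h0 : dot u u = 0.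
  by rewrite -enorm_sq; apply/eqP; rewrite expf_eq0 /= eq_le h enorm_ge0.
apply/rowP => i; rewrite mxE.
move/eqP: h0; rewrite psumr_eq0; last by move=> j _; rewrite -expr2 sqr_ge0.
by move/allP/(_ i (mem_index_enum _)); rewrite -expr2 sqrf_eq0 => /eqP.
Qed.

Lemma continuous_dist2 u : continuous (fun z : 'rV[R]_d => dot (z - u) (z - u)).
Proof.
apply: continuous_big; first exact: add_continuous.
have cB i : continuous (fun z : 'rV[R]_d => (z - u) 0 i).
  have -> : (fun z : 'rV[R]_d => (z - u) 0 i) = (fun z => z 0 i - u 0 i).
    by apply/funext => z; rewrite !mxE.
  move=> z; apply: continuousB; first exact: coord_continuous.
  exact: cst_continuous.
by move=> i _ z; apply: continuousM; exact: cB.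
Qed.

Lemma continuous_enorm u : continuous (fun z : 'rV[R]_d => enorm (z - u)).
Proof.
move=> z; apply: (@continuous_comp _ _ _ (fun z : 'rV[R]_d => dot (z - u) (z - u))).
  exact: continuous_dist2.
exact: sqrt_continuous.
Qed.

Lemma continuous_of_modulus (h : 'rV[R]_d -> R) :
  (forall z, exists a : R, forall w,
     `|h w - h z| <= a * (enorm (w - z) + enorm (w - z) ^+ 2)) ->
  continuous h.
Proof.
move=> H z; have [a ha] := H z.
pose k c (w : 'rV[R]_d) := h z + c * (enorm (w - z) + enorm (w - z) ^+ 2).
have kz c : k c z = h z by rewrite /k subrr enorm0 expr0n addr0 mulr0 addr0.
have hc c : k c @ nbhs z --> h z.
  suff: continuous (k c) by move/(_ z); rewrite /continuous_at kz.
  move=> x; apply: (continuousD (f := fun=> h z)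
    (g := fun w => c * (enorm (w - z) + enorm (w - z) ^+ 2))).
    exact: cst_continuous.
  apply: (continuousM (s := fun=> c)
    (t := fun w => enorm (w - z) + enorm (w - z) ^+ 2)); first exact: cst_continuous.
  apply: (continuousD (f := fun w => enorm (w - z)) (g := fun w => enorm (w - z) ^+ 2)).
    exact: continuous_enorm.
  have -> : (fun w => enorm (w - z) ^+ 2) = (fun w => dot (w - z) (w - z)).
    by apply/funext => w; rewrite enorm_sq.
  exact: continuous_dist2.
apply: (squeeze_cvgr _ (hc (- a)) (hc a)).
by near=> w; have := ha w; rewrite /k ler_norml; lra.
Unshelve. all: by end_near. Qed.

(** * Convex bodies, projections and minimizers *)

(** Convexity is stated along segments, the form in which first-order arguments
    consume it. *)
Definition convex_body (Z : set 'rV[R]_d) :=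
  [/\ Z !=set0, compact Z &
      forall x y (t : R), Z x -> Z y -> 0 <= t <= 1 -> Z (x + t *: (y - x))].

Lemma convex_bodyP (Z : set 'rV[R]_d) :
  Z !=set0 -> closed Z -> convex_set Z -> bounded_set Z -> convex_body Z.
Proof.
move=> Z0 Zc Zv Zb; split => //; first exact: bounded_closed_compact.
move=> x y t Zx Zy /andP[t0 t1].
have /set_mem := Zv y x (Itv01 t0 t1) (mem_set Zy) (mem_set Zx).
rewrite /conv /= /unstable.onem; congr Z.
by rewrite scalerBr scalerBl scale1r addrCA addrA [RHS]addrC addrA addrC addrA.
Qed.

Definition argmin (Z : set 'rV[R]_d) (h : 'rV[R]_d -> R) : 'rV[R]_d :=
  xget 0 [set p | Z p /\ forall q, Z q -> h p <= h q].

Lemma argminP (Z : set 'rV[R]_d) (h : 'rV[R]_d -> R) :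
  convex_body Z -> continuous h ->
  Z (argmin Z h) /\ forall q, Z q -> h (argmin Z h) <= h q.
Proof.
move=> [Z0 Zk _] ch.
have [c cZ cmin] := EVT_min_rV Z0 Zk (continuous_subspaceT ch).
have ex : exists p, [set p | Z p /\ forall q, Z q -> h p <= h q] p.
  by exists c; split; [exact: set_mem|move=> q /mem_set; exact: cmin].
exact: (xgetPex 0 ex).
Qed.

Lemma projP (Z : set 'rV[R]_d) z : convex_body Z ->
  Z (proj Z z) /\ forall q, Z q -> enorm (z - proj Z z) <= enorm (z - q).
Proof.
move=> [Z0 Zk _].
have [c cZ cmin] := EVT_min_rV Z0 Zk (continuous_subspaceT (@continuous_dist2 z)).
have ex : exists p, [set p | Z p /\ forall q, Z q -> enorm (z - p) <= enorm (z - q)] p.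
  exists c; split; first exact: set_mem.
  move=> q /mem_set /cmin h; rewrite enormB (enormB z).
  by rewrite /enorm ler_sqrt ?dot_ge0.
exact: (xgetPex z ex).
Qed.

(** The limit argument behind every first-order condition of this file:
    perturb a minimizer along a segment and compare the terms of order one
    and two in the length [t] of the perturbation. *)
Lemma linear_le_quadratic a b :
  (forall t, 0 < t <= 1 -> a * t <= b * t ^+ 2) -> a <= 0.
Proof.
move=> H; rewrite leNgt; apply/negP => a0.
have ab : a <= b by have := H 1; rewrite ltr01 lexx expr1n !mulr1; apply.
have b0 : 0 < b by lra.
have t0 : 0 < a / (2 * b) by rewrite divr_gt0 //; lra.
have t1 : a / (2 * b) <= 1 by rewrite ler_pdivrMr; lra.
have := H (a / (2 * b)); rewrite t0 t1 => /(_ isT).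
have bt : b * (a / (2 * b)) = a / 2 by field; lra.
set t := a / (2 * b) in t0 t1 bt *.
have -> : b * t ^+ 2 = (b * t) * t by ring.
rewrite bt ler_pM2r //; lra.
Qed.

Lemma proj_variational (Z : set 'rV[R]_d) z w : convex_body Z -> Z w ->
  dot (z - proj Z z) (w - proj Z z) <= 0.
Proof.
move=> Zb Zw; have [Zp pmin] := projP z Zb; set p := proj Z z in Zp pmin *.
apply: (@linear_le_quadratic _ (dot (w - p) (w - p) / 2)) => t /andP[t0 t1].
case: Zb => _ _ /(_ p w t Zp Zw); rewrite (ltW t0) t1 => /(_ isT)/pmin h.
have : enorm (z - p) ^+ 2 <= enorm (z - (p + t *: (w - p))) ^+ 2.
  by rewrite lerXn2r ?nnegrE ?enorm_ge0.
rewrite opprD addrA !enorm_sq; move: (z - p) (w - p) => u v.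
by rewrite !dotE (dotC v u); lra.
Qed.

(** The three-point inequality of a projected step: the variational inequality
    of the projection, with the inner product rewritten by polarization. *)
Lemma proj_step (Z : set 'rV[R]_d) (s G w : 'rV[R]_d) (L : R) :
  convex_body Z -> Z w -> 0 < L ->
  let q := proj Z (s - L^-1 *: G) in
  dot G (q - w) <= L / 2 * (enorm (w - s) ^+ 2 - enorm (w - q) ^+ 2
                            - enorm (q - s) ^+ 2).
Proof.
rewrite /= => Zb Zw L0; set q := proj _ _.
have := proj_variational (s - L^-1 *: G) Zb Zw; rewrite -/q => h.
have {h} : L * dot (s - L^-1 *: G - q) (w - q) <= 0.
  by rewrite pmulr_rle0.
have -> : s - L^-1 *: G - q = (s - q) - L^-1 *: G by rewrite addrAC.
rewrite dotDl dotNl dotZl mulrDr mulrN mulrA mulfV ?gt_eqF // mul1r => h.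
have -> : dot G (q - w) = - dot G (w - q) by rewrite -dotNr opprB.
rewrite !enorm_sq.
suff -> : dot (w - s) (w - s) - dot (w - q) (w - q) - dot (q - s) (q - s)
  = - 2 * dot (s - q) (w - q) by lra.
rewrite !dotE (dotC s w) (dotC q w) (dotC s q); ring.
Qed.

Lemma proj_nonexpansive (Z : set 'rV[R]_d) z z' : convex_body Z ->
  enorm (proj Z z - proj Z z') <= enorm (z - z').
Proof.
move=> Zb; have [Zp _] := projP z Zb; have [Zp' _] := projP z' Zb.
have h1 := proj_variational z Zb Zp'; have h2 := proj_variational z' Zb Zp.
move: (proj Z z) (proj Z z') h1 h2 => p p' h1 h2.
have h : enorm (p - p') ^+ 2 <= enorm (z - z') * enorm (p - p').
  apply: le_trans (dot_le _ _).
  rewrite enorm_sq; move: h1 h2; rewrite !dotE.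
  rewrite (dotC p' p); lra.
have [h0|h0] := leP (enorm (p - p')) 0.
  by apply: le_trans h0 _; exact: enorm_ge0.
by move: h; rewrite expr2 ler_pM2r.
Qed.

Lemma diamP (Z : set 'rV[R]_d) z z' : convex_body Z -> Z z -> Z z' ->
  enorm (z - z') <= diam Z.
Proof.
move=> [Z0 Zk _] Zz Zz'; rewrite /diam; apply: ub_le_sup; last first.
  by exists z => //; exists z'.
have cd : continuous (fun z' : 'rV[R]_d => - dot (z' - z) (z' - z)).
  move=> u; apply: (continuousN (f := fun z' : 'rV[R]_d => dot (z' - z) (z' - z))).
  exact: continuous_dist2.
have [c cZ cmax] := EVT_min_rV Z0 Zk (continuous_subspaceT cd).
have hc x : Z x -> enorm (x - z) <= enorm (c - z).
  by move=> /mem_set/cmax; rewrite lerN2 /enorm ler_sqrt ?dot_ge0.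
exists (enorm (c - z) + enorm (c - z)) => _ [x Zx [y Zy <-]].
apply: le_trans (enorm_triangle x z y) _.
by rewrite (enormB z y); apply: lerD; exact: hc.
Qed.

Lemma diam_ge0 (Z : set 'rV[R]_d) : convex_body Z -> 0 <= diam Z.
Proof.
move=> Zb; case: (Zb) => [[z Zz] _ _].
by have := diamP Zb Zz Zz; rewrite subrr enorm0.
Qed.

End Euclidean.

(** * The potential function of accelerated methods *)

Section Acceleration.
Variables (R : realType) (d : nat).
Implicit Types (p q s v w : 'rV[R]_d).

Lemma enorm_convex (a : R) u v : 0 <= a ->
  enorm (u + a *: v) ^+ 2 <= (1 + a) * (enorm u ^+ 2 + a * enorm v ^+ 2).
Proof.
move=> a0; rewrite !enorm_sq.
have : 0 <= a * dot (u - v) (u - v) by rewrite mulr_ge0 ?dot_ge0.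
rewrite !dotE (dotC v u); lra.
Qed.

Lemma enormD_sq u v : enorm (u + v) ^+ 2 <= 2 * (enorm u ^+ 2 + enorm v ^+ 2).
Proof.
by have := enorm_convex u v ler01; rewrite scale1r mul1r.
Qed.

(** The scalar content of one step: [x] and [x'] are the scaled squared
    distances of the old and new momentum points to the solution, [y] that of
    the iterate and [w] that of the mixture of the old momentum point and the
    iterate; [e] collects the effect of a step that is too long.  The surplus
    in [y] left by the mixture is of order [a ^ 3] and is absorbed by [hp]
    through strong convexity. *)
Lemma potential_contracts (a e hp hq x x' y w z : R) :
  0 < a <= 2^-1 -> 0 <= e -> 16 * e <= a -> 0 <= z ->
  0 <= x -> 0 <= x' -> 0 <= y <= hp -> 0 <= hq -> 0 <= w ->
  (1 + a) * w <= x + a * y ->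
  hq + x' <= (1 - a) * hp + w - a * (1 - a) * y + e * (x' + w) + z ->
  hq + x' <= (1 - a / 4) * (hp + x) + 2 * z.
Proof.
move=> /andP[a0 a1] e0 ea z0 x0 x'0 /andP[y0 yh] hq0 w0 hw H.
have e1 : e <= 32^-1 by lra.
have h1 : (1 - e) * (hq + x') <= (1 - a) * hp + (1 + e) * w - a * (1 - a) * y + z.
  by have : 0 <= e * hq by [exact: mulr_ge0]; lra.
have h2 : (1 + a) * ((1 + e) * w) <= (1 + e) * (x + a * y).
  by rewrite mulrCA ler_pM2l //; lra.
have h3 : (1 + a) * ((1 - a) * hp + (1 + e) * w - a * (1 - a) * y)
          <= (1 + e) * x + (1 + a) * (1 - a + a * e + a ^+ 3) * hp.
  have : (a * e + a ^+ 3) * y <= (a * e + a ^+ 3) * hp.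
    by apply: ler_wpM2l => //; rewrite addr_ge0 ?mulr_ge0 ?exprn_ge0 //; lra.
  have : 0 <= a * (a * e + a ^+ 3) * hp.
    by rewrite !mulr_ge0 ?addr_ge0 ?mulr_ge0 ?exprn_ge0 //; lra.
  lra.
have a2 : a ^+ 2 <= a / 2 by rewrite expr2; have := ler_wpM2l (ltW a0) a1; lra.
have a3 : a ^+ 3 <= a / 4.
  by rewrite exprS; have := ler_wpM2l (ltW a0) a2; lra.
have ae : a * e <= e / 2 by have := ler_wpM2r e0 a1; lra.
have ae0 : 0 <= a * e by rewrite mulr_ge0 // ltW.
have c1 : 1 + e <= (1 + a) * ((1 - a / 4) * (1 - e)).
  have : 0 <= a ^+ 2 * e by rewrite mulr_ge0 ?exprn_ge0 // ltW.
  lra.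
have c2 : 1 - a + a * e + a ^+ 3 <= (1 - a / 4) * (1 - e) by lra.
have h4 : (1 + a) * ((1 - e) * (hq + x'))
   <= (1 + a) * ((1 - a / 4) * (1 - e) * (hp + x) + z).
  apply: le_trans (_ : (1 + e) * x + (1 + a) * (1 - a + a * e + a ^+ 3) * hp
                       + (1 + a) * z <= _).
    have : (1 + a) * ((1 - e) * (hq + x')) <= (1 + a) *
      ((1 - a) * hp + (1 + e) * w - a * (1 - a) * y + z).
      by rewrite ler_pM2l //; lra.
    lra.
  have := ler_wpM2r x0 c1.
  have hp0 : 0 <= hp by lra.
  have := ler_wpM2r hp0 c2.
  have a10 : 0 <= 1 + a by lra.
  move=> /(ler_wpM2l a10); lra.
have {h4} : (1 - e) * (hq + x') <= (1 - a / 4) * (1 - e) * (hp + x) + z.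
  by move: h4; rewrite ler_pM2l //; lra.
have -> : (1 - a / 4) * (1 - e) * (hp + x) + z =
   (1 - e) * ((1 - a / 4) * (hp + x) + z / (1 - e)) by field; lra.
rewrite ler_pM2l; last by lra.
suff : z / (1 - e) <= 2 * z by lra.
rewrite ler_pdivrMr; last by lra.
have : z * e <= z * 32^-1 by apply: ler_wpM2l.
lra.
Qed.

(** The state of an accelerated method after [t] iterations: [p] is the
    iterate and [s] the extrapolated point, seen as a mixture of [p] and of a
    momentum point [v] for which Nesterov's potential has contracted.  Nothing
    is asserted of the potential before the first step: the diameter [D] does
    not control the objective at the starting point, but it controls it after
    one step. *)
Definition accelerated (H : 'rV[R]_d -> R) (zs : 'rV[R]_d) (L a z D : R)
    (t : nat) (p s : 'rV[R]_d) :=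
  exists v, s = (1 + a)^-1 *: (p + a *: v) /\
    match t with
    | 0 => v = p
    | t'.+1 => H p - H zs + a ^+ 2 * L / 2 * enorm (v - zs) ^+ 2
               <= 2 * L * D ^+ 2 * (1 - a / 4) ^+ t' + 8 / a * z
    end.

(** What a step from [s] to [q] must achieve against a competitor [w].  Exact
    and inexact projected gradient steps and inexact proximal steps all take
    this form: [z] is the inexactness, and [c > 0] allows for a step length
    that slightly exceeds the inverse of the smoothness constant. *)
Definition step_bound (H : 'rV[R]_d -> R) (L a c z : R) (s q w : 'rV[R]_d) :=
  H q <= H w + L / 2 * (enorm (w - s) ^+ 2 - enorm (w - q) ^+ 2)
         - a ^+ 2 * L / 2 * enorm (w - q) ^+ 2
         + c * a ^+ 2 * L * enorm (q - s) ^+ 2 + z.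

Lemma accelerated0 H zs L a z D p : 0 < a -> accelerated H zs L a z D 0 p p.
Proof.
move=> a0; exists p; split => //.
by rewrite -[X in X + a *: _]scale1r -scalerDl scalerA mulVf ?scale1r // gt_eqF //; lra.
Qed.

(** One step of the potential, with the solution translated to the origin.
    The bounds against the iterate and against the solution are added with
    weights [1 - a] and [a]; the squares then recombine into the distance of
    the new momentum point [V'] and of the mixture [W], because both [S] and
    [Q] have the form [(1 - a) *: P + a *: _]. *)
Lemma accelerated_step (hp hq L a c z : R) (P V V' : 'rV[R]_d) :
  0 < L -> 0 < a <= 2^-1 -> 0 <= c -> 64 * c * a <= 1 -> 0 <= z ->
  a ^+ 2 * L / 2 * enorm P ^+ 2 <= hp -> 0 <= hq ->
  let S := (1 + a)^-1 *: (P + a *: V) in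
  let Q := (1 - a) *: P + a *: V' in
  hq <= hp + L / 2 * (enorm (P - S) ^+ 2 - enorm (P - Q) ^+ 2)
         - a ^+ 2 * L / 2 * enorm (P - Q) ^+ 2
         + c * a ^+ 2 * L * enorm (Q - S) ^+ 2 + z ->
  hq <= L / 2 * (enorm S ^+ 2 - enorm Q ^+ 2)
         - a ^+ 2 * L / 2 * enorm Q ^+ 2
         + c * a ^+ 2 * L * enorm (Q - S) ^+ 2 + z ->
  hq + a ^+ 2 * L / 2 * enorm V' ^+ 2 <=
  (1 - a / 4) * (hp + a ^+ 2 * L / 2 * enorm V ^+ 2) + 2 * z.
Proof.
move=> L0 /andP[a0 a1] c0 ca z0 hP hq0 /= K1 K2.
pose W := (1 + a)^-1 *: (V + a *: P).
have a10 : 1 + a != 0 by rewrite gt_eqF //; lra.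
have ES : (1 + a)^-1 *: (P + a *: V) = (1 - a) *: P + a *: W.
  by apply/rowP => i; rewrite /W !mxE; field.
rewrite {}ES in K1 K2.
have a2 : 0 < a ^+ 2 by rewrite exprn_gt0.
have M0 : 0 < a ^+ 2 * L / 2 by rewrite divr_gt0 // mulr_gt0.
have W0 : (1 + a) * enorm W ^+ 2 <= enorm V ^+ 2 + a * enorm P ^+ 2.
  have h := enorm_convex V P (ltW a0).
  rewrite /W enorm_sq !dotZl !dotZr -enorm_sq mulrA mulfV // mul1r.
  by rewrite ler_pdivrMl //; lra.
have W1 : enorm (V' - W) ^+ 2 <= 2 * (enorm V' ^+ 2 + enorm W ^+ 2).
  by have := enormD_sq V' (- W); rewrite enormN.
have KK : hq <= (1 - a) * hp + a ^+ 2 * L / 2 * enorm W ^+ 2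
   - (1 + a ^+ 2) * (a ^+ 2 * L / 2) * enorm V' ^+ 2
   - a * (1 - a) * (a ^+ 2 * L / 2 * enorm P ^+ 2)
   + c * a ^+ 2 * L * (a ^+ 2 * enorm (V' - W) ^+ 2) + z.
  have a1' : 0 <= 1 - a by lra.
  have := lerD (ler_wpM2l a1' K1) (ler_wpM2l (ltW a0) K2).
  move: V' W {K1 K2 W0 W1} => V' W.
  have -> : (1 - a) *: P + a *: V' - ((1 - a) *: P + a *: W) = a *: (V' - W).
    by apply/rowP => i; rewrite !mxE; ring.
  have -> : forall U : 'rV[R]_d, P - ((1 - a) *: P + a *: U) = a *: (P - U).
    by move=> U; apply/rowP => i; rewrite !mxE; ring.
  rewrite !enorm_sq !dotE (dotC V' P) (dotC W P) (dotC W V'); lra.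
have hc : 16 * (4 * c * a ^+ 2) <= a.
  by have := ler_wpM2r (ltW a0) ca; lra.
have e0 : 0 <= 4 * c * a ^+ 2 by apply: mulr_ge0; [apply: mulr_ge0|exact: ltW].
have nn U : 0 <= a ^+ 2 * L / 2 * enorm U ^+ 2 by rewrite mulr_ge0 ?sqr_ge0 // ltW.
apply: (@potential_contracts a (4 * c * a ^+ 2) hp hq _ _
  (a ^+ 2 * L / 2 * enorm P ^+ 2) (a ^+ 2 * L / 2 * enorm W ^+ 2) z) => //.
- by rewrite a0.
- by rewrite hP nn.
- by have := ler_wpM2l (ltW M0) W0; lra.
apply: le_trans (_ : (1 - a) * hp + a ^+ 2 * L / 2 * enorm W ^+ 2
   - a ^+ 2 * (a ^+ 2 * L / 2 * enorm V' ^+ 2)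
   - a * (1 - a) * (a ^+ 2 * L / 2 * enorm P ^+ 2)
   + c * a ^+ 2 * L * (a ^+ 2 * enorm (V' - W) ^+ 2) + z <= _); first by lra.
have h0 : 0 <= a ^+ 2 * (a ^+ 2 * L / 2 * enorm V' ^+ 2).
  by apply: mulr_ge0; [exact: sqr_ge0|exact: nn].
have hk : 0 <= c * a ^+ 2 * L * a ^+ 2.
  by rewrite !mulr_ge0 ?(ltW L0) ?sqr_ge0 ?(ltW a0).
have := ler_wpM2l hk W1; lra.
Qed.

(** The first step is compared with the solution alone, so that only distances
    enter the resulting bound on the potential. *)
Lemma accelerated_first (h1 L a c z D : R) (P Q V' : 'rV[R]_d) :
  0 < L -> 0 < a <= 2^-1 -> 0 <= c -> 64 * c * a <= 1 -> 0 <= z -> 0 <= D ->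
  enorm P <= D -> enorm Q <= D -> enorm (Q - P) <= D ->
  a *: V' = Q - (1 - a) *: P ->
  h1 <= L / 2 * (enorm P ^+ 2 - enorm Q ^+ 2)
         - a ^+ 2 * L / 2 * enorm Q ^+ 2
         + c * a ^+ 2 * L * enorm (Q - P) ^+ 2 + z ->
  h1 + a ^+ 2 * L / 2 * enorm V' ^+ 2 <= 2 * L * D ^+ 2 + 8 / a * z.
Proof.
move=> L0 /andP[a0 a1] c0 ca z0 D0 PD QD QPD EV K.
have sq x : enorm x <= D -> enorm x ^+ 2 <= D ^+ 2 :> R.
  by move=> h; rewrite lerXn2r ?nnegrE ?enorm_ge0.
have {}PD := sq _ _ PD; have {}QD := sq _ _ QD; have {}QPD := sq _ _ QPD.
have hV : a ^+ 2 * enorm V' ^+ 2 <= D ^+ 2.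
  have -> : a ^+ 2 * enorm V' ^+ 2 = enorm ((1 - a) *: (Q - P) + a *: Q) ^+ 2.
    have -> : (1 - a) *: (Q - P) + a *: Q = a *: V'.
      by rewrite EV; apply/rowP => i; rewrite !mxE; ring.
    by rewrite !enorm_sq dotZl dotZr mulrA -expr2.
  have : enorm ((1 - a) *: (Q - P) + a *: Q) ^+ 2 <=
     (1 - a) * enorm (Q - P) ^+ 2 + a * enorm Q ^+ 2.
    have : 0 <= a * (1 - a) * enorm P ^+ 2.
      by rewrite !mulr_ge0 ?enorm_ge0 ?(ltW a0) //; lra.
    rewrite !enorm_sq !dotE (dotC Q P); lra.
  have a1' : 0 <= 1 - a by lra.
  have := ler_wpM2l a1' QPD; have := ler_wpM2l (ltW a0) QD; lra.
have hc : c * a ^+ 2 <= 128^-1.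
  by have := ler_wpM2r (ltW a0) ca; lra.
have hz : z <= 8 / a * z.
  by rewrite -[X in X <= _]mul1r ler_wpM2r // ler_pdivlMr //; lra.
have h1' : c * a ^+ 2 * (L * enorm (Q - P) ^+ 2) <= 128^-1 * (L * D ^+ 2).
  apply: ler_pM => //; last by rewrite ler_pM2l.
    by rewrite mulr_ge0 ?sqr_ge0.
  by apply: mulr_ge0; [exact: ltW|exact: sqr_ge0].
have h2 := ler_wpM2l (ltW L0) hV; have h3 := ler_wpM2l (ltW L0) PD.
have h4 : 0 <= a ^+ 2 * L * enorm Q ^+ 2.
  by rewrite !mulr_ge0 ?enorm_ge0 ?(ltW L0) ?(ltW a0).
have h5 : 0 <= L * enorm Q ^+ 2 by apply: mulr_ge0; [exact: ltW|exact: sqr_ge0].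
have h6 : 0 <= L * D ^+ 2 by apply: mulr_ge0; [exact: ltW|exact: sqr_ge0].
lra.
Qed.

Lemma acceleratedS H zs L a c z D t p s q :
  0 < L -> 0 < a <= 2^-1 -> 0 <= c -> 64 * c * a <= 1 -> 0 <= z -> 0 <= D ->
  enorm (p - zs) <= D -> enorm (q - zs) <= D -> enorm (q - p) <= D ->
  a ^+ 2 * L / 2 * enorm (p - zs) ^+ 2 <= H p - H zs -> H zs <= H q ->
  accelerated H zs L a z D t p s ->
  step_bound H L a c z s q p -> step_bound H L a c z s q zs ->
  accelerated H zs L a z D t.+1 q (q + ((1 - a) / (1 + a)) *: (q - p)).
Proof.
move=> L0 a01 c0 ca z0 D0 PD QD QPD hp hq [v [Es Hv]] Kp Kz.
have /andP[a0 a1] := a01.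
have a10 : 1 + a != 0 by rewrite gt_eqF //; lra.
have an0 : a != 0 by rewrite gt_eqF.
pose v' := p + a^-1 *: (q - p).
have Ev : a *: v' = q - (1 - a) *: p.
  by apply/rowP => i; rewrite !mxE; field.
have EQ : q - zs = (1 - a) *: (p - zs) + a *: (v' - zs).
  by apply/rowP => i; rewrite !mxE; field.
exists v'; split.
  by rewrite Ev; apply/rowP => i; rewrite !mxE; field.
case: t Hv => [Evp|t Hv].
  rewrite expr0 mulr1.
  have Esp : s = p.
    by rewrite Es Evp; apply/rowP => i; rewrite !mxE; field.
  have := @accelerated_first (H q - H zs) L a c z D (p - zs) (q - zs) (v' - zs).
  apply => //.
  - by rewrite opprB addrA subrK.
  - by rewrite EQ; apply/rowP => i; rewrite !mxE; ring.
  move: Kz; rewrite /step_bound Esp (enormB zs p) (enormB zs q) opprB addrA subrK.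
  lra.
have -> : 2 * L * D ^+ 2 * (1 - a / 4) ^+ t.+1 + 8 / a * z =
  (1 - a / 4) * (2 * L * D ^+ 2 * (1 - a / 4) ^+ t + 8 / a * z) + 2 * z.
  by rewrite (exprS _ t); set r := _ ^+ t; field.
have ha : 0 <= 1 - a / 4 by lra.
apply: le_trans (_ : (1 - a / 4) * (H p - H zs + a ^+ 2 * L / 2 *
    enorm (v - zs) ^+ 2) + 2 * z <= _); last first.
  by rewrite lerD2r; apply: ler_wpM2l.
have ES : (1 + a)^-1 *: (p - zs + a *: (v - zs)) = s - zs.
  by rewrite Es; apply/rowP => i; rewrite !mxE; field.
apply: (accelerated_step (c := c) (P := p - zs) L0) => //; rewrite ?subr_ge0 //=.
  move: Kp; rewrite /step_bound ES -EQ.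
  rewrite !(opprB _ zs) !(addrA _ zs) !subrK.
  by rewrite addrC lerBlDr; lra.
move: Kz; rewrite /step_bound ES -EQ.
rewrite (opprB s) (addrA _ zs) subrK (enormB zs q) (enormB zs s); lra.
Qed.

Lemma accelerated_bound H zs L a z D t p s :
  0 < L -> accelerated H zs L a z D t.+1 p s ->
  H p - H zs <= 2 * L * D ^+ 2 * (1 - a / 4) ^+ t + 8 / a * z.
Proof.
move=> L0 [v [_ h]]; apply: le_trans h; rewrite lerDl.
by rewrite mulr_ge0 ?sqr_ge0 // divr_ge0 // mulr_ge0 ?sqr_ge0 // ltW.
Qed.

End Acceleration.

(** * Projected gradient steps and the procedure AGD *)

Lemma first_positive (P : nat -> Prop) (t0 : nat) : (0 < t0)%N -> P t0 ->
  exists t, [/\ (0 < t <= t0)%N, P t & forall s, (0 < s < t)%N -> ~ P s].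
Proof.
move=> t00 Pt0; pose Q t := (0 < t)%N && `[< P t >].
have ex : exists t, Q t by exists t0; rewrite /Q t00; apply/asboolP.
case: (ex_minnP ex) => t /andP[t1 /asboolP Pt] tmin.
exists t; split => //.
  by rewrite t1 tmin // /Q t00; apply/asboolP.
move=> s /andP[s0 st] Ps; have := tmin s; rewrite /Q s0 /=.
by move=> /(_ (asboolT Ps)); rewrite leqNgt st.
Qed.

Section ProjectedGradient.
Variables (R : realType) (d : nat).
Implicit Types (z s w : 'rV[R]_d) (h : 'rV[R]_d -> R) (Z : set 'rV[R]_d).

Definition quadratic_lower (c : R) h := forall z w,
  h z + dot (grad h z) (w - z) + c / 2 * enorm (w - z) ^+ 2 <= h w.

Definition quadratic_upper (c : R) h := forall z w,
  h w <= h z + dot (grad h z) (w - z) + c / 2 * enorm (w - z) ^+ 2.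

Lemma quadratic_continuous (a b : R) h :
  quadratic_lower a h -> quadratic_upper b h -> continuous h.
Proof.
move=> lo up; apply: continuous_of_modulus => z.
exists (enorm (grad h z) + `|a / 2| + `|b / 2|) => w.
have := lo z w; have := up z w; have := dot_abs (grad h z) (w - z).
have := ler_norm (b / 2); have := ler_norm (- (a / 2)); rewrite normrN.
have := normr_ge0 (a / 2); have := normr_ge0 (b / 2).
have := enorm_ge0 (grad h z); have := enorm_ge0 (w - z).
move: `|a / 2| `|b / 2| (dot _ _) (enorm (grad h z)) (enorm (w - z)).
move=> A B p G e e0 G0 B0 A0 hA hB; rewrite !ler_norml => /andP[h1 h2] h3 h4.
have e20 := sqr_ge0 e.
have := ler_wpM2r e20 hA; have := ler_wpM2r e20 hB.
have := mulr_ge0 G0 e20; have := mulr_ge0 A0 e0; have := mulr_ge0 B0 e0.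
have := mulr_ge0 A0 e20; have := mulr_ge0 B0 e20.
move=> *; apply/andP; split; lra.
Qed.

Lemma first_order_optimality (c : R) h Z p w :
  quadratic_upper c h -> convex_body Z -> Z p -> Z w ->
  (forall q, Z q -> h p <= h q) -> 0 <= dot (grad h p) (w - p).
Proof.
move=> up [_ _ Zc] Zp Zw pmin; rewrite -oppr_le0.
apply: (@linear_le_quadratic _ _ (c / 2 * enorm (w - p) ^+ 2)) => t /andP[t0 t1].
have := pmin _ (Zc p w t Zp Zw _); rewrite (ltW t0) t1 => /(_ isT) h1.
have := le_trans h1 (up p _); rewrite (addrC p) addrK !enorm_sq.
rewrite !dotZr !dotZl; lra.
Qed.

Lemma minimizer_growth (c c' : R) h Z p w :
  quadratic_lower c h -> quadratic_upper c' h -> convex_body Z ->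
  Z p -> Z w -> (forall q, Z q -> h p <= h q) ->
  h p + c / 2 * enorm (w - p) ^+ 2 <= h w.
Proof.
move=> lo up Zb Zp Zw pmin.
by have := first_order_optimality up Zb Zp Zw pmin; have := lo p w; lra.
Qed.

(** The upper expansion at [s] is used towards the new point and the lower one
    towards the competitor, so that only the excess [b - L] of the smoothness
    constant over the inverse step length remains. *)
Lemma gradient_step_bound (a b L : R) h Z s w :
  quadratic_lower a h -> quadratic_upper b h -> convex_body Z -> Z w -> 0 < L ->
  let q := AGD_step h Z L s in
  h q <= h w - a / 2 * enorm (w - s) ^+ 2
       + L / 2 * (enorm (w - s) ^+ 2 - enorm (w - q) ^+ 2)
       + (b - L) / 2 * enorm (q - s) ^+ 2.
Proof.
rewrite /= => lo up Zb Zw L0; have := proj_step s (grad h s) Zb Zw L0.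
rewrite /= -/(AGD_step h Z L s); set q := AGD_step _ _ _ _ => h1.
have h2 := up s q; have h3 := lo s w.
have : dot (grad h s) (q - w) = dot (grad h s) (q - s) - dot (grad h s) (w - s).
  by rewrite !dotDr !dotNr; lra.
lra.
Qed.

Lemma AGD_step_in h Z L s : convex_body Z -> Z (AGD_step h Z L s).
Proof. by move=> Zb; have [] := projP (s - L^-1 *: grad h s) Zb. Qed.

Lemma AGD_iterateS h Z z0 L m t :
  let s := AGD_iterate h Z z0 L m t in
  let z := AGD_step h Z L s.2 in
  AGD_iterate h Z z0 L m t.+1 = (z, z + ((Num.sqrt (L / m) - 1) /
    (Num.sqrt (L / m) + 1)) *: (z - s.1)).
Proof. by []. Qed.

(** The step bound against the minimizer, confronted with the growth of the
    objective around it: the ratio of the two moduli is three, hence the factor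
    [(3 - 1) / (3 + 1)]. *)
Lemma short_step (l : R) h Z s :
  0 < l -> quadratic_lower l h -> quadratic_upper (3 * l) h -> convex_body Z ->
  let zs := argmin Z h in
  let q := AGD_step h Z (3 * l) s in
  2 * enorm (q - zs) ^+ 2 <= enorm (s - zs) ^+ 2 /\
  h q - h zs <= l * enorm (s - zs) ^+ 2.
Proof.
rewrite /= => l0 lo up Zb; set zs := argmin Z h; set q := AGD_step _ _ _ _.
have [Zzs zmin] := argminP Zb (quadratic_continuous lo up).
have l3 : 0 < 3 * l by lra.
have := gradient_step_bound s lo up Zb Zzs l3; rewrite /= -/q subrr !mul0r addr0.
rewrite (enormB zs s) (enormB zs q) => h1.
have h2 := minimizer_growth lo up Zb Zzs (AGD_step_in h (3 * l) s Zb) zmin.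
split; last by have := mulr_ge0 (ltW l0) (sqr_ge0 (enorm (q - zs))); lra.
have : l * (2 * enorm (q - zs) ^+ 2) <= l * enorm (s - zs) ^+ 2.
  by move: h1 h2; rewrite -/q -/zs; lra.
by rewrite ler_pM2l.
Qed.

(** The weight [c] trades one distance for the other. *)
Lemma enormB_sq (c : R) (x y : 'rV[R]_d) : 0 < c ->
  enorm (x + y) ^+ 2 <= (1 + c) * enorm x ^+ 2 + (1 + c^-1) * enorm y ^+ 2.
Proof.
move=> c0; rewrite !enorm_sq.
have h : 0 <= c^-1 * dot (c *: x - y) (c *: x - y).
  by rewrite mulr_ge0 ?dot_ge0 // invr_ge0 ltW.
have E : c^-1 * dot (c *: x - y) (c *: x - y) =
  c * dot x x - 2 * dot x y + c^-1 * dot y y.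
  by rewrite !dotE (dotC y x); field; rewrite gt_eqF.
by rewrite !dotE (dotC y x); move: h; rewrite E; lra.
Qed.

(** From [sqrt (3 / 2) <= 9 / 7]. *)
Lemma momentum32 (l : R) : 0 < l ->
  let t := (Num.sqrt (3 * l / (2 * l)) - 1) / (Num.sqrt (3 * l / (2 * l)) + 1) in
  0 <= t <= 8^-1.
Proof.
move=> l0 /=; have -> : 3 * l / (2 * l) = 3 / 2 by field; rewrite gt_eqF.
have s0 : 0 <= 3 / 2 :> R by lra.
have := sqr_sqrtr s0; have := sqrtr_ge0 (3 / 2 : R).
move: (Num.sqrt _) => x x0 x2.
have x1 : 1 <= x by rewrite leNgt; apply/negP => hx; nra.
have x9 : x <= 9 / 7 by rewrite leNgt; apply/negP => hx; nra.
apply/andP; split; first by apply: divr_ge0; lra.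
by rewrite ler_pdivrMr; lra.
Qed.

(** The solver extrapolates with the momentum of the modulus [2 * l] although
    only the modulus [l] is available.  Since each step contracts distances and
    the momentum is at most [1 / 8], the weighted sum of the squared distances
    of two consecutive iterates still contracts by [5 / 6]. *)
Lemma short_momentum (l : R) h Z z0 t :
  0 < l -> quadratic_lower l h -> quadratic_upper (3 * l) h -> convex_body Z ->
  Z z0 -> let zs := argmin Z h in
  let st := AGD_iterate h Z z0 (3 * l) (2 * l) t in
  enorm (st.1 - zs) ^+ 2 <= 9 / 8 * diam Z ^+ 2 * (5 / 6) ^+ t.
Proof.
rewrite /= => l0 lo up Zb Zz0; set zs := argmin Z h.
pose st t := AGD_iterate h Z z0 (3 * l) (2 * l) t.
have [Zzs _] := argminP Zb (quadratic_continuous lo up).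
rewrite -/(st t).
pose th := (Num.sqrt (3 * l / (2 * l)) - 1) / (Num.sqrt (3 * l / (2 * l)) + 1).
have /andP[th0 th8] : 0 <= th <= 8^-1 by exact: momentum32.
have D2 z : Z z -> enorm (z - zs) ^+ 2 <= diam Z ^+ 2.
  by move=> Zz; rewrite lerXn2r ?nnegrE ?enorm_ge0 ?diam_ge0 // diamP.
suff [p [Es hp]] : exists p, (st t).2 = (st t).1 + th *: ((st t).1 - p) /\
    enorm ((st t).1 - zs) ^+ 2 + enorm (p - zs) ^+ 2 / 8
    <= 9 / 8 * diam Z ^+ 2 * (5 / 6) ^+ t.
  by have := sqr_ge0 (enorm (p - zs)); lra.
elim: t => [|t [p [Es IH]]].
  exists z0; rewrite /st /= subrr scaler0 addr0; split => //.
  by have := D2 _ Zz0; rewrite -/zs expr0; lra.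
exists (st t).1; split; first by rewrite /st AGD_iterateS.
have E1 : (st t.+1).1 = AGD_step h Z (3 * l) (st t).2 by [].
have [h1 _] := short_step (st t).2 l0 lo up Zb; move: h1; rewrite -E1 -/zs => h1.
have h2 : enorm ((st t).2 - zs) ^+ 2 <=
   (1 + th) * (1 + 2 * th) * enorm ((st t).1 - zs) ^+ 2
   + th * (1 + 2 * th) * enorm (p - zs) ^+ 2.
  have -> : (st t).2 - zs = (1 + th) *: ((st t).1 - zs) - th *: (p - zs).
    by rewrite Es; apply/rowP => i; rewrite !mxE; ring.
  have : 0 <= th * (1 + th) * enorm ((st t).1 - zs + (p - zs)) ^+ 2.
    by rewrite mulr_ge0 ?sqr_ge0 // mulr_ge0 //; lra.
  rewrite !enorm_sq; move: ((st t).1 - zs) (p - zs) => x y.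
  rewrite !dotE (dotC y x); lra.
have c1 : (1 + th) * (1 + 2 * th) <= 9 / 8 * (5 / 4).
  by apply: ler_pM; lra.
have c2 : th * (1 + 2 * th) <= 8^-1 * (5 / 4).
  by apply: ler_pM; lra.
have := ler_wpM2r (sqr_ge0 (enorm ((st t).1 - zs))) c1.
have := ler_wpM2r (sqr_ge0 (enorm (p - zs))) c2.
have := sqr_ge0 (enorm (p - zs)).
have := sqr_ge0 (enorm ((st t).1 - zs)).
rewrite (exprS _ t); lra.
Qed.

(** The inner solver for the well conditioned variable.  A contraction makes
    the residual of the stopping rule comparable with the distance to the
    solution, in both directions: the rule is met after logarithmically many
    iterations, and once met it certifies the output. *)
Lemma AGD_short (l tau : R) h Z z0 (T : nat) :
  0 < l -> 0 < tau -> quadratic_lower l h -> quadratic_upper (3 * l) h ->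
  convex_body Z -> Z z0 ->
  l * diam Z ^+ 2 * (5 / 6) ^+ T <= tau / 21 ->
  exists out N, [/\ AGD h Z z0 (3 * l) (2 * l) tau out N, Z out,
    l * enorm (out - argmin Z h) ^+ 2 <= 2 * tau,
    h out - h (argmin Z h) <= 3 * tau & (N <= 2 * T.+1)%N].
Proof.
move=> l0 tau0 lo up Zb Zz0 HT; set zs := argmin Z h.
have [Zzs zmin] := argminP Zb (quadratic_continuous lo up).
pose z t := (AGD_iterate h Z z0 (3 * l) (2 * l) t).1.
have stopE y : AGD_stop h Z (3 * l) (2 * l) tau y <->
   9 / 2 * (l * enorm (y - AGD_step h Z (3 * l) y) ^+ 2) <= tau.
  rewrite /AGD_stop.
  have -> : 2 * (3 * l / (2 * l)) ^+ 2 * (3 * l - 2 * l) = 9 / 2 * l.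
    by field; rewrite gt_eqF.
  rewrite ler_pdivlMr; last by lra.
  split=> [[h0|]|h0]; first by exfalso; lra.
    by lra.
  by right; lra.
have scal (r x e y D : R) : 2 * y ^+ 2 <= e ^+ 2 -> x ^+ 2 <= 2 * (e ^+ 2 + y ^+ 2) ->
    e ^+ 2 <= 9 / 8 * D ^+ 2 * (5 / 6 * r) -> l * D ^+ 2 * r <= tau / 21 ->
    9 / 2 * (l * x ^+ 2) <= tau.
  move=> h1 h2 h3 h4; have h5 : x ^+ 2 <= 4 * e ^+ 2 by have := sqr_ge0 e; lra.
  have := ler_wpM2l (ltW l0) h5; have := ler_wpM2l (ltW l0) h3; lra.
have stopT : AGD_stop h Z (3 * l) (2 * l) tau (z T.+1).
  apply/stopE; have [h1 _] := short_step (z T.+1) l0 lo up Zb.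
  move: h1; rewrite -/zs; set q := AGD_step _ _ _ _ => h1.
  have := short_momentum T.+1 l0 lo up Zb Zz0; rewrite /= -/zs -/(z T.+1).
  have := enormD_sq (z T.+1 - zs) (zs - q); rewrite addrA subrK (enormB zs q).
  rewrite (exprS (5 / 6) T) => h2 h3.
  exact: (scal ((5 / 6) ^+ T) _ _ _ (diam Z) h1 h2 h3 HT).
have [t [/andP[t0 tT] st smin]] := @first_positive
  (fun t => AGD_stop h Z (3 * l) (2 * l) tau (z t)) T.+1 isT stopT.
exists (AGD_step h Z (3 * l) (z t)), (2 * t)%N.
have [h1 h2] := short_step (z t) l0 lo up Zb.
move/stopE: (st); move: h1 h2; rewrite -/zs; set q := AGD_step _ _ _ _ => h1 h2 h3.
have h4 : enorm (z t - zs) ^+ 2 <= (1 + 2) * enorm (z t - q) ^+ 2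
   + (1 + 2^-1) * enorm (q - zs) ^+ 2.
  have := @enormB_sq 2 (z t - q) (q - zs) (ltr0Sn _ _).
  by rewrite addrA subrK.
have h5 : enorm (q - zs) ^+ 2 <= 6 * enorm (z t - q) ^+ 2 by lra.
have h6 : enorm (z t - zs) ^+ 2 <= 12 * enorm (z t - q) ^+ 2 by lra.
have h5' := ler_wpM2l (ltW l0) h5; have h6' := ler_wpM2l (ltW l0) h6.
split; [by exists t; split|exact: AGD_step_in|by lra|by lra|].
by rewrite leq_pmul2l.
Qed.

(** A step of length [1 / l] is slightly too long here, since the smoothness
    constant is [l + 2 * mu]; hence the positive last term. *)
Lemma long_step (l mu : R) h Z s w :
  0 < l -> 0 < mu -> quadratic_lower (2 * mu) h ->
  quadratic_upper (l + 2 * mu) h -> convex_body Z -> Z w ->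
  let q := AGD_step h Z l s in
  h q <= h w + l / 2 * (enorm (w - s) ^+ 2 - enorm (w - q) ^+ 2)
     - mu * enorm (w - s) ^+ 2 + mu * enorm (q - s) ^+ 2.
Proof.
rewrite /= => l0 mu0 lo up Zb Zw; set q := AGD_step _ _ _ _.
by have := gradient_step_bound s lo up Zb Zw l0; rewrite /= -/q; lra.
Qed.

(** The solver for the badly conditioned variable.  The excess of the step
    length is a perturbation of relative size [mu / l], while one accelerated
    step contracts the potential by a factor whose distance to [1] is of order
    [sqrt (mu / l)]; the perturbation is harmless for a large condition
    number. *)
Lemma AGD_long (l mu tau : R) h Z z0 (T : nat) :
  0 < l -> 0 < mu -> 128 ^+ 2 * mu <= l -> 0 < tau ->
  quadratic_lower (2 * mu) h -> quadratic_upper (l + 2 * mu) h ->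
  convex_body Z -> Z z0 ->
  24 * (l / mu) ^+ 3 * (l * diam Z ^+ 2) * (1 - (Num.sqrt (l / mu))^-1 / 4) ^+ T <= tau ->
  exists out N, [/\ AGD h Z z0 l mu tau out N, Z out,
    l * enorm (out - argmin Z h) ^+ 2 <= 4 * tau & (N <= 2 * T.+1)%N].
Proof.
move=> l0 mu0 lmu tau0 lo up Zb Zz0 HT; set zs := argmin Z h.
have [Zzs zmin] := argminP Zb (quadratic_continuous lo up).
set k := l / mu in HT; set X := (X in X <= tau) in HT; pose a := (Num.sqrt k)^-1.
have k0 : 0 < k by rewrite divr_gt0.
have kbig : 128 ^+ 2 <= k by rewrite /k ler_pdivlMr.
have s0 : 0 < Num.sqrt k by rewrite sqrtr_gt0.
have sbig : 128 <= Num.sqrt k.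
  by apply: ler_abs_sq; [exact: ltW|rewrite sqr_sqrtr // ltW].
have {}lmu : 16 * mu <= l.
  apply: le_trans lmu; rewrite ler_pM2r //.
  by apply: (@le_trans _ _ (128 * 1)); [lra|rewrite expr2 ler_pM2l; lra].
have {}kbig : 16 <= k by rewrite /k ler_pdivlMr.
have a0 : 0 < a by rewrite invr_gt0.
have a1 : a <= 128^-1 by rewrite /a lef_pV2 // posrE.
have mul : a ^+ 2 * l = mu.
  rewrite /a exprVn sqr_sqrtr ?(ltW k0) // /k; field.
  by rewrite !gt_eqF.
have mul2 : 2 * a ^+ 2 * l = 2 * mu by rewrite -mulrA mul.
have D0 := diam_ge0 Zb.
pose st t := AGD_iterate h Z z0 l mu t; pose z t := (st t).1.
have thE : (Num.sqrt k - 1) / (Num.sqrt k + 1) = (1 - a) / (1 + a).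
  by rewrite /a; field; rewrite !gt_eqF //; lra.
have Zz t : Z (z t) by case: t => // t; exact: AGD_step_in.
have grow w : Z w -> mu * enorm (w - zs) ^+ 2 <= h w - h zs.
  by move=> Zw; have := minimizer_growth lo up Zb Zzs Zw zmin; rewrite -/zs; lra.
have conv t : accelerated h zs l a 0 (diam Z) t (z t) (st t).2.
  elim: t => [|t IH]; first exact: accelerated0.
  have -> : (st t.+1).2 = z t.+1 + ((1 - a) / (1 + a)) *: (z t.+1 - z t).
    by rewrite -thE /z /st AGD_iterateS.
  apply: (acceleratedS (c := 2) l0 _ _ _ _ D0 _ _ _ _ _ IH) => //.
  - by rewrite a0; lra.
  - by lra.
  - by apply: diamP.
  - by apply: diamP.
  - by apply: diamP.
  - rewrite mul; have := grow _ (Zz t).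
    by have := mulr_ge0 (ltW mu0) (sqr_ge0 (enorm (z t - zs))); lra.
  - exact: zmin.
  - have := long_step (st t).2 l0 mu0 lo up Zb (Zz t).
    rewrite /= /step_bound mul mul2 -/(z t.+1) addr0.
    have := enormD_sq (z t - (st t).2) ((st t).2 - z t.+1).
    rewrite addrA subrK (enormB (st t).2 (z t.+1)).
    by move=> /(ler_wpM2l (ltW mu0)); lra.
  - have := long_step (st t).2 l0 mu0 lo up Zb Zzs.
    rewrite /= /step_bound mul mul2 -/(z t.+1) addr0.
    have := enormD_sq (zs - (st t).2) ((st t).2 - z t.+1).
    rewrite addrA subrK (enormB (st t).2 (z t.+1)).
    by move=> /(ler_wpM2l (ltW mu0)); lra.
have lm : 0 < l - mu by lra.
have stopE y : AGD_stop h Z l mu tau y <->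
   2 * k ^+ 2 * (l - mu) * enorm (y - AGD_step h Z l y) ^+ 2 <= tau.
  have den : 0 < 2 * k ^+ 2 * (l - mu).
    by apply: mulr_gt0 => //; apply: mulr_gt0 => //; exact: exprn_gt0.
  rewrite /AGD_stop -/k /= ler_pdivlMr //.
  rewrite mulrC; split=> [[h0|//]|h0]; last by right.
  by exfalso; move: lm; rewrite h0; lra.
(* one step cannot move away from the solution by more than a constant
   factor, so that a point near the solution passes the stopping test *)
have near y : let q := AGD_step h Z l y in
    3 * enorm (q - zs) ^+ 2 <= 5 * enorm (y - zs) ^+ 2.
  move=> q; have := long_step y l0 mu0 lo up Zb Zzs.
  have := zmin _ (AGD_step_in h l y Zb); rewrite /= -/q -/zs.
  rewrite (enormB zs q) (enormB zs y) => h1 h2.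
  have := enormD_sq (q - zs) (zs - y); rewrite addrA subrK (enormB zs y) => h3.
  have h4 := ler_wpM2l (ltW mu0) h3.
  have h5 := ler_wpM2r (sqr_ge0 (enorm (q - zs))) lmu.
  have h6 := ler_wpM2r (sqr_ge0 (enorm (y - zs))) lmu.
  have h7 := mulr_ge0 (ltW l0) (sqr_ge0 (enorm (y - zs))).
  rewrite -(ler_pM2l l0); lra.
have kmu : k * mu = l by rewrite /k mulfVK // gt_eqF.
have stop_near y : 12 * k ^+ 3 * (mu * enorm (y - zs) ^+ 2) <= tau ->
    AGD_stop h Z l mu tau y.
  move=> hy; apply/stopE; have := near y; set q := AGD_step _ _ _ _ => /= h1.
  apply: le_trans hy.
  have h4 : enorm (y - q) ^+ 2 <= 6 * enorm (y - zs) ^+ 2.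
    have := enormD_sq (y - zs) (zs - q); rewrite addrA subrK (enormB zs q).
    by have := sqr_ge0 (enorm (y - zs)); lra.
  have -> : 12 * k ^+ 3 * (mu * enorm (y - zs) ^+ 2) =
    2 * k ^+ 2 * (k * mu) * (6 * enorm (y - zs) ^+ 2) by ring.
  rewrite kmu; apply: ler_pM; rewrite ?sqr_ge0 //.
    by apply: mulr_ge0; [apply: mulr_ge0 => //; exact: sqr_ge0|exact: ltW].
  by apply: ler_wpM2l; [apply: mulr_ge0 => //; exact: sqr_ge0|lra].
have stopT : AGD_stop h Z l mu tau (z T.+1).
  apply/stop_near/(le_trans _ HT).
  have h2 := accelerated_bound l0 (conv T.+1); rewrite mulr0 addr0 in h2.
  have h3 := le_trans (grow _ (Zz T.+1)) h2.
  have k3 : 0 <= 12 * k ^+ 3.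
    by apply: mulr_ge0 => //; apply: exprn_ge0; exact: ltW.
  apply: (le_trans (ler_wpM2l k3 h3)).
  have scal (c D r : R) : 12 * c * (2 * l * D ^+ 2 * r) = 24 * c * (l * D ^+ 2) * r.
    by ring.
  by rewrite scal.
have [t [/andP[t0 tT] stp smin]] := @first_positive
  (fun t => AGD_stop h Z l mu tau (z t)) T.+1 isT stopT.
exists (AGD_step h Z l (z t)), (2 * t)%N.
split; [by exists t; split|exact: AGD_step_in| |by rewrite leq_pmul2l].
have Zq := AGD_step_in h l (z t) Zb.
move/stopE: (stp); set q := AGD_step _ _ _ _ in Zq * => h3.
(* conversely the growth of the objective bounds the distance to the
   solution by the residual, up to a factor of order l / mu *)
have h1 := long_step (z t) l0 mu0 lo up Zb Zzs; move: h1 (zmin _ Zq).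
rewrite /= -/q -/zs (enormB zs q) (enormB zs (z t)) (enormB q (z t)).
have := enorm_triangle (z t) q zs; have := enorm_triangle q (z t) zs.
rewrite (enormB q (z t)).
have := enorm_ge0 (z t - q); have := enorm_ge0 (q - zs); have := enorm_ge0 (z t - zs).
move: (enorm (z t - q)) (enorm (q - zs)) (enorm (z t - zs)) h3
  => r b e h3 e0 b0 r0 tr1 tr2 h1 h2.
have h4 : mu * e ^+ 2 <= l * r * e + mu * r ^+ 2.
  have : e ^+ 2 - b ^+ 2 <= 2 * r * e.
    have [er|er] := leP e r.
      have : e * e <= r * e by apply: ler_wpM2r.
      by have := sqr_ge0 b; have := mulr_ge0 r0 e0; lra.
    have : (e - r) ^+ 2 <= b ^+ 2 by rewrite lerXn2r ?nnegrE //; lra.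
    by have := sqr_ge0 r; lra.
  by move=> /(ler_wpM2l (ltW l0)); lra.
have h5 : mu * e <= (l + mu) * r.
  have [er|er] := leP e r.
    have : mu * e <= mu * r by rewrite ler_pM2l.
    by have := mulr_ge0 (ltW l0) r0; lra.
  have e1 : 0 < e by lra.
  rewrite -(ler_pM2r e1).
  have : mu * r * r <= mu * r * e by apply: ler_wpM2l; [apply: mulr_ge0 => //|]; exact: ltW.
  by lra.
have h6 : b <= (k + 2) * r.
  rewrite -(ler_pM2l mu0).
  have -> : mu * ((k + 2) * r) = (k * mu + 2 * mu) * r by ring.
  by rewrite kmu; have := ler_wpM2l (ltW mu0) tr1; lra.
have h7 : b ^+ 2 <= ((k + 2) * r) ^+ 2.
  by rewrite lerXn2r ?nnegrE ?mulr_ge0 //; lra.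
have h8 : (k + 2) ^+ 2 <= 2 * k ^+ 2.
  have : 16 * k <= k * k by apply: ler_wpM2r => //; exact: ltW.
  lra.
have h9 : l * b ^+ 2 <= l * (2 * k ^+ 2 * r ^+ 2).
  rewrite ler_pM2l //; apply: (le_trans h7); rewrite exprMn.
  by apply: ler_wpM2r => //; exact: sqr_ge0.
have h10 : 0 <= k ^+ 2 * r ^+ 2 by rewrite mulr_ge0 ?sqr_ge0.
have : l * (k ^+ 2 * r ^+ 2) <= 2 * (l - mu) * (k ^+ 2 * r ^+ 2).
  by apply: ler_wpM2r => //; lra.
lra.
Qed.

End ProjectedGradient.

(** * Gradients and first-order expansions *)

Section Gradients.
Variables (R : realType).

Lemma enormZ d (c : R) (v : 'rV[R]_d) : 0 <= c -> enorm (c *: v) = c * enorm v.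
Proof.
by move=> c0; rewrite /enorm dotZl dotZr mulrA -expr2 sqrtrM ?sqr_ge0 // sqrtr_sqr ger0_norm.
Qed.

Lemma derive_grad d (h : 'rV[R]_d -> R) (z v : 'rV[R]_d) :
  differentiable h z -> 'D_v h z = dot (grad h z) v.
Proof.
move=> dh; rewrite deriveE // {1}[v]row_sum_delta linear_sum /=.
by apply: eq_bigr => i _; rewrite linearZ mxE deriveE // mulrC.
Qed.

Lemma is_derive_line d (h : 'rV[R]_d -> R) (z v : 'rV[R]_d) (t : R) :
  differentiable h (z + t *: v) ->
  is_derive t 1 (fun t : R => h (z + t *: v)) (dot (grad h (z + t *: v)) v).
Proof.
move=> dh; have dc : derivable h (z + t *: v) v by exact: diff_derivable.
have dE := derive_grad v dh; move: dE dc; rewrite /derivable /derive => dE dc.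
have E : (fun s : R => s^-1 *: (((fun t : R => h (z + t *: v)) \o shift t) (s *: (1 : R))
            - h (z + t *: v))) =
    (fun s : R => s^-1 *: ((h \o shift (z + t *: v)) (s *: v) - h (z + t *: v))).
  apply/funext => s; congr (_ *: (h _ - _)).
  by rewrite /= scalerDl -scalerA scale1r addrCA.
apply: DeriveDef; first by rewrite /derivable E.
by rewrite /derive E.
Qed.

(** The mean value theorem on the segment, applied to the restriction of [h]
    minus its first-order expansion and the quadratic bound; the sign [e]
    treats the two inequalities at once. *)
Lemma smooth_expansion d (l : R) (h : 'rV[R]_d -> R) z w : smooth l h ->
  `|h w - h z - dot (grad h z) (w - z)| <= l / 2 * enorm (w - z) ^+ 2.
Proof.
move=> [dh Lh]; set v := w - z.
have gen (e : R) : `|e| <= 1 ->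
    e * (h w - h z - dot (grad h z) v) <= l / 2 * enorm v ^+ 2.
  move=> e1.
  pose k (t : R) := e * (h (z + t *: v) - t * dot (grad h z) v)
                    - l / 2 * enorm v ^+ 2 * t ^+ 2.
  pose dk (t : R) := e * (dot (grad h (z + t *: v)) v - dot (grad h z) v)
                    - l * enorm v ^+ 2 * t.
  have kd (t : R) : is_derive t 1 k (dk t).
    have h1 := is_derive_line (dh (z + t *: v)).
    rewrite /k /dk; apply: is_derive_eq.
    rewrite /GRing.scale /=; by field.
  have kc : {within `[0, 1], continuous k}.
    apply: continuous_subspaceT => s; apply: differentiable_continuous.
    by apply/derivable1_diffP; have [] := kd s.
  have [c /[!in_itv] /= /andP[c0 c1] kE] := MVT ltr01 (fun t _ => kd t) kc.
  have : dk c <= 0.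
    rewrite /dk subr_le0 -[X in X - _]dotC -[X in _ - X]dotC -dotNr -dotDr.
    apply: le_trans (ler_norm _) _; rewrite normrM.
    apply: le_trans (ler_wpM2r (normr_ge0 _) e1) _; rewrite mul1r dotC.
    apply: le_trans (dot_abs _ _) _.
    have := ler_wpM2r (enorm_ge0 v) (Lh (z + c *: v) z).
    rewrite (addrC z) addrK.
    rewrite enormZ ?(ltW c0) //.
    by move/le_trans; apply; rewrite expr2; lra.
  have k1 : k 1 = e * (h w - dot (grad h z) v) - l / 2 * enorm v ^+ 2.
    by rewrite /k scale1r /v (addrC z) subrK expr1n mulr1 mul1r.
  have k0 : k 0 = e * h z by rewrite /k scale0r addr0 mul0r expr0n /= mulr0 !subr0.
  move: kE; rewrite k1 k0 subr0 mulr1; lra.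
have := gen 1; have := gen (- 1).
rewrite normrN normr1 lexx => /(_ isT) h1 /(_ isT) h2.
by rewrite ler_norml; lra.
Qed.

(** Gradients of partial, shifted and opposite functions are all read off from
    their expansions through this uniqueness property. *)
Lemma grad_of_expansion d (h : 'rV[R]_d -> R) z (G : 'rV[R]_d) (C : R) :
  (forall w, `|h w - h z - dot G (w - z)| <= C * enorm (w - z) ^+ 2) ->
  grad h z = G.
Proof.
move=> H; apply/rowP => j; rewrite mxE /derive.
pose e : 'rV[R]_d := delta_mx 0 j.
have eE : dot G e = G 0 j.
  rewrite /dot (bigD1 j) //= mxE !eqxx mulr1 big1 ?addr0 // => i ij.
  by rewrite mxE (negbTE ij) andbF mulr0.
have lim (c : R) : (fun t : R => G 0 j + c * `|t|) @ 0^' --> G 0 j.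
  apply: (@cvg_trans _ ((fun t : R => G 0 j + c * `|t|) @ nbhs (0 : R))).
    by apply: cvg_app; exact: cvg_within.
  have -> : nbhs (G 0 j) = nbhs (G 0 j + c * `|0 : R|).
    by rewrite normr0 mulr0 addr0.
  apply: (continuousD (f := fun=> G 0 j) (g := fun t : R => c * `|t|)).
    exact: cst_continuous.
  apply: continuousM.
    exact: cst_continuous.
  exact: norm_continuous.
apply: cvg_lim => //.
apply: (squeeze_cvgr _ (lim (- (C * enorm e ^+ 2))) (lim (C * enorm e ^+ 2))).
near=> t.
have t0 : t != 0 by near: t; exact: nbhs_dnbhs_neq.
have := H (t *: e + z); rewrite addrK dotZr eE.
have -> : enorm (t *: e) ^+ 2 = `|t| ^+ 2 * enorm e ^+ 2.
  by rewrite !enorm_sq !dotE real_normK ?num_real // mulrA -expr2.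
move=> h1.
have : `|t^-1 * (h (t *: e + z) - h z) - G 0 j| <= C * enorm e ^+ 2 * `|t|.
  have -> : t^-1 * (h (t *: e + z) - h z) - G 0 j =
     t^-1 * (h (t *: e + z) - h z - t * G 0 j) by field.
  rewrite normrM normfV ler_pdivrMl ?normr_gt0 //; apply: (le_trans h1); lra.
rewrite ler_norml /GRing.scale /= => /andP[h2 h3]; apply/andP; split; lra.
Unshelve. all: by end_near. Qed.

End Gradients.

(** * Smooth saddle functions *)

Section SaddleFunctions.
Variable (R : realType).

Definition expands d (C : R) (h : 'rV[R]_d -> R) := forall z w,
  `|h w - h z - dot (grad h z) (w - z)| <= C * enorm (w - z) ^+ 2.

Lemma expandsN d C (h : 'rV[R]_d -> R) : expands C h ->
  (forall z, grad (fun z => - h z) z = - grad h z) /\ expands C (fun z => - h z).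
Proof.
move=> H; have G z : grad (fun z => - h z) z = - grad h z.
  apply: (grad_of_expansion (C := C)) => w; rewrite dotNl opprK.
  by rewrite -normrN !opprD !opprK; apply: le_trans (H z w); rewrite -normrN !opprD !opprK.
split => // z w; rewrite G dotNl opprK -normrN.
by apply: le_trans (H z w); rewrite !opprD !opprK.
Qed.

Section QuadraticShift.
Variables (d : nat) (C b e : R) (z0 : 'rV[R]_d) (h k : 'rV[R]_d -> R).
Hypothesis kE : forall z, k z = h z + b * enorm (z - z0) ^+ 2 + e.
Hypothesis hC : expands C h.

Lemma quadratic_shiftE z w : k w - k z - dot (grad h z + (2 * b) *: (z - z0)) (w - z)
  = h w - h z - dot (grad h z) (w - z) + b * enorm (w - z) ^+ 2.
Proof.
rewrite !kE !enorm_sq (dotDl (grad h z)) (dotZl (2 * b)).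
have -> : w - z0 = (w - z) + (z - z0) by rewrite addrA subrK.
move: (w - z) (z - z0) => u v; rewrite !dotE (dotC v u); ring.
Qed.

Lemma grad_quadratic_shift z : grad k z = grad h z + (2 * b) *: (z - z0).
Proof.
apply: (grad_of_expansion (C := C + `|b|)) => w; rewrite quadratic_shiftE.
apply: le_trans (ler_normD _ _) _; rewrite mulrDl lerD // normrM.
by rewrite (ger0_norm (sqr_ge0 _)).
Qed.

Lemma quadratic_lower_shift (a : R) :
  quadratic_lower a h -> quadratic_lower (a + 2 * b) k.
Proof.
move=> lo z w; have := lo z w; have := quadratic_shiftE z w.
by rewrite grad_quadratic_shift; lra.
Qed.

Lemma quadratic_upper_shift (a : R) :
  quadratic_upper a h -> quadratic_upper (a + 2 * b) k.
Proof.
move=> lo z w; have := lo z w; have := quadratic_shiftE z w.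
by rewrite grad_quadratic_shift; lra.
Qed.

End QuadraticShift.

Section Joint.
Variables (m n : nat).
Implicit Types (x : 'rV[R]_m) (y : 'rV[R]_n).

Lemma dot_row_mx (u v : 'rV[R]_(m + n)) :
  dot u v = dot (lsubmx u) (lsubmx v) + dot (rsubmx u) (rsubmx v).
Proof.
rewrite /dot big_split_ord /=.
by congr (_ + _); apply: eq_bigr => i _; rewrite !mxE.
Qed.

Lemma enorm_lsubmx (u : 'rV[R]_(m + n)) : enorm (lsubmx u) <= enorm u.
Proof. by rewrite ler_sqrt ?dot_ge0 // (dot_row_mx u u) lerDl dot_ge0. Qed.

Lemma enorm_rsubmx (u : 'rV[R]_(m + n)) : enorm (rsubmx u) <= enorm u.
Proof. by rewrite ler_sqrt ?dot_ge0 // (dot_row_mx u u) lerDr dot_ge0. Qed.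

Lemma enorm_row_l x : enorm (row_mx x (0 : 'rV[R]_n)) = enorm x.
Proof. by rewrite /enorm dot_row_mx !row_mxKl !row_mxKr dot0l addr0. Qed.

Lemma enorm_row_r y : enorm (row_mx (0 : 'rV[R]_m) y) = enorm y.
Proof. by rewrite /enorm dot_row_mx !row_mxKl !row_mxKr dot0l add0r. Qed.

Lemma row_mxB_l x x' y : row_mx x y - row_mx x' y = row_mx (x - x') 0.
Proof. by rewrite opp_row_mx add_row_mx subrr. Qed.

Lemma row_mxB_r x y y' : row_mx x y - row_mx x y' = row_mx 0 (y - y').
Proof. by rewrite opp_row_mx add_row_mx subrr. Qed.

Lemma jointE (f : 'rV[R]_m -> 'rV[R]_n -> R) x y : joint f (row_mx x y) = f x y.
Proof. by rewrite /joint row_mxKl row_mxKr. Qed.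

Section Partial.
Variables (l : R) (f : 'rV[R]_m -> 'rV[R]_n -> R).
Hypothesis fs : smooth l (joint f).

Lemma joint_expansion_x x x' y :
  `|f x' y - f x y - dot (lsubmx (grad (joint f) (row_mx x y))) (x' - x)|
  <= l / 2 * enorm (x' - x) ^+ 2.
Proof.
have := smooth_expansion (row_mx x y) (row_mx x' y) fs.
by rewrite !jointE row_mxB_l enorm_row_l dot_row_mx !row_mxKl !row_mxKr dot0r addr0.
Qed.

Lemma joint_expansion_y x y y' :
  `|f x y' - f x y - dot (rsubmx (grad (joint f) (row_mx x y))) (y' - y)|
  <= l / 2 * enorm (y' - y) ^+ 2.
Proof.
have := smooth_expansion (row_mx x y) (row_mx x y') fs.
by rewrite !jointE row_mxB_r enorm_row_r dot_row_mx !row_mxKl !row_mxKr dot0r add0r.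
Qed.

Lemma partial_grad_x x y :
  grad (f^~ y) x = lsubmx (grad (joint f) (row_mx x y)).
Proof. by apply: (grad_of_expansion (C := l / 2)) => x'; exact: joint_expansion_x. Qed.

Lemma partial_grad_y x y :
  grad (f x) y = rsubmx (grad (joint f) (row_mx x y)).
Proof. by apply: (grad_of_expansion (C := l / 2)) => y'; exact: joint_expansion_y. Qed.

Lemma partial_expands_x y : expands (l / 2) (f^~ y).
Proof. by move=> x x'; rewrite partial_grad_x; exact: joint_expansion_x. Qed.

Lemma partial_expands_y x : expands (l / 2) (f x).
Proof. by move=> y y'; rewrite partial_grad_y; exact: joint_expansion_y. Qed.

Let lip (u v : 'rV[R]_(m + n)) :
  enorm (grad (joint f) u - grad (joint f) v) <= l * enorm (u - v).
Proof. exact: fs.2. Qed.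

Lemma partial_lipschitz_xx x x' y :
  enorm (grad (f^~ y) x - grad (f^~ y) x') <= l * enorm (x - x').
Proof.
rewrite !partial_grad_x -linearB /=; apply: le_trans (enorm_lsubmx _) _.
by apply: le_trans (lip _ _) _; rewrite row_mxB_l enorm_row_l.
Qed.

Lemma partial_lipschitz_xy x y y' :
  enorm (grad (f^~ y) x - grad (f^~ y') x) <= l * enorm (y - y').
Proof.
rewrite !partial_grad_x -linearB /=; apply: le_trans (enorm_lsubmx _) _.
by apply: le_trans (lip _ _) _; rewrite row_mxB_r enorm_row_r.
Qed.

Lemma partial_lipschitz_yx x x' y :
  enorm (grad (f x) y - grad (f x') y) <= l * enorm (x - x').
Proof.
rewrite !partial_grad_y -linearB /=; apply: le_trans (enorm_rsubmx _) _.
by apply: le_trans (lip _ _) _; rewrite row_mxB_l enorm_row_l.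
Qed.

Lemma partial_lipschitz_yy x y y' :
  enorm (grad (f x) y - grad (f x) y') <= l * enorm (y - y').
Proof.
rewrite !partial_grad_y -linearB /=; apply: le_trans (enorm_rsubmx _) _.
by apply: le_trans (lip _ _) _; rewrite row_mxB_r enorm_row_r.
Qed.

End Partial.

(** The curvature data of a saddle function used by the analysis.  Convexity
    in [x] is only required at the points of [V], because the algorithm
    evaluates the function at extrapolated points that may leave the feasible
    set, where some of the convexity is lost. *)
Record saddle_smooth (F : 'rV[R]_m -> 'rV[R]_n -> R) (X : set 'rV[R]_m)
    (V : set 'rV[R]_n) (mx Mx my My l : R) : Prop := SaddleSmooth {
  saddle_xlo : forall y, V y -> quadratic_lower mx (F^~ y);
  saddle_xup : forall y, quadratic_upper Mx (F^~ y);
  saddle_ylo : forall x, X x -> quadratic_lower my (fun y => - F x y);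
  saddle_yup : forall x, quadratic_upper My (fun y => - F x y);
  saddle_gradN : forall x y, grad (fun y => - F x y) y = - grad (F x) y;
  saddle_gradNx : forall x y, grad (fun x => - F x y) x = - grad (F^~ y) x;
  saddle_lip_xx : forall x x' y,
    enorm (grad (F^~ y) x - grad (F^~ y) x') <= Mx * enorm (x - x');
  saddle_lip_xy : forall x y y',
    enorm (grad (F^~ y) x - grad (F^~ y') x) <= l * enorm (y - y');
  saddle_lip_yx : forall x x' y,
    enorm (grad (F x) y - grad (F x') y) <= l * enorm (x - x');
  saddle_lip_yy : forall x y y',
    enorm (grad (F x) y - grad (F x) y') <= My * enorm (y - y') }.

Lemma expands_upper d C (h : 'rV[R]_d -> R) : expands C h ->
  quadratic_upper (2 * C) h.
Proof. by move=> H z w; have := H z w; rewrite ler_norml => /andP[_]; lra. Qed.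

Lemma expands_lower d C (h : 'rV[R]_d -> R) : expands C h ->
  quadratic_lower (- (2 * C)) h.
Proof. by move=> H z w; have := H z w; rewrite ler_norml => /andP[]; lra. Qed.

(** The two regularizations of the algorithm, [- c |y - y0|^2] for strong
    concavity and [b |x - xt|^2] for the proximal subproblems.  With [b] large
    the second one makes a merely smooth function convex in [x], which is how
    a negative [mx] is used. *)
Lemma saddle_smooth_regularized (l mx b c : R) (f F : 'rV[R]_m -> 'rV[R]_n -> R)
    (X : set 'rV[R]_m) (V : set 'rV[R]_n) xt y0 :
  smooth l (joint f) -> 0 <= b -> 0 <= c ->
  (forall y, V y -> quadratic_lower mx (f^~ y)) ->
  (forall x, X x -> quadratic_lower 0 (fun y => - f x y)) ->
  (forall x y, F x y = f x y - c * enorm (y - y0) ^+ 2 + b * enorm (x - xt) ^+ 2) ->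
  saddle_smooth F X V (mx + 2 * b) (l + 2 * b) (2 * c) (l + 2 * c) l.
Proof.
move=> fs b0 c0 flo fco FE.
have l0 x : enorm x = 0 \/ 0 < enorm x :> R.
  by have := enorm_ge0 x; rewrite le_eqVlt => /orP[/eqP|]; auto.
have ex := partial_expands_x fs; have ey := partial_expands_y fs.
have FxE y x : (F^~ y) x = (f^~ y) x + b * enorm (x - xt) ^+ 2 - c * enorm (y - y0) ^+ 2.
  by rewrite FE; ring.
have FyE x y : F x y = f x y + (- c) * enorm (y - y0) ^+ 2 + b * enorm (x - xt) ^+ 2.
  by rewrite FE; ring.
have FNE x y : - F x y = - f x y + c * enorm (y - y0) ^+ 2 + - b * enorm (x - xt) ^+ 2.
  by rewrite FE; ring.
have gx x y : grad (F^~ y) x = grad (f^~ y) x + (2 * b) *: (x - xt).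
  exact: (grad_quadratic_shift (FxE y) (ex y)).
have gy x y : grad (F x) y = grad (f x) y + (2 * - c) *: (y - y0).
  exact: (grad_quadratic_shift (FyE x) (ey x)).
have eN x := expandsN (ey x).
have gN x y : grad (fun y => - F x y) y = grad (fun y => - f x y) y + (2 * c) *: (y - y0).
  exact: (grad_quadratic_shift (FNE x) (eN x).2).
have exN y := expandsN (ex y).
have FNxE y x : - F x y = - f x y + (- b) * enorm (x - xt) ^+ 2 + c * enorm (y - y0) ^+ 2.
  by rewrite FE; ring.
split.
- by move=> y Vy; exact: (quadratic_lower_shift (FxE y) (ex y) (flo y Vy)).
- move=> y; have := quadratic_upper_shift (FxE y) (ex y) (expands_upper (ex y)).
  by have -> : 2 * (l / 2) = l by field.
- move=> x Xx; have := quadratic_lower_shift (FNE x) (eN x).2 (fco x Xx).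
  by rewrite add0r.
- move=> x; have := quadratic_upper_shift (FNE x) (eN x).2 (expands_upper (eN x).2).
  by have -> : 2 * (l / 2) = l by field.
- move=> x y; rewrite gN gy (eN x).1 opprD; congr (_ + _).
  by rewrite mulrN scaleNr opprK.
- move=> x y; rewrite gx (grad_quadratic_shift (FNxE y) (exN y).2) (exN y).1.
  by rewrite opprD mulrN scaleNr.
- move=> x x' y; rewrite !gx.
  have -> : grad (f^~ y) x + (2 * b) *: (x - xt) - (grad (f^~ y) x' + (2 * b) *: (x' - xt))
    = (grad (f^~ y) x - grad (f^~ y) x') + (2 * b) *: (x - x').
    by apply/rowP => i; rewrite !mxE; ring.
  apply: le_trans (enormD _ _) _; rewrite [leRHS]mulrDl; apply: lerD.
    exact: partial_lipschitz_xx fs _ _ _.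
  by rewrite enormZ // mulr_ge0.
- move=> x y y'; rewrite !gx.
  have -> : grad (f^~ y) x + (2 * b) *: (x - xt) - (grad (f^~ y') x + (2 * b) *: (x - xt))
    = grad (f^~ y) x - grad (f^~ y') x by apply/rowP => i; rewrite !mxE; ring.
  exact: partial_lipschitz_xy fs _ _ _.
- move=> x x' y; rewrite !gy.
  have -> : grad (f x) y + (2 * - c) *: (y - y0) - (grad (f x') y + (2 * - c) *: (y - y0))
    = grad (f x) y - grad (f x') y by apply/rowP => i; rewrite !mxE; ring.
  exact: partial_lipschitz_yx fs _ _ _.
- move=> x y y'; rewrite !gy.
  have -> : grad (f x) y + (2 * - c) *: (y - y0) - (grad (f x) y' + (2 * - c) *: (y' - y0))
    = (grad (f x) y - grad (f x) y') + (2 * c) *: (y' - y).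
    by apply/rowP => i; rewrite !mxE; ring.
  apply: le_trans (enormD _ _) _; rewrite [leRHS]mulrDl; apply: lerD.
    exact: partial_lipschitz_yy fs _ _ _.
  by rewrite enormZ ?mulr_ge0 // (enormB y').
Qed.

(** Both expansions at the origin, compared at one nonzero vector; this is
    where the dimension has to be positive. *)
Lemma strongly_convex_le_smooth (l mu : R) (f : 'rV[R]_m -> 'rV[R]_n -> R) y :
  (0 < m)%N -> smooth l (joint f) -> quadratic_lower mu (f^~ y) -> mu <= l.
Proof.
move=> m0 fs lo; pose e : 'rV[R]_m := const_mx 1.
have up := expands_upper (partial_expands_x fs y).
have e0 : 0 < enorm e.
  rewrite sqrtr_gt0 /dot; under eq_bigr do rewrite mxE mulr1.
  by rewrite sumr_const card_ord ltr0n.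
have := le_trans (lo 0 e) (up 0 e); rewrite subr0.
rewrite -!addrA !lerD2l => h.
have : mu / 2 * enorm e ^+ 2 <= 2 * (l / 2) / 2 * enorm e ^+ 2 by lra.
by rewrite ler_pM2r ?exprn_gt0 //; lra.
Qed.

End Joint.
End SaddleFunctions.

(** * Value functions and saddle points *)

Section Minimizers.
Variables (R : realType) (d : nat).

Lemma proj_id (Z : set 'rV[R]_d) z : convex_body Z -> Z z -> proj Z z = z.
Proof.
move=> Zb Zz; have [_ /(_ z Zz)] := projP z Zb.
by rewrite subrr enorm0 => /enorm_le0/eqP; rewrite subr_eq0 => /eqP.
Qed.

(** The optimality conditions of the two minimizers, each tested at the other
    one, against the strong monotonicity of the first gradient. *)
Lemma minimizer_lipschitz (c c1 c2 : R) (h1 h2 : 'rV[R]_d -> R) (Z : set 'rV[R]_d) p1 p2 :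
  quadratic_lower c h1 -> quadratic_upper c1 h1 -> quadratic_upper c2 h2 ->
  convex_body Z -> Z p1 -> Z p2 ->
  (forall q, Z q -> h1 p1 <= h1 q) -> (forall q, Z q -> h2 p2 <= h2 q) ->
  c * enorm (p1 - p2) <= enorm (grad h1 p2 - grad h2 p2).
Proof.
move=> lo up1 up2 Zb Z1 Z2 m1 m2.
have o1 := first_order_optimality up1 Zb Z1 Z2 m1.
have o2 := first_order_optimality up2 Zb Z2 Z1 m2.
have := lo p1 p2; have := lo p2 p1; rewrite (enormB p2 p1) => l1 l2.
have h : c * enorm (p1 - p2) ^+ 2 <=
    enorm (grad h1 p2 - grad h2 p2) * enorm (p1 - p2).
  apply: (@le_trans _ _ (dot (grad h2 p2 - grad h1 p2) (p1 - p2))); last first.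
    by rewrite (enormB (grad h1 p2)); exact: dot_le.
  have : dot (grad h1 p1) (p2 - p1) = - dot (grad h1 p1) (p1 - p2).
    by rewrite -dotNr opprB.
  by rewrite dotDl dotNl; lra.
have [h0|h0] := leP (enorm (p1 - p2)) 0.
  have -> : enorm (p1 - p2) = 0 by apply/eqP; rewrite eq_le h0 enorm_ge0.
  by rewrite mulr0 enorm_ge0.
by move: h; rewrite expr2 mulrA ler_pM2r.
Qed.

End Minimizers.

Section ValueFunction.
Variables (R : realType) (m n : nat) (F : 'rV[R]_m -> 'rV[R]_n -> R).
Variables (X : set 'rV[R]_m) (Y V : set 'rV[R]_n) (mx Mx my My l : R).
Hypotheses (Fs : saddle_smooth F X V mx Mx my My l).
Hypotheses (Xb : convex_body X) (Yb : convex_body Y) (YV : Y `<=` V).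
Hypotheses (mx0 : 0 < mx) (my0 : 0 < my) (l0 : 0 <= l) (My0 : 0 <= My).

Definition best_x y := argmin X (F^~ y).
Definition best_y x := argmin Y (fun y => - F x y).

Lemma best_xP y : V y -> X (best_x y) /\
  forall x, X x -> F (best_x y) y + mx / 2 * enorm (x - best_x y) ^+ 2 <= F x y.
Proof.
move=> Vy; have lo := saddle_xlo Fs Vy; have up := saddle_xup Fs y.
have [Xp pm] := argminP Xb (quadratic_continuous lo up); split => // x Xx.
exact: (minimizer_growth lo up Xb Xp Xx pm).
Qed.

Lemma best_x_le y x : V y -> X x -> F (best_x y) y <= F x y.
Proof.
move=> Vy Xx; have [_ /(_ x Xx)] := best_xP Vy.
by have := mulr_ge0 (ltW mx0) (sqr_ge0 (enorm (x - best_x y))); lra.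
Qed.

Lemma best_yP x : X x -> Y (best_y x) /\
  forall y, Y y -> F x y + my / 2 * enorm (y - best_y x) ^+ 2 <= F x (best_y x).
Proof.
move=> Xx; have lo := saddle_ylo Fs Xx; have up := saddle_yup Fs x.
have [Yp pm] := argminP Yb (quadratic_continuous lo up); split => // y Yy.
by have := minimizer_growth lo up Yb Yp Yy pm; rewrite -/(best_y x); lra.
Qed.

Lemma best_y_ge x y : X x -> Y y -> F x y <= F x (best_y x).
Proof.
move=> Xx Yy; have [_ /(_ y Yy)] := best_yP Xx.
by have := mulr_ge0 (ltW my0) (sqr_ge0 (enorm (y - best_y x))); lra.
Qed.

Lemma best_x_lipschitz y y' : V y -> V y' ->
  mx * enorm (best_x y - best_x y') <= l * enorm (y - y').
Proof.
move=> Vy Vy'; have [X1 _] := best_xP Vy; have [X2 _] := best_xP Vy'.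
apply: le_trans (saddle_lip_xy Fs (best_x y') y y').
exact: (minimizer_lipschitz (saddle_xlo Fs Vy) (saddle_xup Fs y) (saddle_xup Fs y')
  Xb X1 X2 (fun x => best_x_le Vy (x := x)) (fun x => best_x_le Vy' (x := x))).
Qed.

Lemma best_y_lipschitz x x' : X x -> X x' ->
  my * enorm (best_y x - best_y x') <= l * enorm (x - x').
Proof.
move=> Xx Xx'; have [Y1 _] := best_yP Xx; have [Y2 _] := best_yP Xx'.
apply: le_trans (saddle_lip_yx Fs x x' (best_y x')).
have -> : enorm (grad (F x) (best_y x') - grad (F x') (best_y x')) =
  enorm (grad (fun y => - F x y) (best_y x') - grad (fun y => - F x' y) (best_y x')).
  by rewrite !(saddle_gradN Fs) -opprD enormN.
apply: (minimizer_lipschitz (saddle_ylo Fs Xx) (saddle_yup Fs x) (saddle_yup Fs x')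
  Yb Y1 Y2) => y Yy; rewrite lerN2; exact: best_y_ge.
Qed.

Lemma concave_upper x y y' : X x ->
  F x y' <= F x y + dot (grad (F x) y) (y' - y) - my / 2 * enorm (y' - y) ^+ 2.
Proof.
by move=> Xx; have := saddle_ylo Fs Xx y y'; rewrite (saddle_gradN Fs) dotNl; lra.
Qed.

(** The value function [y |-> F (best_x y) y] inherits a quadratic lower
    expansion, even from the partial gradient at an approximate minimizer
    [xt]: an inexact first-order oracle in the sense of Devolder, Glineur and
    Nesterov.  The curvature [c] pays for the motion of the minimizer. *)
Lemma value_lower (c : R) x xt s q : l ^+ 2 <= mx * c -> V s -> X x ->
  F (best_x s) s + dot (grad (F xt) s) (q - s)
    - (My / 2 + c / 2 + l / 2) * enorm (q - s) ^+ 2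
    - l / 2 * enorm (xt - best_x s) ^+ 2 <= F x q.
Proof.
move=> hc Vs Xx; have := saddle_yup Fs x s q; rewrite (saddle_gradN Fs) dotNl => h1.
have [_ /(_ x Xx) h2] := best_xP Vs.
have h3 : - (l * enorm (x - xt) * enorm (q - s)) <=
    dot (grad (F x) s) (q - s) - dot (grad (F xt) s) (q - s).
  have := dot_abs (grad (F x) s - grad (F xt) s) (q - s).
  rewrite dotDl dotNl ler_norml => /andP[h _]; apply: le_trans h; rewrite lerN2.
  by apply: ler_wpM2r (saddle_lip_yx Fs x xt s); exact: enorm_ge0.
have := enorm_triangle x (best_x s) xt; rewrite (enormB (best_x s) xt).
move: h1 h2 h3; move: (enorm_ge0 (x - best_x s)) (enorm_ge0 (xt - best_x s))
  (enorm_ge0 (q - s)).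
move: (enorm (x - best_x s)) (enorm (xt - best_x s)) (enorm (q - s)) (enorm (x - xt)).
move=> a e r b a0 e0 r0 h1 h2 h3 h4.
have h5 : l * b * r <= l * a * r + l * e * r.
  have : l * r * b <= l * r * (a + e) by apply: ler_wpM2l => //; exact: mulr_ge0.
  by lra.
have h6 : l * a * r <= mx / 2 * a ^+ 2 + c / 2 * r ^+ 2.
  rewrite -(ler_pM2l mx0).
  have := sqr_ge0 (mx * a - l * r); have := ler_wpM2r (sqr_ge0 r) hc; lra.
have h7 : l * e * r <= l / 2 * e ^+ 2 + l / 2 * r ^+ 2.
  by have := mulr_ge0 l0 (sqr_ge0 (e - r)); lra.
lra.
Qed.

Lemma value_upper w s xt : V w -> X xt ->
  F (best_x w) w <= F xt s + dot (grad (F xt) s) (w - s) - my / 2 * enorm (w - s) ^+ 2.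
Proof.
by move=> Vw Xxt; apply: le_trans (best_x_le Vw Xxt) _; exact: concave_upper.
Qed.

(** A saddle point is obtained from a maximizer of the value function: its
    first-order condition is that of the maximization of [F xs], since the
    expansions of the two functions agree to first order. *)
Lemma saddle_exists : exists xs ys, [/\ X xs, Y ys,
  forall x, X x -> F xs ys + mx / 2 * enorm (x - xs) ^+ 2 <= F x ys,
  forall y, Y y -> F xs y <= F xs ys - my / 2 * enorm (y - ys) ^+ 2 &
  xs = best_x ys].
Proof.
pose C := My / 2 + (l ^+ 2 / mx) / 2 + l / 2.
have hc : l ^+ 2 <= mx * (l ^+ 2 / mx) by rewrite mulrCA mulfV ?mulr1 // gt_eqF.
have C0 : 0 <= C by rewrite !addr_ge0 // divr_ge0 // divr_ge0 ?sqr_ge0 // ltW.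
have low s q : Y s -> Y q -> F (best_x s) s + dot (grad (F (best_x s)) s) (q - s)
    - C * enorm (q - s) ^+ 2 <= F (best_x q) q.
  move=> Ys Yq; have [Xq _] := best_xP (YV Yq).
  have := value_lower (best_x s) q hc (YV Ys) Xq.
  by rewrite subrr enorm0 expr0n mulr0 subr0.
(* the value function is controlled on Y only; composing it with the
   projection makes it continuous everywhere *)
pose phi y := - F (best_x (proj Y y)) (proj Y y).
have phic : continuous phi.
  apply: continuous_of_modulus => z; pose s := proj Y z.
  have Ys : Y s by have [] := projP z Yb.
  exists (enorm (grad (F (best_x s)) s) + C) => w; pose q := proj Y w.
  have Yq : Y q by have [] := projP w Yb.
  have h1 := low s q Ys Yq.
  have [Xs _] := best_xP (YV Ys).
  have h2 := value_upper s (YV Yq) Xs.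
  have h3 := dot_abs (grad (F (best_x s)) s) (q - s).
  have h4 : enorm (q - s) <= enorm (w - z) by exact: proj_nonexpansive.
  rewrite /phi -/s -/q.
  have h5 : enorm (q - s) ^+ 2 <= enorm (w - z) ^+ 2.
    by rewrite lerXn2r ?nnegrE ?enorm_ge0.
  have h6 := ler_wpM2l C0 h5.
  have h7 := ler_wpM2l (enorm_ge0 (grad (F (best_x s)) s)) h4.
  have h8 := mulr_ge0 (enorm_ge0 (grad (F (best_x s)) s)) (sqr_ge0 (enorm (w - z))).
  have h9 := mulr_ge0 C0 (enorm_ge0 (w - z)).
  have h10 := mulr_ge0 C0 (sqr_ge0 (enorm (w - z))).
  have h11 := mulr_ge0 (ltW my0) (sqr_ge0 (enorm (q - s))).
  move: h3; rewrite ler_norml => /andP[h31 h32].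
  by rewrite ler_norml; apply/andP; split; lra.
pose ys := argmin Y phi; have [Yys pmin] := argminP Yb phic.
exists (best_x ys), ys; have [Xxs xmin] := best_xP (YV Yys).
split => // y Yy; set xs := best_x ys in Xxs xmin *.
have opt : dot (grad (F xs) ys) (y - ys) <= 0.
  apply: (@linear_le_quadratic _ _ (C * enorm (y - ys) ^+ 2)) => t /andP[t0 t1].
  have Yt : Y (ys + t *: (y - ys)) by case: Yb => _ _; apply => //; rewrite (ltW t0).
  have := pmin _ Yt; rewrite /phi !proj_id // lerN2 => h1.
  have := le_trans (low ys _ Yys Yt) h1.
  by rewrite (addrC ys) addrK dotZr enormZ ?(ltW t0) // exprMn; lra.
by have := concave_upper ys y Xxs; lra.
Qed.

End ValueFunction.

(** A projected gradient step in one variable turns closeness of a pair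
    [(xt, yt)] to the saddle point [(xs, ys)] into a bound on the objective,
    without any bound on the size of the gradients.  The gradient is taken at
    the approximate pair; the errors of its two arguments are paid by the
    negative terms of the three-point inequality and by the concavity of
    [F xs]. *)
Lemma projected_step_gap (R : realType) m n (F : 'rV[R]_m -> 'rV[R]_n -> R)
    (X : set 'rV[R]_m) (Y V : set 'rV[R]_n) (mx Mx my My l S : R) xs ys xt yt :
  saddle_smooth F X V mx Mx my My l -> convex_body X -> Y `<=` V ->
  0 < mx -> 0 < my -> 0 <= l -> 0 <= Mx -> 0 < S ->
  7 * Mx ^+ 2 <= 2 * S ^+ 2 -> 2 * l ^+ 2 <= my * S ->
  X xs ->
  (forall y, Y y -> F xs y <= F xs ys - my / 2 * enorm (y - ys) ^+ 2) ->
  let q := proj X (xt - S^-1 *: grad (F^~ yt) xt) in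
  forall y, Y y -> F q y <= F xs ys + S / 2 * enorm (xt - xs) ^+ 2
                           + 5 / 4 * my * enorm (yt - ys) ^+ 2.
Proof.
move=> Fs Xb YV mx0 my0 l0 Mx0 S0 cM cl Xxs ymax q y Yy.
have h1 := proj_step xt (grad (F^~ yt) xt) Xb Xxs S0; rewrite /= -/q in h1.
have h2 := saddle_xlo Fs (YV _ Yy) q xs.
have h3 := ymax y Yy.
have h4 : dot (grad (F^~ y) q) (q - xs) <= dot (grad (F^~ yt) xt) (q - xs)
    + (Mx * enorm (q - xt) + l * (enorm (y - ys) + enorm (yt - ys))) * enorm (q - xs).
  have := dot_le (grad (F^~ y) q - grad (F^~ yt) xt) (q - xs).
  rewrite dotDl dotNl lerBlDl => /le_trans; apply; rewrite lerD2l.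
  apply: ler_wpM2r; first exact: enorm_ge0.
  apply: le_trans (enorm_triangle _ (grad (F^~ y) xt) _) _; apply: lerD.
    exact: (saddle_lip_xx Fs).
  apply: le_trans (saddle_lip_xy Fs _ _ _) _; apply: ler_wpM2l => //.
  by apply: le_trans (enorm_triangle _ ys _) _; rewrite (enormB ys).
have h5 : dot (grad (F^~ y) q) (xs - q) = - dot (grad (F^~ y) q) (q - xs).
  by rewrite -dotNr opprB.
have h6 := mulr_ge0 (ltW mx0) (sqr_ge0 (enorm (xs - q))).
move: h1 h2 h3 h4 h6; rewrite {}h5 (enormB xs xt) (enormB xs q).
move: (enorm_ge0 (xt - xs)) (enorm_ge0 (q - xs)) (enorm_ge0 (q - xt))
  (enorm_ge0 (y - ys)) (enorm_ge0 (yt - ys)).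
move: (dot _ _) (dot _ _) (enorm (xt - xs)) (enorm (q - xs)) (enorm (q - xt))
  (enorm (y - ys)) (enorm (yt - ys)) => p p' A B r u e A0 B0 r0 u0 e0 h1 h2 h3 h4 h6.
(* the term in B ^ 2 of the projection, with weight 1 / 2 = 1 / 7 + 1 / 4 +
   3 / 28, absorbs the three cross products *)
have k1 : Mx * r * B <= S / 2 * r ^+ 2 + S / 7 * B ^+ 2.
  rewrite -(ler_pM2l S0).
  by have := sqr_ge0 (S * r - Mx * B); have := ler_wpM2r (sqr_ge0 B) cM; lra.
have k2 : l * u * B <= my / 2 * u ^+ 2 + S / 4 * B ^+ 2.
  rewrite -(ler_pM2l my0).
  by have := sqr_ge0 (my * u - l * B); have := ler_wpM2r (sqr_ge0 B) cl; lra.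
have k3 : l * e * B <= 5 / 4 * my * e ^+ 2 + 3 / 28 * S * B ^+ 2.
  rewrite -(ler_pM2l S0).
  have := sqr_ge0 (3 / 14 * S * B - l * e); have := ler_wpM2r (sqr_ge0 e) cl.
  have := mulr_ge0 (mulr_ge0 (ltW S0) (ltW my0)) (sqr_ge0 e); lra.
lra.
Qed.

(** Exchanging the players turns statements on the primal gap into statements
    on the dual gap. *)
Lemma saddle_smooth_transpose (R : realType) m n (F : 'rV[R]_m -> 'rV[R]_n -> R)
    X V (mx Mx my My l : R) :
  saddle_smooth F X V mx Mx my My l ->
  saddle_smooth (fun y x => - F x y) V X my My mx Mx l.
Proof.
move=> Fs; have NN y : (fun x => - - F x y) = F^~ y.
  by apply/funext => x; rewrite opprK.
split.
- exact: saddle_ylo Fs.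
- exact: saddle_yup Fs.
- by move=> y Vy; rewrite NN; exact: saddle_xlo Fs _ Vy.
- by move=> y; rewrite NN; exact: saddle_xup Fs _.
- by move=> y x; rewrite NN (saddle_gradNx Fs) opprK.
- move=> y x; have -> : (fun z => - - F x z) = F x.
    by apply/funext => z; rewrite opprK.
  by rewrite (saddle_gradN Fs) opprK.
- move=> y y' x; rewrite !(saddle_gradN Fs) -opprD enormN.
  exact: saddle_lip_yy Fs _ _ _.
- move=> y x x'; rewrite !(saddle_gradN Fs) -opprD enormN.
  exact: saddle_lip_yx Fs _ _ _.
- move=> y y' x; rewrite !(saddle_gradNx Fs) -opprD enormN.
  exact: saddle_lip_xy Fs _ _ _.
- move=> y x x'; rewrite !(saddle_gradNx Fs) -opprD enormN.
  exact: saddle_lip_xx Fs _ _ _.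
Qed.

(** * The procedure Maximin-AG2 *)

Section MaximinAG2.
Variables (R : realType) (m n : nat) (g : 'rV[R]_m -> 'rV[R]_n -> R).
Variables (X : set 'rV[R]_m) (Y : set 'rV[R]_n) (x0 : 'rV[R]_m) (y0 : 'rV[R]_n).
Variables (l mu a delta : R).
Hypotheses (l0 : 0 < l) (mu0 : 0 < mu) (lmu : 16 * mu <= l) (delta0 : 0 < delta).
Hypothesis gs : saddle_smooth g X setT l (3 * l) (2 * mu) (l + 2 * mu) l.
Hypotheses (Xb : convex_body X) (Yb : convex_body Y) (Xx0 : X x0) (Yy0 : Y y0).
(* the contraction parameter of the outer loop, whose step length is
   1 / (9 l) and whose momentum is tuned to the modulus mu / 8 *)
Hypotheses (a0 : 0 < a) (aE : 72 * l * a ^+ 2 = mu).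
Variables (xs : 'rV[R]_m) (ys : 'rV[R]_n).
Hypotheses (Yys : Y ys) (xsE : xs = best_x g X ys).
Hypothesis ysmax : forall y, Y y -> g xs y <= g xs ys - mu * enorm (y - ys) ^+ 2.

Local Ltac slra := move: (l0) (mu0) (lmu) (a0) (aE) => *; lra.

Let E := 45 * (l / mu).
Let tau := delta / E ^+ 7.

Lemma ag2_E_ge : 45 * 16 <= E.
Proof. by rewrite /E; apply: ler_wpM2l => //; rewrite ler_pdivlMr. Qed.

Lemma ag2_E_gt0 : 0 < E.
Proof. by apply: lt_le_trans ag2_E_ge; rewrite mulr_gt0. Qed.

Lemma ag2_tau_gt0 : 0 < tau.
Proof. by rewrite divr_gt0 // exprn_gt0 // ag2_E_gt0. Qed.

Lemma ag2_condition : 10 * (3 * l / (2 * l)) * (3 * l / mu) = E.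
Proof. by rewrite /E; field; rewrite !gt_eqF. Qed.

Lemma ag2_etaE : AG2_eta (3 * l) (2 * l) = (9 * l)^-1.
Proof. by rewrite /AG2_eta; field; rewrite !gt_eqF //. Qed.

Lemma ag2_momentum : (4 * Num.sqrt (3 * l / (2 * l) * (3 * l / mu)) - 1)
    / (4 * Num.sqrt (3 * l / (2 * l) * (3 * l / mu)) + 1) = (1 - a) / (1 + a).
Proof.
have a1 : a != 0 by rewrite gt_eqF.
have -> : 3 * l / (2 * l) * (3 * l / mu) = ((4 * a)^-1) ^+ 2.
  by rewrite -aE; field; rewrite a1 gt_eqF.
rewrite sqrtr_sqr ger0_norm; last by rewrite invr_ge0 mulr_ge0 // ltW.
have a10 : 1 + a != 0 by rewrite gt_eqF // addr_gt0.
by field; rewrite a10 a1.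
Qed.

Let H y := - g (best_x g X y) y.

(** What [AGD_short] certifies, read as an inexact oracle at the dual point
    [s]. *)
Definition ag2_good (x : 'rV[R]_m) (s : 'rV[R]_n) :=
  [/\ X x, l * enorm (x - best_x g X s) ^+ 2 <= 2 * tau &
      g x s - g (best_x g X s) s <= 3 * tau].

(** One outer step is a projected gradient step for [H] with an inexact oracle;
    its length is conservative enough to leave a negative term in
    [|q - s|^2]. *)
Lemma ag2_step_bound xt s w : ag2_good xt s -> Y w ->
  let q := proj Y (s + AG2_eta (3 * l) (2 * l) *: grad (g xt) s) in
  H q <= H w + 9 * l / 2 * (enorm (w - s) ^+ 2 - enorm (w - q) ^+ 2)
     - mu * enorm (w - s) ^+ 2 - 5 / 2 * l * enorm (q - s) ^+ 2 + 4 * tau.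
Proof.
move=> [Xt h1 h2] Yw; rewrite ag2_etaE /=; set q := proj _ _.
have My0 : 0 <= l + 2 * mu by slra.
have YV : Y `<=` setT by [].
have m20 : 0 < 2 * mu by slra.
have [Xq _] := best_xP gs Xb (I : setT q).
have hc : l ^+ 2 <= l * l by rewrite expr2.
have h3 := value_lower gs Xb l0 (ltW l0) xt q hc (I : setT s) Xq.
have h4 := value_upper gs Xb l0 s (I : setT w) Xt.
have h5 := proj_step s (- grad (g xt) s) Yb Yw (mulr_gt0 (ltr0Sn R 8) l0).
rewrite /= scalerN opprK -/q in h5.
have h6 : dot (- grad (g xt) s) (q - w) =
    dot (grad (g xt) s) (w - s) - dot (grad (g xt) s) (q - s).
  by rewrite dotNl !dotDr !dotNr; slra.
have h7 : mu * enorm (q - s) ^+ 2 <= l / 2 * enorm (q - s) ^+ 2.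
  by apply: ler_wpM2r; [exact: sqr_ge0|slra].
by rewrite /H; slra.
Qed.

Lemma ag2_growth w : Y w -> mu * enorm (w - ys) ^+ 2 <= H w - H ys.
Proof.
move=> Yw; have [Xxs _] := best_xP gs Xb (I : setT ys).
have := best_x_le gs Xb l0 (I : setT w) Xxs; rewrite -xsE /H -xsE.
by have := ysmax Yw; slra.
Qed.

Lemma ag2_min w : Y w -> H ys <= H w.
Proof.
move=> Yw; have := ag2_growth Yw.
by have := mulr_ge0 (ltW mu0) (sqr_ge0 (enorm (w - ys))); slra.
Qed.

Variables (TX TY : nat).
Hypothesis hTX : l * diam X ^+ 2 * (5 / 6) ^+ TX <= tau / 21.
Hypothesis hTY : 18 * l * diam Y ^+ 2 * (1 - a / 4) ^+ TY <= 32 * tau / a.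

Lemma ag2_solve s : exists x N,
  [/\ AGD (g^~ s) X x0 (3 * l) (2 * l) tau x N, ag2_good x s & (N <= 2 * TX.+1)%N].
Proof.
have [x [N [h1 h2 h3 h4 h5]]] :=
  AGD_short l0 ag2_tau_gt0 (saddle_xlo gs (I : setT s)) (saddle_xup gs s) Xb Xx0 hTX.
by exists x, N; split.
Qed.

Lemma ag2_a_small : a <= 8^-1.
Proof.
apply: ler_abs_sq; first by rewrite invr_ge0.
by rewrite -(ler_pM2l l0) exprVn; slra.
Qed.

Lemma ag2_inv_a : a^-1 <= E.
Proof.
rewrite -[leLHS]mul1r ler_pdivrMr // -(ler_pM2l mu0).
have -> : mu * (E * a) = 45 * l * a by rewrite /E; field; rewrite gt_eqF.
rewrite -aE expr2.
have : a * a <= a * 8^-1 by rewrite ler_pM2l // ag2_a_small.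
move=> /(ler_wpM2l (ltW l0)).
have := mulr_gt0 l0 a0; slra.
Qed.

(** The residual of the stopping rule and the distance to the dual solution
    control each other, up to the inexactness of the oracle and to the squared
    condition number. *)
Lemma ag2_residual x y : ag2_good x y -> Y y ->
  let q := proj Y (y + AG2_eta (3 * l) (2 * l) *: grad (g x) y) in
  l * enorm (y - q) ^+ 2 <= 4 * (l * enorm (y - ys) ^+ 2) + 2 * tau /\
  l * enorm (y - ys) ^+ 2 <= 81 * (l / mu) ^+ 2 * (l * enorm (y - q) ^+ 2)
     + 8 * (l / mu) * tau.
Proof.
move=> gd Yy q; have Yq : Y q by have [] := projP (y + AG2_eta (3 * l) (2 * l) *: grad (g x) y) Yb.
have := ag2_step_bound gd Yys; rewrite /= -/q => h1.
have h2 := ag2_min Yq.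
move: h1; rewrite (enormB ys y) (enormB ys q) (enormB q y) => h1.
have h3 := enormD_sq (y - ys) (ys - q).
rewrite addrA subrK (enormB ys q) in h3.
have h4 := enorm_triangle y q ys.
have t0 := ag2_tau_gt0.
move: h1 h3 h4 (enorm_ge0 (y - ys)) (enorm_ge0 (q - ys)) (enorm_ge0 (y - q)).
move: (enorm (y - ys)) (enorm (q - ys)) (enorm (y - q)) => e b r h1 h3 h4 e0 b0 r0.
have me := mulr_ge0 (ltW mu0) (sqr_ge0 e).
have lr := mulr_ge0 (ltW l0) (sqr_ge0 r).
have lb : l * b ^+ 2 <= l * e ^+ 2 + tau by slra.
split; first by have := ler_wpM2l (ltW l0) h3; slra.
have h5 : mu * e ^+ 2 <= 9 * l * (r * e) + 4 * tau.
  have : e ^+ 2 - b ^+ 2 <= 2 * (r * e).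
    have [er|er] := leP e r.
      have : e * e <= r * e by apply: ler_wpM2r.
      by have := sqr_ge0 b; have := mulr_ge0 r0 e0; slra.
    have : (e - r) ^+ 2 <= b ^+ 2 by rewrite lerXn2r ?nnegrE //; slra.
    by have := sqr_ge0 r; slra.
  by move=> /(ler_wpM2l (ltW l0)); slra.
pose k := l / mu; have kmu : k * mu = l by rewrite /k mulfVK // gt_eqF.
have k0 : 0 < k by rewrite divr_gt0.
rewrite -/k -kmu.
have h6 : mu * e ^+ 2 <= 81 * k ^+ 2 * (mu * r ^+ 2) + 8 * tau.
  have := mulr_ge0 (ltW mu0) (sqr_ge0 (e - 9 * k * r)).
  move: h5; rewrite -kmu; slra.
have := ler_wpM2l (ltW k0) h6; slra.
Qed.

Lemma ag2_stopE x y : AG2_stop g Y (3 * l) (2 * l) mu delta x y <->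
  3 * (l * enorm (y - proj Y (y + AG2_eta (3 * l) (2 * l) *: grad (g x) y)) ^+ 2)
  <= E ^+ 3 * tau.
Proof.
have E0 := ag2_E_gt0; have E40 := exprn_gt0 4 E0.
rewrite /AG2_stop ag2_condition; set r := enorm _ ^+ 2.
rewrite ler_pdivlMr; last by rewrite mulr_gt0 // mulr_gt0.
have -> : r * (E ^+ 4 * (3 * l)) = E ^+ 4 * (3 * (l * r)) by ring.
have -> : delta = E ^+ 4 * (E ^+ 3 * tau).
  by rewrite /tau; field; rewrite gt_eqF.
by rewrite ler_pM2l.
Qed.

(** On stopping, [y] is close to the dual solution; the inner minimizer being
    Lipschitz, [x] is close to the primal one, and the final gradient step
    turns these distances into an objective gap.  The powers of the condition
    number in the tolerances leave room for each of these losses. *)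
Lemma ag2_output x y : ag2_good x y -> Y y ->
  AG2_stop g Y (3 * l) (2 * l) mu delta x y ->
  forall y', Y y' ->
  g (proj X (x - (2 * (3 * l / mu) * (3 * l))^-1 *: grad (g^~ y) x)) y'
  <= g xs ys + delta.
Proof.
move=> gd Yy /ag2_stopE st y' Yy'.
have [_] := ag2_residual gd Yy; move: st; set q := proj Y _ => st hres.
have [Xx gx _] := gd.
have t0 := ag2_tau_gt0; have E0 := ag2_E_gt0; have Eb := ag2_E_ge.
pose k := l / mu; have kE : 45 * k = E by [].
have kE' : k = E / 45 by rewrite -kE; field.
have kmu : k * mu = l by rewrite /k mulfVK // gt_eqF.
have k0 : 0 < k by rewrite divr_gt0.
have k16 : 16 <= k by rewrite /k ler_pdivlMr.
pose S := 2 * (3 * l / mu) * (3 * l).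
have SE : S = 18 * k * l by rewrite /S /k; field; rewrite gt_eqF.
have S0 : 0 < S by rewrite SE; apply: mulr_gt0 => //; exact: mulr_gt0.
have [Xxs _] := best_xP gs Xb (I : setT ys).
have YV : Y `<=` setT by [].
have m20 : 0 < 2 * mu by slra.
have l3 : 0 <= 3 * l by slra.
have c1 : 7 * (3 * l) ^+ 2 <= 2 * S ^+ 2.
  have lS : 18 * l <= S by rewrite SE ler_pM2r //; slra.
  have : (18 * l) ^+ 2 <= S ^+ 2.
    by rewrite lerXn2r ?nnegrE ?(ltW S0) // mulr_ge0 // ltW.
  by have := sqr_ge0 l; slra.
have c2 : 2 * l ^+ 2 <= 2 * mu * S.
  have -> : 2 * mu * S = 36 * (k * mu) * l by rewrite SE; ring.
  by rewrite kmu; have := sqr_ge0 l; slra.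
rewrite -xsE in Xxs.
have ymax y'' : Y y'' -> g xs y'' <= g xs ys - 2 * mu / 2 * enorm (y'' - ys) ^+ 2.
  by move=> /ysmax; slra.
have := projected_step_gap x y gs Xb YV l0 m20 (ltW l0) l3 S0 c1 c2 Xxs ymax Yy'.
rewrite /= => /le_trans; apply; rewrite -addrA lerD2l.
have h1 : l * enorm (x - xs) ^+ 2 <= 4 * tau + 2 * (l * enorm (y - ys) ^+ 2).
  have h2 : enorm (best_x g X y - xs) ^+ 2 <= enorm (y - ys) ^+ 2.
    rewrite lerXn2r ?nnegrE ?enorm_ge0 // xsE -(ler_pM2l l0).
    exact: (best_x_lipschitz gs Xb l0 (I : setT y) (I : setT ys)).
  have := enormD_sq (x - best_x g X y) (best_x g X y - xs).
  rewrite addrA subrK => /(ler_wpM2l (ltW l0)).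
  by have := ler_wpM2l (ltW l0) h2; slra.
have h2 : mu * enorm (y - ys) ^+ 2 <= 16^-1 * (l * enorm (y - ys) ^+ 2).
  by have := ler_wpM2r (sqr_ge0 (enorm (y - ys))) lmu; slra.
have h0 : 0 <= l * enorm (y - ys) ^+ 2 by rewrite mulr_ge0 ?sqr_ge0 // ltW.
have ->: delta = E ^+ 7 * tau by rewrite /tau mulrC mulfVK // gt_eqF // exprn_gt0.
rewrite SE; move: (enorm (x - xs)) (enorm (y - ys)) (enorm (y - q)) h1 h2 h0 hres st.
rewrite -/k => A e r h1 h2 h0 hres st.
have kt : 0 < k * tau by exact: mulr_gt0.
have Et j : 0 < E ^+ j * tau by rewrite mulr_gt0 // exprn_gt0.
have E1 j : E ^+ j * tau <= E ^+ j.+1 * tau.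
  rewrite ler_pM2r // exprS -[leLHS]mul1r ler_pM2r ?exprn_gt0 //; slra.
have h3 : l * e ^+ 2 <= E ^+ 5 * tau.
  have k2 : 0 <= 27 * k ^+ 2 by rewrite mulr_ge0 ?sqr_ge0.
  have := ler_wpM2l k2 st.
  have -> : 27 * k ^+ 2 * (E ^+ 3 * tau) = 27 / 2025 * (E ^+ 5 * tau).
    by rewrite kE'; move: (E) (tau) => u v; field.
  have : 8 * k * tau = 8 / 45 * (E ^+ 1 * tau).
    by rewrite kE'; move: (E) (tau) => u v; field.
  have := E1 1%N; have := E1 2%N; have := E1 3%N; have := E1 4%N; slra.
have h4 : 18 * k * l / 2 * A ^+ 2 <= 9 * k * (4 * tau + 2 * (E ^+ 5 * tau)).
  have -> : 18 * k * l / 2 * A ^+ 2 = 9 * k * (l * A ^+ 2) by field.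
  have k9 : 0 < 9 * k by exact: mulr_gt0.
  rewrite ler_pM2l //; apply: le_trans h1 _; rewrite lerD2l ler_pM2l //.
have h5 : 9 * k * (4 * tau + 2 * (E ^+ 5 * tau)) =
    36 / 45 * (E ^+ 1 * tau) + 18 / 45 * (E ^+ 6 * tau).
  by rewrite kE'; move: (E) (tau) => u v; field.
have h6 : 45 * (E ^+ 6 * tau) <= E ^+ 7 * tau.
  by rewrite (exprS E 6) -mulrA ler_pM2r //; slra.
have := E1 1%N; have := E1 2%N; have := E1 3%N; have := E1 4%N; have := E1 5%N.
have := Et 6%N; have := Et 1%N; slra.
Qed.

Definition ag2_state t x y yt N := [/\
  AG2_iterate g X Y x0 y0 (3 * l) (2 * l) mu delta t x y yt N, Y y,
  accelerated H ys (9 * l) a (4 * tau) (diam Y) t y yt,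
  ((0 < t)%N -> ag2_good x y) & (N <= t * (4 * TX.+1 + 2))%N].

Lemma ag2_state_next t x y yt N : ag2_state t x y yt N ->
  ((0 < t)%N -> ~ AG2_stop g Y (3 * l) (2 * l) mu delta x y) ->
  exists x' y' yt' N', ag2_state t.+1 x' y' yt' N'.
Proof.
move=> [it Yy acc _ hN] nst.
have [xt [N1 [A1 gd1 hN1]]] := ag2_solve yt.
set q := proj Y (yt + AG2_eta (3 * l) (2 * l) *: grad (g xt) yt).
have Yq : Y q by have [] := projP (yt + AG2_eta (3 * l) (2 * l) *: grad (g xt) yt) Yb.
have [x' [N2 [A2 gd2 hN2]]] := ag2_solve q.
exists x', q, (q + ((1 - a) / (1 + a)) *: (q - y)), (N + N1 + 1 + N2 + 1)%N.
split => //.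
- rewrite -ag2_momentum; apply: (AG2_next it nst (xt := xt)) => //.
    by rewrite ag2_condition.
  by rewrite ag2_condition.
- have t0 := ag2_tau_gt0; have a8 := ag2_a_small; have D0 := diam_ge0 Yb.
  have aL : a ^+ 2 * (9 * l) = mu / 8 by rewrite -aE; field.
  have sb w : Y w -> step_bound H (9 * l) a 0 (4 * tau) yt q w.
    move=> Yw; have := ag2_step_bound gd1 Yw; rewrite /= -/q /step_bound aL !mul0r.
    have := enormD_sq (w - yt) (yt - q); rewrite addrA subrK (enormB yt q).
    move=> /(ler_wpM2l (ltW mu0)).
    have := mulr_ge0 (ltW mu0) (sqr_ge0 (enorm (w - yt))).
    have := ler_wpM2r (sqr_ge0 (enorm (q - yt))) lmu.
    have := mulr_ge0 (ltW mu0) (sqr_ge0 (enorm (q - yt))).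
    slra.
  apply: (acceleratedS (c := 0) _ _ _ _ _ D0 _ _ _ _ _ acc) => //.
  + by slra.
  + by rewrite a0; slra.
  + by rewrite mulr0 mul0r.
  + by slra.
  + exact: diamP.
  + exact: diamP.
  + exact: diamP.
  + rewrite aL; have := ag2_growth Yy.
    by have := mulr_ge0 (ltW mu0) (sqr_ge0 (enorm (y - ys))); slra.
  + exact: ag2_min.
  + exact: sb.
  + exact: sb.
- have -> : (N + N1 + 1 + N2 + 1 = N + N1 + N2 + 2)%N by rewrite !addn1 addn2 addSn.
  move: (TX.+1) hN hN1 hN2 => Q hN hN1 hN2.
  have -> : (t.+1 * (4 * Q + 2) = t * (4 * Q + 2) + 2 * Q + 2 * Q + 2)%N.
    rewrite (mulSn t) [LHS]addnC [LHS]addnA.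
    by rewrite -(addnA (t * (4 * Q + 2))%N (2 * Q)%N (2 * Q)%N) -mulnDl.
  by rewrite leq_add2r; apply: leq_add => //; exact: leq_add.
Qed.

Lemma ag2_state_stop x y yt N : ag2_state TY.+1 x y yt N ->
  AG2_stop g Y (3 * l) (2 * l) mu delta x y.
Proof.
move=> [_ Yy acc gd _]; have {}gd := gd isT; apply/ag2_stopE.
have [hres _] := ag2_residual gd Yy; move: hres; set q := proj _ _ => hres.
have l9 : 0 < 9 * l by slra.
have hb := accelerated_bound l9 acc.
have t0 := ag2_tau_gt0.
have h1 : mu * enorm (y - ys) ^+ 2 <= 64 * tau / a.
  apply: le_trans (ag2_growth Yy) _; apply: le_trans hb _.
  have -> : 64 * tau / a = 32 * tau / a + 8 / a * (4 * tau).
    by field; rewrite gt_eqF.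
  by rewrite lerD2r; have -> : 2 * (9 * l) = 18 * l by ring.
pose k := l / mu; have kE : 45 * k = E by [].
have kmu : k * mu = l by rewrite /k mulfVK // gt_eqF.
have k0 : 0 < k by rewrite divr_gt0.
have E0 := ag2_E_gt0; have Eb := ag2_E_ge.
have h2 : l * enorm (y - ys) ^+ 2 <= 64 * k * tau * E.
  rewrite -kmu -mulrA; apply: (le_trans (ler_wpM2l (ltW k0) h1)).
  have -> : k * (64 * tau / a) = 64 * k * tau * a^-1 by ring.
  have kt : 0 < 64 * k * tau by apply: mulr_gt0 => //; exact: mulr_gt0.
  by rewrite ler_pM2l // ag2_inv_a.
have kE' : k = E / 45 by rewrite -kE; field.
have h3 : 64 * k * tau * E = 64 / 45 * (E ^+ 2 * tau).
  by rewrite kE'; move: (E) (tau) => u v; field.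
have h4 : 720 * (E ^+ 2 * tau) <= E ^+ 3 * tau.
  have E720 : 720 <= E by slra.
  have Et : 0 < E ^+ 2 * tau by rewrite mulr_gt0 // exprn_gt0.
  by rewrite (exprS E 2) -mulrA ler_pM2r.
have h5 : 1 * tau <= E ^+ 2 * tau.
  by rewrite ler_pM2r // -(expr1n _ 2) lerXn2r ?nnegrE ?(ltW E0) //; slra.
slra.
Qed.

(** The run stops at the latest when the potential is as small as the oracle
    error permits; an earlier stop is covered by [ag2_output] as well. *)
Lemma ag2_run : exists out N,
  [/\ Maximin_AG2 g X Y x0 y0 (3 * l) (2 * l) mu delta out N, X out,
      forall y, Y y -> g out y <= g xs ys + delta &
      (N <= TY.+1 * (4 * TX.+1 + 2) + 1)%N].
Proof.
suff [t [x [y [yt [N [t0 tT [it Yy _ gd hN] st]]]]]] : exists t x y yt N,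
    [/\ (0 < t)%N, (t <= TY.+1)%N, ag2_state t x y yt N &
        AG2_stop g Y (3 * l) (2 * l) mu delta x y].
  exists (proj X (x - (2 * (3 * l / mu) * (3 * l))^-1 *: grad (g^~ y) x)), (N + 1)%N.
  split.
  - by exists t, x, y, yt, N; split.
  - by have [] := projP (x - (2 * (3 * l / mu) * (3 * l))^-1 *: grad (g^~ y) x) Xb.
  - by move=> y' Yy'; apply: ag2_output => //; exact: gd.
  - by rewrite leq_add2r (leq_trans hN) // leq_mul2r tT orbT.
have run t : (exists t' x y yt N, [/\ (0 < t')%N, (t' <= t)%N, ag2_state t' x y yt N &
        AG2_stop g Y (3 * l) (2 * l) mu delta x y]) \/
    exists x y yt N, ag2_state t x y yt N /\
      ((0 < t)%N -> ~ AG2_stop g Y (3 * l) (2 * l) mu delta x y).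
  elim: t => [|t [[t' [x [y [yt [N [h1 h2 h3 h4]]]]]]|[x [y [yt [N [st nst]]]]]]].
  - right; exists x0, y0, y0, 0%N; split => //; split => //.
    + exact: AG2_start.
    + exact: accelerated0.
  - by left; exists t', x, y, yt, N; split => //; exact: leqW.
  - have [x' [y' [yt' [N' st']]]] := ag2_state_next st nst.
    have [hs|hs] := pselect (AG2_stop g Y (3 * l) (2 * l) mu delta x' y').
      by left; exists t.+1, x', y', yt', N'.
    by right; exists x', y', yt', N'; split.
have [//|[x [y [yt [N [st nst]]]]]] := run TY.+1.
by case: (nst isT); exact: ag2_state_stop st.
Qed.

End MaximinAG2.

(** * The procedure Minimax-APPA *)

Section MinimaxAPPA.
Variables (R : realType) (m n : nat) (F : 'rV[R]_m -> 'rV[R]_n -> R).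
Variables (X : set 'rV[R]_m) (Y : set 'rV[R]_n) (x0 : 'rV[R]_m) (y0 : 'rV[R]_n).
Variables (l mux mu eps : R).
Hypotheses (l0 : 0 < l) (mux0 : 0 < mux) (muxl : mux <= l) (mu0 : 0 < mu).
Hypotheses (lmu : 128 ^+ 2 * mu <= l) (eps0 : 0 < eps).
Hypotheses (Xb : convex_body X) (Yb : convex_body Y) (Xx0 : X x0) (Yy0 : Y y0).

Let prox (s : 'rV[R]_m) := fun u v => F u v + l * enorm (u - s) ^+ 2.

Hypothesis Fs : saddle_smooth F X Y mux l (2 * mu) (l + 2 * mu) l.
(* the proximal term restores convexity at dual points outside Y, and adds to
   the strong convexity available on Y *)
Hypothesis ps : forall s,
  saddle_smooth (prox s) X setT l (3 * l) (2 * mu) (l + 2 * mu) l.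
Hypothesis psY : forall s,
  saddle_smooth (prox s) X Y (mux + 2 * l) (3 * l) (2 * mu) (l + 2 * mu) l.

Let k1 := l / mux.
Let k2 := l / mu.
Let delta := eps / (10 * k1 * k2) ^+ 4.
Let tau := delta / (45 * k2) ^+ 7.

Variables (a1 a2 : R) (TX TY TA TF : nat).
Hypotheses (a10 : 0 < a1) (a1E : 4 * l * a1 ^+ 2 = mux).
Hypotheses (a20 : 0 < a2) (a2E : 72 * l * a2 ^+ 2 = mu).
Hypothesis hTX : l * diam X ^+ 2 * (5 / 6) ^+ TX <= tau / 21.
Hypothesis hTY : 18 * l * diam Y ^+ 2 * (1 - a2 / 4) ^+ TY <= 32 * tau / a2.
Hypothesis hTA : 4 * l * diam X ^+ 2 * (1 - a1 / 4) ^+ TA <= 8 * k1 ^+ 2 * delta.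
Hypothesis hTF : 24 * k2 ^+ 3 * (l * diam Y ^+ 2) *
  (1 - (Num.sqrt k2)^-1 / 4) ^+ TF <= eps / (10 ^+ 2 * k1 * k2).

Local Ltac slra := move: (l0) (mux0) (muxl) (mu0) (eps0) (a10) (a1E) => *; lra.

Lemma appa_k1_ge1 : 1 <= k1.
Proof. by rewrite /k1 ler_pdivlMr // mul1r. Qed.

Lemma appa_lmu16 : 16 * mu <= l.
Proof.
apply: le_trans lmu; rewrite ler_pM2r // expr2.
have h : 128 * 1 <= 128 * 128 :> R by rewrite ler_pM2l; lra.
by apply: le_trans h; lra.
Qed.

Lemma appa_k2_big : 128 ^+ 2 <= k2.
Proof. by rewrite /k2 ler_pdivlMr. Qed.

Lemma appa_k1_gt0 : 0 < k1. Proof. by rewrite divr_gt0. Qed.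
Lemma appa_k2_gt0 : 0 < k2. Proof. by rewrite divr_gt0. Qed.

Lemma appa_delta_gt0 : 0 < delta.
Proof.
rewrite divr_gt0 // exprn_gt0 // mulr_gt0 ?appa_k2_gt0 //.
by rewrite mulr_gt0 // appa_k1_gt0.
Qed.

Lemma appa_k1mux : k1 * mux = l.
Proof. by rewrite /k1 mulfVK // gt_eqF. Qed.

Lemma appa_k2mu : k2 * mu = l.
Proof. by rewrite /k2 mulfVK // gt_eqF. Qed.

Lemma appa_a1_half : a1 <= 2^-1.
Proof.
apply: ler_abs_sq; first by rewrite invr_ge0.
by rewrite -(ler_pM2l l0) exprVn; slra.
Qed.

Lemma appa_momentum :
  (2 * Num.sqrt k1 - 1) / (2 * Num.sqrt k1 + 1) = (1 - a1) / (1 + a1).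
Proof.
have a1n : a1 != 0 by rewrite gt_eqF.
have -> : k1 = ((2 * a1)^-1) ^+ 2.
  by rewrite /k1 -a1E; field; rewrite a1n gt_eqF.
rewrite sqrtr_sqr ger0_norm; last by rewrite invr_ge0 mulr_ge0 // ltW.
have a1p : 1 + a1 != 0 by rewrite gt_eqF // addr_gt0.
by field; rewrite a1n a1p.
Qed.

Let Phi x := F x (best_y F Y x).

Lemma prox_solve s : exists out N xs ys,
  [/\ Maximin_AG2 (prox s) X Y x0 y0 (3 * l) (2 * l) mu delta out N, X out,
      (forall y, Y y -> prox s out y <= prox s xs ys + delta),
      (N <= TY.+1 * (4 * TX.+1 + 2) + 1)%N &
      [/\ X xs, Y ys & forall w, X w ->
        prox s xs ys + (mux + 2 * l) / 2 * enorm (w - xs) ^+ 2 <= prox s w ys]].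
Proof.
have YV : Y `<=` setT by [].
have m20 : 0 < 2 * mu by rewrite mulr_gt0.
have ml0 : 0 <= l + 2 * mu by rewrite addr_ge0 // ltW.
have [xs [ys [Xxs Yys xmin ymax xsE]]] := saddle_exists (ps s) Xb Yb YV l0 m20 (ltW l0) ml0.
have ymax' y : Y y -> prox s xs y <= prox s xs ys - mu * enorm (y - ys) ^+ 2.
  by move=> /ymax; lra.
have [out [N [h1 h2 h3 h4]]] := ag2_run l0 mu0 appa_lmu16 appa_delta_gt0 (ps s)
  Xb Yb Xx0 Yy0 a20 a2E Yys xsE ymax' hTX hTY.
exists out, N, xs, ys; split => //; split => // w Xw.
apply: (minimizer_growth (saddle_xlo (psY s) Yys) (saddle_xup (psY s) ys) Xb Xxs Xw).
move=> q Xq; have := xmin q Xq.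
by have := mulr_ge0 (ltW l0) (sqr_ge0 (enorm (q - xs))); lra.
Qed.

(** An inexact proximal step.  The exact solution of the subproblem enjoys
    growth with modulus [mux + 2 * l]; half of [mux] is given up to move the
    center of this growth to the computed point, which costs a factor
    proportional to [k1] on the objective gap [delta]. *)
Lemma prox_step_bound s q xs ys w : X q -> X w ->
  (forall y, Y y -> prox s q y <= prox s xs ys + delta) ->
  X xs -> Y ys ->
  (forall w, X w -> prox s xs ys + (mux + 2 * l) / 2 * enorm (w - xs) ^+ 2
                    <= prox s w ys) ->
  step_bound Phi (2 * l) a1 0 (7 * k1 * delta) s q w.
Proof.
move=> Xq Xw hq Xxs Yys hmin.
have m20 : 0 < 2 * mu by rewrite mulr_gt0.
have [Yq _] := best_yP Fs Yb Xq.
have h1 := hq _ Yq; have h2 := hmin w Xw.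
have h3 := le_trans (hmin q Xq) (hq _ Yys).
have h4 := best_y_ge Fs Yb m20 Xw Yys.
have aL : a1 ^+ 2 * (2 * l) = mux / 2 by rewrite -a1E; field.
rewrite /step_bound aL !mul0r addr0 -/(Phi q).
have k0 := appa_k1_gt0; have k11 := appa_k1_ge1; have km := appa_k1mux.
have d0 := appa_delta_gt0.
have c0 : 0 < (5 * k1)^-1 by rewrite invr_gt0 mulr_gt0.
have := @enormB_sq R m (5 * k1)^-1 (w - xs) (xs - q) c0.
rewrite invrK addrA subrK (enormB xs q).
have := sqr_ge0 (enorm (w - q)); have := sqr_ge0 (enorm (w - xs)).
have := sqr_ge0 (enorm (q - xs)); have := sqr_ge0 (enorm (q - s)).
have cE : (5 * k1)^-1 * k1 = 5^-1 by field; rewrite gt_eqF.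
move: h1 h2 h3 h4; rewrite /prox -/(Phi q) -/(Phi w).
move: (enorm (w - q) ^+ 2) (enorm (w - xs) ^+ 2) (enorm (q - xs) ^+ 2)
  (enorm (q - s) ^+ 2) (enorm (w - s) ^+ 2) (enorm (xs - s) ^+ 2) (5 * k1)^-1 c0 cE.
move=> wq wx qx qs ws xss c c0 cE h1 h2 h3 h4 qs0 qx0 wx0 wq0 h5.
have {}h3 : (l + mux / 2) * qx <= delta by lra.
have lm0 : 0 <= l + mux / 4 by slra.
have h6 := ler_wpM2l lm0 h5.
have c1 : c <= 5^-1 by rewrite -cE ler_peMr // ltW.
have h7 : (l + mux / 4) * ((1 + c) * wx) <= (l + mux / 2) * wx.
  rewrite mulrA; apply: ler_wpM2r => //.
  have -> : (l + mux / 4) * (1 + c) = l + mux / 4 + (c * k1) * mux + c * mux / 4.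
    by rewrite -km; field.
  rewrite cE.
  have : c * mux <= 5^-1 * mux by rewrite ler_pM2r.
  by slra.
have h8 : (l + mux / 4) * ((1 + 5 * k1) * qx) <= 6 * k1 * delta.
  have h9 : (l + mux / 4) * qx <= delta.
    by apply: le_trans h3; apply: ler_wpM2r => //; slra.
  have h10 : 0 <= 1 + 5 * k1 by lra.
  have := ler_wpM2l h10 h9.
  have : (1 + 5 * k1) * delta <= 6 * k1 * delta by rewrite ler_pM2r //; lra.
  lra.
have h11 : 1 * delta <= k1 * delta by rewrite ler_pM2r.
have h12 := mulr_ge0 (ltW l0) qs0.
lra.
Qed.

Variables (xs : 'rV[R]_m) (ys : 'rV[R]_n).
Hypotheses (Xxs : X xs) (Yys : Y ys).
Hypothesis xsmin : forall x, X x -> F xs ys + mux / 2 * enorm (x - xs) ^+ 2 <= F x ys.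
Hypothesis ysmax : forall y, Y y -> F xs y <= F xs ys - 2 * mu / 2 * enorm (y - ys) ^+ 2.

Lemma appa_Phi_xs : Phi xs <= F xs ys.
Proof.
have [Yq _] := best_yP Fs Yb Xxs; have := ysmax Yq.
have := mulr_ge0 (ltW mu0) (sqr_ge0 (enorm (best_y F Y xs - ys))).
by rewrite /Phi; lra.
Qed.

Lemma appa_growth w : X w -> mux / 2 * enorm (w - xs) ^+ 2 <= Phi w - Phi xs.
Proof.
move=> Xw; have m20 : 0 < 2 * mu by rewrite mulr_gt0.
have := best_y_ge Fs Yb m20 Xw Yys; rewrite -/(Phi w).
by have := xsmin Xw; have := appa_Phi_xs; lra.
Qed.

Let M := (TY.+1 * (4 * TX.+1 + 2) + 1)%N.

Lemma appa_iterates t : exists x xt N,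
  [/\ APPA_iterate F X Y x0 y0 l mux mu eps t x xt N, X x,
      accelerated Phi xs (2 * l) a1 (7 * k1 * delta) (diam X) t x xt &
      (N <= t * M)%N].
Proof.
elim: t => [|t [x [xt [N [it Xx acc hN]]]]].
  by exists x0, x0, 0%N; split => //; [exact: APPA_start|exact: accelerated0].
have [q [Nq [ps' [pt' [h1 Xq h2 hNq [Xp Yp hp]]]]]] := prox_solve xt.
exists q, (q + ((1 - a1) / (1 + a1)) *: (q - x)), (N + Nq)%N; split => //.
- by rewrite -appa_momentum; exact: APPA_next it h1.
- have l20 : 0 < 2 * l by rewrite mulr_gt0.
  have z0 : 0 <= 7 * k1 * delta.
    by rewrite mulr_ge0 ?(ltW appa_delta_gt0) // mulr_ge0 // ltW // appa_k1_gt0.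
  have sb w : X w -> step_bound Phi (2 * l) a1 0 (7 * k1 * delta) xt q w.
    by move=> Xw; exact: prox_step_bound h2 Xp Yp hp.
  have aL : a1 ^+ 2 * (2 * l) / 2 = mux / 4 by rewrite -a1E; field.
  apply: (acceleratedS (c := 0) l20 _ _ _ z0 (diam_ge0 Xb) _ _ _ _ _ acc) => //.
  + by rewrite a10 appa_a1_half.
  + by rewrite mulr0 mul0r.
  + exact: diamP.
  + exact: diamP.
  + exact: diamP.
  + rewrite aL; have := appa_growth Xx.
    by have := mulr_ge0 (ltW mux0) (sqr_ge0 (enorm (x - xs))); lra.
  + have := appa_growth Xq.
    by have := mulr_ge0 (ltW mux0) (sqr_ge0 (enorm (q - xs))); lra.
  + exact: sb.
  + exact: sb.
- by rewrite mulSn addnC; apply: leq_add.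
Qed.

Lemma appa_inv_a1 : a1^-1 <= 2 * k1.
Proof.
rewrite -[leLHS]mul1r ler_pdivrMr // -(ler_pM2l mux0).
have -> : mux * (2 * k1 * a1) = 2 * (k1 * mux) * a1 by ring.
rewrite appa_k1mux.
have := ler_wpM2l (ltW (mulr_gt0 l0 a10)) appa_a1_half.
by slra.
Qed.

Lemma appa_delta_small : 120 * k1 ^+ 2 * delta <= eps / (80 * k1 ^+ 2 * k2 ^+ 4).
Proof.
have k10 := appa_k1_gt0; have k20 := appa_k2_gt0.
have -> : 120 * k1 ^+ 2 * delta = 24 / 25 * (eps / (80 * k1 ^+ 2 * k2 ^+ 4)).
  by rewrite /delta; move: (k1) (k2) k10 k20 => u v u0 v0; field; rewrite !gt_eqF.
rewrite ger_pMl; first by lra.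
apply: divr_gt0 => //; apply: mulr_gt0; last exact: exprn_gt0.
by apply: mulr_gt0 => //; exact: exprn_gt0.
Qed.

(** The primal gap is the value of the potential.  For the dual gap, strong
    convexity turns the primal gap into a distance, the best response is
    Lipschitz, and a last projected step in [y] turns the distances back into
    an objective gap. *)
Lemma minimax_run : exists xh yh N,
  [/\ Minimax_APPA F X Y x0 y0 l mux mu eps TA.+1 xh yh N,
      X xh, Y yh, forall x y, X x -> Y y -> F xh y - F x yh <= eps &
      (N <= TA.+1 * M + 2 * TF.+1 + 1)%N].
Proof.
have k10 := appa_k1_gt0; have k20 := appa_k2_gt0; have k11 := appa_k1_ge1.
have km1 := appa_k1mux; have km2 := appa_k2mu.
have m20 : 0 < 2 * mu by rewrite mulr_gt0.
have k2big : 128 <= k2.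
  apply: le_trans appa_k2_big; rewrite expr2.
  have h : 128 * 1 <= 128 * 128 :> R by rewrite ler_pM2l; lra.
  by apply: le_trans h; lra.
have [xh [xt [N1 [it Xxh acc hN1]]]] := appa_iterates TA.+1.
have gap : Phi xh - Phi xs <= eps / (80 * k1 ^+ 2 * k2 ^+ 4).
  have l20 : 0 < 2 * l by rewrite mulr_gt0.
  apply: le_trans (accelerated_bound l20 acc) _; apply: le_trans appa_delta_small.
  have -> : 120 * k1 ^+ 2 * delta = 8 * k1 ^+ 2 * delta + 112 * k1 ^+ 2 * delta by ring.
  have -> : 2 * (2 * l) = 4 * l by ring.
  apply: lerD; first exact: hTA.
  have kd : 0 <= 56 * k1 * delta.
    by rewrite mulr_ge0 ?(ltW appa_delta_gt0) // mulr_ge0 // ltW.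
  have := ler_wpM2l kd appa_inv_a1; move: (delta) (a1^-1) (k1) => *; lra.
(* e is the unit in which the distances to the saddle point are measured *)
pose e := eps / (k1 * k2); have e0 : 0 < e by rewrite divr_gt0 // mulr_gt0.
have ke : k1 * k2 * e = eps by rewrite /e; field; rewrite !gt_eqF.
have gapE : eps / (80 * k1 ^+ 2 * k2 ^+ 4) * (80 * k1 * k2 ^+ 3) = e.
  rewrite /e; move: (k1) (k2) k10 k20 => u v u0 v0; field; by rewrite !gt_eqF.
have hx : k1 * k2 ^+ 3 * (Phi xh - Phi xs) <= e / 80.
  have c0 : 0 < 80 * k1 * k2 ^+ 3.
    by apply: mulr_gt0; [exact: mulr_gt0|exact: exprn_gt0].
  have := ler_wpM2r (ltW c0) gap; rewrite gapE.
  move: (k1) (k2) (Phi xh - Phi xs) (e) => *; lra.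
have hd : k2 ^+ 3 * (l * enorm (xh - xs) ^+ 2) <= e / 40.
  have := appa_growth Xxh.
  have c0 : 0 < 2 * k1 * k2 ^+ 3.
    by apply: mulr_gt0; [exact: mulr_gt0|exact: exprn_gt0].
  move/(ler_wpM2l (ltW c0)) => h.
  have -> : k2 ^+ 3 * (l * enorm (xh - xs) ^+ 2) =
      2 * k1 * k2 ^+ 3 * (mux / 2 * enorm (xh - xs) ^+ 2).
    by rewrite -km1; field.
  apply: le_trans h _; move: hx.
  move: (k1) (k2) (Phi xh - Phi xs) (e) => *; lra.
have hlo := saddle_ylo Fs Xxh; have hup := saddle_yup Fs xh.
have eps' : 0 < eps / (10 ^+ 2 * k1 * k2).
  apply: divr_gt0 => //; apply: mulr_gt0 => //; exact: mulr_gt0.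
have [yt [N2 [A1 Yyt hyt hN2]]] := AGD_long l0 mu0 lmu eps' hlo hup Yb Yy0 hTF.
rewrite -/(best_y F Y xh) in hyt.
pose yh := proj Y (yt + (2 * k1 * l)^-1 *: grad (F xh) yt).
have Yyh : Y yh by have [] := projP (yt + (2 * k1 * l)^-1 *: grad (F xh) yt) Yb.
have bys : best_y F Y xs = ys.
  apply/eqP; rewrite -subr_eq0; apply/eqP/enorm_le0.
  have [Yq _] := best_yP Fs Yb Xxs.
  have := ysmax Yq; have := best_y_ge Fs Yb m20 Xxs Yys => h h'.
  have : mu * enorm (best_y F Y xs - ys) ^+ 2 <= mu * 0 ^+ 2 by lra.
  by rewrite ler_pM2l // => /ler_abs_sq; apply.
have hlip : l * enorm (best_y F Y xh - ys) ^+ 2 <= k2 ^+ 2 / 4 * (l * enorm (xh - xs) ^+ 2).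
  have := best_y_lipschitz Fs Yb m20 Xxh Xxs; rewrite bys => h.
  have {}h : enorm (best_y F Y xh - ys) <= k2 / 2 * enorm (xh - xs).
    rewrite -(ler_pM2l m20); have -> : 2 * mu * (k2 / 2 * enorm (xh - xs)) =
      (k2 * mu) * enorm (xh - xs) by field.
    by rewrite km2.
  have -> : k2 ^+ 2 / 4 * (l * enorm (xh - xs) ^+ 2) = l * (k2 / 2 * enorm (xh - xs)) ^+ 2.
    by field.
  rewrite ler_pM2l // lerXn2r ?nnegrE ?enorm_ge0 //.
  by rewrite mulr_ge0 ?enorm_ge0 // divr_ge0 // ltW.
have eE : 4 * (eps / (10 ^+ 2 * k1 * k2)) = e / 25.
  by rewrite /e; move: (k1) (k2) k10 k20 => u v u0 v0; field; rewrite !gt_eqF.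
have hy : l * enorm (yt - ys) ^+ 2 <= e / 10.
  have := enormD_sq (yt - best_y F Y xh) (best_y F Y xh - ys).
  rewrite addrA subrK => /(ler_wpM2l (ltW l0)).
  have h1 : k2 ^+ 2 * (l * enorm (xh - xs) ^+ 2) <= e / 40.
    apply: le_trans hd; rewrite (exprS k2 2) -mulrA ler_peMl //; last by lra.
    by rewrite mulr_ge0 ?sqr_ge0 // mulr_ge0 ?sqr_ge0 // ltW.
  rewrite eE in hyt; move: hyt hlip h1 e0.
  move: (enorm _) (enorm _) (enorm _) (enorm _) => u1 u2 u3 u4.
  lra.
have hx1 : l * enorm (xh - xs) ^+ 2 <= e / 40.
  apply: le_trans hd; rewrite ler_peMl //; last first.
    by rewrite -(expr1n _ 3) lerXn2r ?nnegrE ?(ltW k20) //; lra.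
  by rewrite mulr_ge0 ?sqr_ge0 // ltW.
have ee : 128 * e <= eps.
  rewrite -ke; apply: ler_wpM2r; first exact: ltW.
  by apply: (le_trans k2big); rewrite ler_peMl // ltW.
have dual x : X x -> F xs ys - eps / 5 <= F x yh.
  move=> Xx; pose S := 2 * k1 * l.
  have S0 : 0 < S by apply: mulr_gt0 => //; exact: mulr_gt0.
  have XX : X `<=` X by [].
  have ml0 : 0 <= l + 2 * mu by rewrite addr_ge0 // ltW.
  have c1 : 7 * (l + 2 * mu) ^+ 2 <= 2 * S ^+ 2.
    have lS : 2 * l <= S.
      by rewrite /S ler_pM2r // ler_peMr.
    have h1 : (2 * l) ^+ 2 <= S ^+ 2.
      by rewrite lerXn2r ?nnegrE ?(ltW S0) // mulr_ge0 // ltW.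
    have h2 : l + 2 * mu <= 65 / 64 * l.
      have : 128 * mu <= l by rewrite -km2; apply: ler_wpM2r => //; exact: ltW.
      by slra.
    have h3 : (l + 2 * mu) ^+ 2 <= (65 / 64 * l) ^+ 2.
      by rewrite lerXn2r ?nnegrE // mulr_ge0 // ?(ltW l0) // divr_ge0.
    have := sqr_ge0 l; lra.
  have c2 : 2 * l ^+ 2 <= mux * S by rewrite /S -km1; lra.
  have xmax x' : X x' -> - F x' ys <= - F xs ys - mux / 2 * enorm (x' - xs) ^+ 2.
    by move=> /xsmin; lra.
  have := projected_step_gap yt xh (saddle_smooth_transpose Fs) Yb XX m20 mux0
    (ltW l0) ml0 S0 c1 c2 Yys xmax Xx.
  rewrite /= (saddle_gradN Fs) scalerN opprK -/S -/yh.
  have -> : S / 2 * enorm (yt - ys) ^+ 2 = k1 * (l * enorm (yt - ys) ^+ 2).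
    by rewrite /S; field.
  have h4 : k1 * (l * enorm (yt - ys) ^+ 2) <= eps / 10.
    have h41 : k1 * (l * enorm (yt - ys) ^+ 2) <= k1 * (e / 10) by rewrite ler_pM2l.
    apply: (le_trans h41); rewrite -ke.
    have k21 : 1 <= k2 by lra.
    have : k1 * e * 1 <= k1 * e * k2 by rewrite ler_pM2l // mulr_gt0.
    have := mulr_gt0 k10 e0; move: (k1) (k2) => u v; lra.
  have h5 : mux * enorm (xh - xs) ^+ 2 <= e / 40.
    by apply: le_trans hx1; apply: ler_wpM2r => //; exact: sqr_ge0.
  move: h4 h5 e0 ee.
  move: (enorm (xh - xs) ^+ 2) (k1 * (l * enorm (yt - ys) ^+ 2)) => *; slra.
have primal y : Y y -> F xh y <= F xs ys + eps / 10.
  move=> Yy; have := best_y_ge Fs Yb m20 Xxh Yy; rewrite -/(Phi xh).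
  have h1 : Phi xh - Phi xs <= e / 80.
    apply: le_trans hx; rewrite ler_peMl //.
      by have := appa_growth Xxh; have := mulr_ge0 (ltW mux0) (sqr_ge0 (enorm (xh - xs))); lra.
    rewrite -[leLHS]mulr1; apply: ler_pM => //.
    by rewrite -(expr1n _ 3) lerXn2r ?nnegrE ?(ltW k20) //; lra.
  by have := appa_Phi_xs; move: ee e0; slra.
exists xh, yh, (N1 + N2 + 1)%N; split => //.
- by exists xt, yt, N1, N2; split.
- by move=> x y Xx Yy; have := dual x Xx; have := primal y Yy; slra.
- by rewrite leq_add2r leq_add.
Qed.

End MinimaxAPPA.

(** * Iteration counts and the complexity bound *)

(** From [expR (- 1 / 2) >= 1 / 2]. *)
Lemma ln_ge1 (R : realType) (x : R) : 4 <= x -> 1 <= ln x.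
Proof.
move=> x4; have x0 : 0 < x by lra.
rewrite -ler_expR lnK ?posrE //; apply: le_trans x4.
have h := expR_ge1Dx (- (2^-1 : R)); rewrite expRN in h.
have e0 := expR_gt0 (2^-1 : R).
have h2 : expR (2^-1 : R) <= 2.
  rewrite -(ler_pM2l e0) in h; rewrite mulfV ?gt_eqF // in h; lra.
have -> : 1 = 2^-1 + 2^-1 :> R by lra.
by rewrite expRD; have := ler_pM (ltW e0) (ltW e0) h2 h2; lra.
Qed.

(** Contracting by [1 - a <= expR (- a)] gains a factor [x ^ p] in
    [p * ln x / a] iterations; the constant [2] absorbs the rounding and the
    successor. *)
Lemma iteration_count (R : realType) (a A B x : R) (p : nat) :
  0 < a <= 1 -> 4 <= x -> 0 <= A -> A <= B * x ^+ p ->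
  exists T : nat, A * (1 - a) ^+ T <= B /\ T.+1%:R <= (p%:R + 2) / a * ln x.
Proof.
move=> /andP[a0 a1] x4 A0 AB.
have x0 : 0 < x by lra.
have L1 := ln_ge1 x4.
have y0 : 0 <= p%:R * ln x / a.
  by apply: divr_ge0; [apply: mulr_ge0 => //|exact: ltW]; lra.
have /andP[T1 T2] := truncn_itv y0; set T := (Num.Def.truncn _).+1 in T2.
exists T; split; last first.
  have -> : (p%:R + 2) / a * ln x = p%:R * ln x / a + 2 * (ln x / a).
    by field; rewrite gt_eqF.
  have h : 1 <= ln x / a by rewrite ler_pdivlMr // mul1r; lra.
  by rewrite /T -natr1 -natr1; lra.
have a1' : 0 <= 1 - a by lra.
have h1 : (1 - a) ^+ T <= expR (- a) ^+ T.
  by rewrite lerXn2r ?nnegrE ?expR_ge0 //; exact: expR_ge1Dx.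
have h2 : expR (- a) ^+ T * x ^+ p <= 1.
  have -> : x ^+ p = expR (p%:R * ln x) by rewrite expRM_natl lnK ?posrE.
  rewrite -expRM_natl -expRD -[leRHS]expR0 ler_expR.
  have T2' : p%:R * ln x <= T%:R * a by rewrite -ler_pdivrMr // ltW.
  by rewrite mulrN addrC subr_le0.
have e0 : 0 <= expR (- a) ^+ T by rewrite exprn_ge0 // expR_ge0.
apply: le_trans (_ : A * expR (- a) ^+ T <= _); first exact: ler_wpM2l.
have B0 : 0 <= B.
  have xp : 0 < x ^+ p by rewrite exprn_gt0.
  by rewrite -(pmulr_lge0 _ xp); apply: le_trans A0 AB.
apply: (le_trans (ler_wpM2r e0 AB)).
by rewrite -mulrA (mulrC (x ^+ p)) -[leRHS]mulr1; exact: ler_wpM2l.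
Qed.

(** The tolerance [tau] of the innermost solver is the smallest accuracy of the
    whole run, and it is polynomial in the argument [x] of the logarithm; so
    one power of [x] serves all four loops. *)
Lemma tolerance_polynomial (R : realType) (k1 k2 eps p q x tau : R) :
  1 <= k1 -> 0 < eps -> 0 <= p -> 200 <= q -> k2 = 4 * q -> x = k1 * (p + q) ->
  tau = eps / 2 / (10 * k1 * k2) ^+ 4 / (45 * k2) ^+ 7 ->
  [/\ 200 <= x, 18 * (p * eps) <= tau / 21 * x ^+ 31,
      18 * (q * eps) <= tau / 21 * x ^+ 31 &
      24 * k2 ^+ 3 * (q * eps) <= tau / 21 * x ^+ 31].
Proof.
move=> k11 eps0 p0 q200 k2E xE tauE.
have px : p <= x.
  have : 1 * (p + q) <= k1 * (p + q) by apply: ler_wpM2r => //; lra.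
  by rewrite xE; lra.
have qx : q <= x.
  have : 1 * (p + q) <= k1 * (p + q) by apply: ler_wpM2r => //; lra.
  by rewrite xE; lra.
have kq : k1 * q <= x by rewrite xE; apply: ler_wpM2l; lra.
have x200 : 200 <= x by lra.
have x0 : 0 < x by lra.
have xx : 200 * x <= x ^+ 2 by rewrite expr2; apply: ler_wpM2r => //; exact: ltW.
have pos u v : 0 <= u -> u <= v -> forall j, u ^+ j <= v ^+ j.
  by move=> u0 uv j; rewrite lerXn2r // nnegrE //; apply: le_trans uv.
have c1 : (10 * k1 * k2) ^+ 4 <= x ^+ 8.
  have -> : x ^+ 8 = (x ^+ 2) ^+ 4 by rewrite -exprM.
  have kq0 : 0 <= k1 * q by apply: mulr_ge0; lra.
  by apply: pos; rewrite k2E; lra.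
have c2 : (45 * k2) ^+ 7 <= x ^+ 14.
  have -> : x ^+ 14 = (x ^+ 2) ^+ 7 by rewrite -exprM.
  by apply: pos; rewrite k2E; lra.
have k20 : 0 < k2 by lra.
have d1 : 0 < (10 * k1 * k2) ^+ 4.
  by apply: exprn_gt0; apply: mulr_gt0 => //; lra.
have d2 : 0 < (45 * k2) ^+ 7 by apply: exprn_gt0; lra.
have hB : eps <= tau / 21 * x ^+ 23.
  have h : (10 * k1 * k2) ^+ 4 * (45 * k2) ^+ 7 <= x ^+ 22.
    by rewrite -[22%N]/(8 + 14)%N exprD; apply: ler_pM => //; exact: ltW.
  have -> : tau / 21 * x ^+ 23 = eps * (x ^+ 23 / 42 /
      ((10 * k1 * k2) ^+ 4 * (45 * k2) ^+ 7)).
    rewrite tauE; move: (_ ^+ 4) (_ ^+ 7) d1 d2 => u v u0 v0.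
    by field; rewrite !gt_eqF.
  rewrite -[leLHS]mulr1; apply: ler_wpM2l; first exact: ltW.
  rewrite ler_pdivlMr; last exact: mulr_gt0.
  rewrite mul1r; apply: (le_trans h).
  rewrite (exprS x 22) mulrAC ler_peMl //; first by rewrite exprn_ge0 // ltW.
  by rewrite ler_pdivlMr; lra.
have t0 : 0 <= tau / 21.
  by rewrite tauE !divr_ge0 // ltW.
have x1 : 1 <= x by lra.
have fin A : A <= x ^+ 8 -> A * eps <= tau / 21 * x ^+ 31.
  move=> hA; rewrite -[31%N]/(8 + 23)%N exprD.
  have x8 : 0 <= x ^+ 8 by rewrite exprn_ge0 // ltW.
  have := ler_wpM2l x8 hB; have := ler_wpM2r (ltW eps0) hA.
  move: (x ^+ 8) (x ^+ 23) => u v; lra.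
have x28 : x ^+ 2 <= x ^+ 8 by rewrite ler_weXn2l.
split => //.
- by rewrite mulrA; apply: fin; lra.
- by rewrite mulrA; apply: fin; lra.
- rewrite mulrA; apply: fin; rewrite -[8%N]/((1 + 6) + 1)%N !exprD expr1.
  have -> : x ^+ 6 = (x ^+ 2) ^+ 3 by rewrite -exprM.
  have x60 : 0 <= (x ^+ 2) ^+ 3 by rewrite !exprn_ge0 // ltW.
  apply: ler_pM => //; [by apply: mulr_ge0 => //; rewrite exprn_ge0 // ltW|lra|].
  apply: ler_pM => //; [by rewrite exprn_ge0 // ltW|lra|].
  by apply: pos; lra.
Qed.

Lemma tolerance_order (R : realType) (k1 k2 eps delta tau : R) :
  1 <= k1 -> 1 <= k2 -> 0 < eps -> delta = eps / 2 / (10 * k1 * k2) ^+ 4 ->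
  tau = delta / (45 * k2) ^+ 7 ->
  [/\ 0 < tau, tau <= delta & tau / 21 <= eps / 2 / (10 ^+ 2 * k1 * k2)].
Proof.
move=> k11 k21 eps0 dE tE.
have k10 : 0 < k1 by lra.
have k20 : 0 < k2 by lra.
have e20 : 0 < eps / 2 by exact: divr_gt0.
have k12 : 1 <= k1 * k2 by rewrite -[leLHS]mulr1; apply: ler_pM.
have c4 : 0 < (10 * k1 * k2) ^+ 4.
  by apply: exprn_gt0; apply: mulr_gt0 => //; exact: mulr_gt0.
have delta0 : 0 < delta by rewrite dE; exact: divr_gt0.
have c7 : 0 < (45 * k2) ^+ 7 by apply: exprn_gt0; exact: mulr_gt0.
have tau0 : 0 < tau by rewrite tE; exact: divr_gt0.
have k45 : 1 <= 45 * k2 by lra.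
have taud : tau <= delta.
  by rewrite tE ler_pdivrMr // ler_peMr ?(ltW delta0) // exprn_ege1.
split => //; apply: le_trans (_ : delta <= _).
  by clear -tau0 taud; lra.
have c0 : 0 < 10 ^+ 2 * k1 * k2.
  by apply: mulr_gt0 => //; apply: mulr_gt0 => //; exact: exprn_gt0.
rewrite dE ler_pM2l // lef_pV2 ?posrE //.
have -> : (10 * k1 * k2) ^+ 4 = 10 ^+ 2 * k1 * k2 * (10 ^+ 2 * (k1 * k2) ^+ 3) by ring.
rewrite ler_peMr ?(ltW c0) //.
by have := exprn_ege1 3 k12; clear; move: ((k1 * k2) ^+ 3) => u hu; lra.
Qed.

(** The three nested loops contribute one logarithm each; the final solver is
    of lower order. *)
Lemma total_count (R : realType) (TX TY TA TF N : nat) (P s1 s2 L : R) :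
  0 <= P -> 1 <= s1 -> 0 <= s2 -> 1 <= L ->
  (N <= TA.+1 * (TY.+1 * (4 * TX.+1 + 2) + 1) + 2 * TF.+1 + 1)%N ->
  TX.+1%:R <= 6 * P * L -> TY.+1%:R <= 36 * P * s2 * L ->
  TA.+1%:R <= 8 * P * s1 * L -> TF.+1%:R <= 4 * P * s2 * L ->
  N%:R <= (7 * 8 * 36 * 6 * P ^+ 3 + 12 * P) * (s1 * s2 * L ^+ 3).
Proof.
move=> P0 s11 s20 L1 hN hX hY hA hF.
have {}hN : (N <= 7 * (TA.+1 * (TY.+1 * TX.+1)) + 3 * TF.+1)%N.
  apply: leq_trans hN _; rewrite -addnA; apply: leq_add; last first.
    by rewrite [X in (_ <= X)%N]mulSn addnC leq_add2r.
  rewrite mulnCA leq_pmul2l // [X in (_ <= X)%N]mulSn addnC; apply: leq_add.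
    by rewrite muln_gt0.
  rewrite mulnCA leq_pmul2l // -[6%N]/(4 + 2)%N mulnDl leq_add2l.
  by rewrite -[X in (X <= _)%N]muln1 leq_pmul2l.
have {hN} : N%:R <= 7 * (TA.+1%:R * (TY.+1%:R * TX.+1%:R)) + 3 * TF.+1%:R :> R.
  by move: hN; rewrite -(ler_nat R) natrD !natrM.
move/le_trans; apply.
have PL : 0 <= P * L by apply: mulr_ge0 => //; lra.
have h1 : TA.+1%:R * (TY.+1%:R * TX.+1%:R)
   <= 8 * P * s1 * L * (36 * P * s2 * L * (6 * P * L)) :> R.
  apply: ler_pM; [exact: ler0n|by rewrite -natrM ler0n|exact: hA|].
  by apply: ler_pM.
have s10 : 0 <= s1 by lra.
have L3 : L <= L ^+ 3.
  have L2 : 1 <= L ^+ 2 by rewrite expr_ge1 //; lra.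
  by rewrite exprSr ler_peMl //; lra.
have h2 : P * s2 * L <= P * (s1 * s2 * L ^+ 3).
  have c0 : 0 <= P * s2 by exact: mulr_ge0.
  have c1 := ler_wpM2l c0 L3.
  have c2 : 1 * (P * s2 * L ^+ 3) <= s1 * (P * s2 * L ^+ 3).
    by apply: ler_wpM2r => //; apply: mulr_ge0 => //; apply: exprn_ge0; lra.
  lra.
move: (TA.+1%:R * _) h1 => u h1; lra.
Qed.

(** The rates are [1 / 6] for the innermost loop and [a2 / 4], [a1 / 4] for the
    two accelerated ones, where [1 / a1] and [1 / a2] are proportional to the
    square roots of the condition numbers: this is where the square roots of
    the bound come from. *)
Lemma schedule_exists (R : realType) (l mux mu Dx Dy eps k1 k2 delta tau x P : R) :
  0 < mux -> mux <= l -> 0 < mu -> 0 < eps -> 4 * (mu * Dy ^+ 2) = eps ->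
  200 <= l * Dy ^+ 2 / eps ->
  k1 = l / mux -> k2 = l / mu -> delta = eps / 2 / (10 * k1 * k2) ^+ 4 ->
  tau = delta / (45 * k2) ^+ 7 -> x = k1 * l * (Dx ^+ 2 + Dy ^+ 2) / eps ->
  P = 31%:R + 2 ->
  exists a1 a2 : R, [/\ 0 < a1, 4 * l * a1 ^+ 2 = mux, 0 < a2 & 72 * l * a2 ^+ 2 = mu] /\
  exists TX TY TA TF : nat,
  [/\ l * Dx ^+ 2 * (5 / 6) ^+ TX <= tau / 21,
      18 * l * Dy ^+ 2 * (1 - a2 / 4) ^+ TY <= 32 * tau / a2,
      4 * l * Dx ^+ 2 * (1 - a1 / 4) ^+ TA <= 8 * k1 ^+ 2 * delta,
      24 * k2 ^+ 3 * (l * Dy ^+ 2) * (1 - (Num.sqrt k2)^-1 / 4) ^+ TF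
        <= eps / 2 / (10 ^+ 2 * k1 * k2) &
      forall N, (N <= TA.+1 * (TY.+1 * (4 * TX.+1 + 2) + 1) + 2 * TF.+1 + 1)%N ->
      N%:R <= (7 * 8 * 36 * 6 * P ^+ 3 + 12 * P) *
              (Num.sqrt k1 * Num.sqrt k2 * ln x ^+ 3)].
Proof.
move=> mux0 muxl mu0 eps0 muD hq k1E k2E dE tE xE PE.
have l0 : 0 < l by exact: lt_le_trans muxl.
have P0 : 0 <= P by rewrite PE addr_ge0.
have k11 : 1 <= k1 by rewrite k1E ler_pdivlMr // mul1r.
have k24 : k2 = 4 * (l * Dy ^+ 2 / eps).
  have Dn : Dy != 0.
    by apply/eqP => D0; move: eps0; rewrite -muD D0 expr0n /= !mulr0 ltxx.
  by rewrite k2E -muD; field; rewrite Dn gt_eqF.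
have k21 : 1 <= k2 by rewrite k24; clear -hq; lra.
have p0 : 0 <= l * Dx ^+ 2 / eps.
  by apply: divr_ge0; [apply: mulr_ge0; [exact: ltW|exact: sqr_ge0]|exact: ltW].
have xE' : x = k1 * (l * Dx ^+ 2 / eps + l * Dy ^+ 2 / eps).
  by rewrite xE; field; rewrite gt_eqF.
have tE' : tau = eps / 2 / (10 * k1 * k2) ^+ 4 / (45 * k2) ^+ 7 by rewrite tE dE.
have [x200 bX bY bF] := tolerance_polynomial k11 eps0 p0 hq k24 xE' tE'.
rewrite !mulfVK ?gt_eqF // in bX bY bF.
have [tau0 taud taue] := tolerance_order k11 k21 eps0 dE tE.
have {x200} x4 : 4 <= x by clear -x200; lra.
have {p0 xE' tE' hq k24 muD xE} L1 := ln_ge1 x4.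
have k10 : 0 < k1 by apply: lt_le_trans k11.
have k20 : 0 < k2 by apply: lt_le_trans k21.
have [s1 [s1p s1E]] : exists s : R, s = Num.sqrt k1 /\ s ^+ 2 = k1.
  by exists (Num.sqrt k1); rewrite sqr_sqrtr // ltW.
have [s2 [s2p s2E]] : exists s : R, s = Num.sqrt k2 /\ s ^+ 2 = k2.
  by exists (Num.sqrt k2); rewrite sqr_sqrtr // ltW.
have s11 : 1 <= s1 by rewrite s1p -sqrtr1 ler_sqrt // ltW.
have s21 : 1 <= s2 by rewrite s2p -sqrtr1 ler_sqrt // ltW.
have s10 : 0 < s1 by exact: lt_le_trans s11.
have s20 : 0 < s2 by exact: lt_le_trans s21.
(* the constant of the rate a2, from 72 * l * a2 ^ 2 = mu *)
have [r [r0 rE r1 r9]] : exists r : R, [/\ 0 < r, r ^+ 2 = 72, 1 <= r & r <= 9].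
  have h : (Num.sqrt 72) ^+ 2 = 72 :> R by rewrite sqr_sqrtr.
  exists (Num.sqrt 72); split; rewrite ?sqrtr_gt0 //.
    by apply: ler_abs_sq; [exact: sqrtr_ge0|rewrite h; clear; lra].
  by apply: ler_abs_sq => //; rewrite h; clear; lra.
rewrite -s1p -s2p; clear s1p s2p.
exists (2 * s1)^-1, (r * s2)^-1; split.
  split.
  - by rewrite invr_gt0 mulr_gt0.
  - by rewrite exprVn exprMn s1E k1E; field; rewrite !gt_eqF.
  - by rewrite invr_gt0 mulr_gt0.
  - by rewrite exprVn exprMn s2E rE k2E; field; rewrite !gt_eqF.
have [a1 a1E] : exists a : R, a = (2 * s1)^-1 by exists (2 * s1)^-1.
have [a2 a2E] : exists a : R, a = (r * s2)^-1 by exists (r * s2)^-1.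
rewrite -a1E -a2E.
have a10 : 0 < a1 by rewrite a1E invr_gt0 mulr_gt0.
have a20 : 0 < a2 by rewrite a2E invr_gt0 mulr_gt0.
have a11 : a1 <= 1 by rewrite a1E invf_le1 ?mulr_gt0 //; clear -s11; lra.
have a21 : a2 <= 1.
  by rewrite a2E invf_le1 ?mulr_gt0 // -[leLHS]mulr1; apply: ler_pM.
have rate (a : R) : 0 < a -> a <= 1 -> 0 < a / 4 <= 1.
  by clear => h h'; apply/andP; split; [exact: divr_gt0|lra].
have r6 : 0 < (6^-1 : R) <= 1 by apply/andP; split; clear; lra.
have lDx : 0 <= l * Dx ^+ 2 by apply: mulr_ge0; [exact: ltW|exact: sqr_ge0].
have lDy : 0 <= l * Dy ^+ 2 by apply: mulr_ge0; [exact: ltW|exact: sqr_ge0].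
have l18x : 0 <= 18 * (l * Dx ^+ 2) by exact: mulr_ge0.
have l18y : 0 <= 18 * (l * Dy ^+ 2) by exact: mulr_ge0.
have lF : 0 <= 24 * k2 ^+ 3 * (l * Dy ^+ 2).
  by apply: mulr_ge0 => //; apply: mulr_ge0 => //; apply: exprn_ge0; exact: ltW.
have bX1 : l * Dx ^+ 2 <= tau / 21 * x ^+ 31.
  by apply: le_trans bX; rewrite ler_peMl // ler1n.
have rF : 0 < s2^-1 / 4 <= 1 by apply: rate; rewrite ?invr_gt0 // invf_le1.
have [TX [hTX cTX]] := iteration_count r6 x4 lDx bX1.
have [TY [hTY cTY]] := iteration_count (rate _ a20 a21) x4 l18y bY.
have [TA [hTA cTA]] := iteration_count (rate _ a10 a11) x4 l18x bX.
have [TF [hTF cTF]] := iteration_count rF x4 lF bF.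
rewrite -PE in cTX cTY cTA cTF.
exists TX, TY, TA, TF; split.
- by have -> : 5 / 6 = 1 - 6^-1 :> R by field.
- rewrite -(mulrA 18); apply: (le_trans hTY).
  have : 32 * tau * 1 <= 32 * tau / a2.
    apply: ler_wpM2l; first by apply: mulr_ge0 => //; exact: ltW.
    by rewrite -[leLHS]invr1 lef_pV2 ?posrE.
  by move: (32 * tau / a2) tau0; clear => u; lra.
- have r00 : 0 <= (1 - a1 / 4) ^+ TA.
    by apply: exprn_ge0; move: a11; clear; lra.
  have h1 : 4 * l * Dx ^+ 2 <= 18 * (l * Dx ^+ 2) by move: lDx; clear; lra.
  apply: (le_trans (ler_wpM2r r00 h1)); apply: (le_trans hTA).
  have : 1 * tau <= k1 ^+ 2 * delta.
    by apply: ler_pM => //; [exact: ltW|exact: exprn_ege1].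
  by move: tau0; clear; lra.
- exact: le_trans hTF taue.
- move=> N hN; apply: (total_count P0 s11 (ltW s20) L1 hN).
  + by apply: (le_trans cTX); rewrite invrK (mulrC P).
  + apply: (le_trans cTY).
    have -> : P / (a2 / 4) * ln x = 4 * (r * (P * s2 * ln x)).
      by rewrite a2E; field; rewrite !gt_eqF.
    have u0 : 0 <= P * s2 * ln x.
      apply: mulr_ge0; [apply: mulr_ge0 => //; exact: ltW|exact: le_trans L1].
    by have := ler_wpM2r u0 r9; clear; lra.
  + apply: (le_trans cTA); rewrite a1E.
    have -> : P / ((2 * s1)^-1 / 4) * ln x = 8 * P * s1 * ln x.
      by field; rewrite gt_eqF.
    exact: lexx.
  + apply: (le_trans cTF).
    have -> : P / (s2^-1 / 4) * ln x = 4 * P * s2 * ln x.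
      by field; rewrite gt_eqF.
    exact: lexx.
Qed.

Theorem corollary5p2 (R : realType) :
  exists C K : R, 0 < C /\ 0 < K /\
  forall (m n : nat) (f : 'rV[R]_m -> 'rV[R]_n -> R)
    (X : set 'rV[R]_m) (Y : set 'rV[R]_n) (ell mux eps : R)
    (x0 : 'rV[R]_m) (y0 : 'rV[R]_n),
  (0 < m)%N ->
  smooth ell (joint f) ->
  X !=set0 -> closed X -> convex_set X -> bounded_set X ->
  Y !=set0 -> closed Y -> convex_set Y -> bounded_set Y ->
  0 < diam Y ->
  0 < mux ->
  (forall y, Y y -> strongly_convex mux (f^~ y)) ->
  (forall x, X x -> strongly_concave 0 (f x)) ->
  X x0 -> Y y0 ->
  0 < eps ->
  (* small eps: the range in which the O-bound is asserted *)
  K <= ell * diam Y ^+ 2 / eps ->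
  exists T : nat, (0 < T)%N /\
  exists (xh : 'rV[R]_m) (yh : 'rV[R]_n) (N : nat),
  [/\ Minimax_APPA (f_eps f Y y0 eps) X Y x0 y0 ell mux
        (eps / (4 * diam Y ^+ 2)) (eps / 2) T xh yh N,
      saddle_point X Y f eps xh yh &
      let kx := ell / mux in
      N%:R <= C * (Num.sqrt (kx * ell / eps) * diam Y *
                   ln (kx * ell * (diam X ^+ 2 + diam Y ^+ 2) / eps) ^+ 3)].
Proof.
(* 31 is the power of the argument of the logarithm that bounds the accuracy
   required from every loop *)
have [P [P0 PE]] : exists P : R, 0 < P /\ P = 31%:R + 2.
  by exists (31%:R + 2); split => //; rewrite addr_gt0.
have [C [C0 CE]] : exists C : R, 0 < C /\
    2 * (7 * 8 * 36 * 6 * P ^+ 3 + 12 * P) = C.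
  exists (2 * (7 * 8 * 36 * 6 * P ^+ 3 + 12 * P)); split => //.
  have P3 : 0 < P ^+ 3 by exact: exprn_gt0.
  by rewrite mulr_gt0 // addr_gt0 // mulr_gt0 // !mulr_gt0.
exists C, (128 ^+ 2); split => //.
split; first exact: exprn_gt0.
move=> m n f X Y l mux eps x0 y0 m0 fs X0 Xc Xv Xbd Y0 Yc Yv Ybd D0 mux0.
move=> fx fy Xx0 Yy0 eps0 hK.
have Xb := convex_bodyP X0 Xc Xv Xbd; have Yb := convex_bodyP Y0 Yc Yv Ybd.
have flo y : Y y -> quadratic_lower mux (f^~ y).
  by move=> Yy x x'; have [_ /(_ x x')] := fx y Yy; rewrite dotC.
have fco x : X x -> quadratic_lower 0 (fun y => - f x y).
  by move=> Xx y y'; have [_ /(_ y y')] := fy x Xx; rewrite dotC.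
have muxl := strongly_convex_le_smooth m0 fs (flo y0 Yy0).
have l0 : 0 < l by exact: lt_le_trans muxl.
have D20 : 0 < diam Y ^+ 2 by exact: exprn_gt0.
have [mu muE] : exists mu, mu = eps / (4 * diam Y ^+ 2).
  by exists (eps / (4 * diam Y ^+ 2)).
have mu0 : 0 < mu by rewrite muE; apply: divr_gt0 => //; exact: mulr_gt0.
have muD : 4 * (mu * diam Y ^+ 2) = eps by rewrite muE; field; rewrite gt_eqF.
have K200 : 200 <= 128 ^+ 2 :> R.
  by rewrite expr2; apply: (@le_trans _ _ (10 * 20)); [|apply: ler_pM]; clear; lra.
have lmu : 128 ^+ 2 * mu <= l.
  have -> : l = 4 * (l * diam Y ^+ 2 / eps) * mu.
    by rewrite -muD; field; rewrite !gt_eqF.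
  apply: ler_wpM2r; first exact: ltW.
  by move: hK K200; clear; move: (128 ^+ 2) (l * _ / _) => u v; lra.
have e20 : 0 < eps / 2 by exact: divr_gt0.
have [a1 [a2 [[a10 a1E a20 a2E] [TX [TY [TA [TF [hTX hTY hTA hTF hN]]]]]]]] :=
  @schedule_exists R l mux mu (diam X) (diam Y) eps (l / mux) (l / mu)
  (eps / 2 / (10 * (l / mux) * (l / mu)) ^+ 4) _ _ P
  mux0 muxl mu0 eps0 muD (le_trans K200 hK) erefl erefl erefl erefl erefl PE.
pose F := f_eps f Y y0 eps.
have FE u v : F u v = f u v - mu * enorm (v - y0) ^+ 2 + 0 * enorm (u - 0) ^+ 2.
  by rewrite mul0r addr0 muE.
have Fs : saddle_smooth F X Y mux l (2 * mu) (l + 2 * mu) l.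
  have := saddle_smooth_regularized fs (lexx 0) (ltW mu0) flo fco FE.
  by rewrite !mulr0 !addr0.
have flT y : setT y -> quadratic_lower (- (2 * (l / 2))) (f^~ y).
  by move=> _; apply: expands_lower; exact: partial_expands_x.
have gE s u v : F u v + l * enorm (u - s) ^+ 2 =
    f u v - mu * enorm (v - y0) ^+ 2 + l * enorm (u - s) ^+ 2.
  by rewrite FE mul0r addr0.
have ps s : saddle_smooth (fun u v => F u v + l * enorm (u - s) ^+ 2) X setT
    l (3 * l) (2 * mu) (l + 2 * mu) l.
  have := saddle_smooth_regularized fs (ltW l0) (ltW mu0) flT fco (gE s).
  have -> : - (2 * (l / 2)) + 2 * l = l by field.
  by have -> : l + 2 * l = 3 * l by ring.
have psY s : saddle_smooth (fun u v => F u v + l * enorm (u - s) ^+ 2) X Y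
    (mux + 2 * l) (3 * l) (2 * mu) (l + 2 * mu) l.
  have := saddle_smooth_regularized fs (ltW l0) (ltW mu0) flo fco (gE s).
  by have -> : l + 2 * l = 3 * l by ring.
have m20 : 0 < 2 * mu by exact: mulr_gt0.
have ml0 : 0 <= l + 2 * mu by rewrite addr_ge0 // ltW.
have [xs [ys [Xxs Yys xsmin ysmax _]]] :=
  saddle_exists Fs Xb Yb (fun y h => h) mux0 m20 (ltW l0) ml0.
have [xh [yh [N [h1 Xxh Yyh h2 h3]]]] := minimax_run l0 mux0 muxl mu0 lmu e20 Xb Yb
  Xx0 Yy0 Fs ps psY a10 a1E a20 a2E hTX hTY hTA hTF Xxs Yys xsmin ysmax.
exists TA.+1; split => //; exists xh, yh, N; split.
- by rewrite -muE.
- split => //.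
  have hf u v : X u -> Y v -> f xh v - f u yh <= eps.
    move=> Xu Yw; have := h2 u v Xu Yw; rewrite !FE !mul0r !addr0.
    have : mu * enorm (v - y0) ^+ 2 <= mu * diam Y ^+ 2.
      rewrite ler_pM2l // lerXn2r ?nnegrE ?enorm_ge0 ?(ltW D0) //.
      exact: diamP.
    move: (mulr_ge0 (ltW mu0) (sqr_ge0 (enorm (yh - y0)))) muD eps0.
    by clear; lra.
  rewrite lerBlDr addrC -lerBlDr; apply: lb_le_inf; first by exists (f x0 yh), x0.
  move=> _ [u Xu <-]; rewrite lerBlDr; apply: ge_sup; first by exists (f xh y0), y0.
  by move=> _ [v Yw <-]; have := hf u v Xu Yw; clear; lra.
- move=> kx; apply: (le_trans (hN _ h3)).
  have -> : Num.sqrt (kx * l / eps) * diam Y = Num.sqrt (l / mux) * Num.sqrt (l / mu) / 2.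
    have kx0 : 0 < l / mux by exact: divr_gt0.
    rewrite -sqrtrM ?(ltW kx0) //.
    have -> : l / mux * (l / mu) = kx * l / eps * (2 * diam Y) ^+ 2.
      by rewrite /kx -muD; field; rewrite !gt_eqF.
    have kle : 0 <= kx * l / eps.
      by apply: divr_ge0; [apply: mulr_ge0; exact: ltW|exact: ltW].
    rewrite (sqrtrM _ kle) sqrtr_sqr ger0_norm; last by rewrite mulr_ge0 // ltW.
    by field.
  rewrite -CE -/kx; move: (_ + 12 * P) (Num.sqrt _) (Num.sqrt _) (ln _) => c u v w.
  by rewrite le_eqVlt; apply/orP; left; apply/eqP; field.
Qed.
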